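(* Let $d\ge 2$. Additive actions on hypersurfaces of degree $d$ in $\mathbb{P}^{n+1}$ are in natural one-to-one correspondence with pairs $(R,F)$, where $R$ is a local algebra of dimension $n+2$ and $F$ is an irreducible invariant $d$-linear form on $R$ up to a scalar.
   Context: The ground field $\mathbb{K}$ is algebraically closed of characteristic zero, $\mathbb{G}_a=(\mathbb{K},+)$, and $\mathbb{G}_a^n$ is the $n$-dimensional commutative unipotent group. A local algebra is a finite-dimensional commutative associative local $\mathbb{K}$-algebra with unit; $\mathfrak{m}$ denotes its maximal ideal, and dimension means $\mathbb{K}$-dimension. Hypersurfaces are closed and irreducible. Additive action: an additive action on a hypersurface $H\subseteq\mathbb{P}^{n+1}$ is an effective action $\mathbb{G}_a^n\times\mathbb{P}^{n+1}\to\mathbb{P}^{n+1}$ such that $H$ is $\mathbb{G}_a^n$-invariant and the induced action on $H$ has an open orbit. Two additive actions on $H$ are equivalent if one is obtained from the other via an automorphism of $\mathbb{P}^{n+1}$ preserving $H$. Invariant form: an invariant $d$-linear form on a local algebra $R$ is a $d$-linear symmetric map $F\colon R\times\cdots\times R\to\mathbb{K}$ such that $F(1,1,\ldots,1)=0$, the restriction of $F$ to $\mathfrak{m}$ is nonzero, and there exists a hyperplane $W$ in $\mathfrak{m}$ (a linear subspace of codimension one) which generates $R$ as an algebra with unit and such that $$F(ab_1,b_2,\ldots,b_d)+F(b_1,ab_2,\ldots,b_d)+\cdots+F(b_1,b_2,\ldots,ab_d)=0\quad\text{for all } a\in W,\ b_1,\ldots,b_d\in R.$$ In this case $F$ is said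 to be invariant with respect to $W$. Irreducible: if $F_1$ and $F_2$ are invariant $d_1$-linear and $d_2$-linear forms on $R$ with respect to the same hyperplane $W$, then the product $F_1F_2$ defines an invariant $(d_1+d_2)$-linear form (the symmetric multilinear form whose associated polynomial is $F_1(v,\ldots,v)F_2(v,\ldots,v)$). An invariant multilinear form is irreducible if it cannot be represented as such a product. The correspondence. An additive action on a hypersurface $H$ of degree $d\ge 2$ comes from a faithful rational representation of $\mathbb{G}_a^n$ on $\mathbb{K}^{n+2}$ which is a cyclic module. The associative algebra with unit $R$ generated by the image $W$ of the Lie algebra of $\mathbb{G}_a^n$ is local of dimension $n+2$, $W$ is a hyperplane in $\mathfrak{m}$, and $\mathbb{K}^{n+2}$ is identified with $R$ by applying elements of $R$ to a cyclic vector (which corresponds to $1$); the group acts by multiplication by elements of $\exp(W)$. Let $x_0$ be the coordinate along $\langle 1\rangle$ in $R=\langle 1\rangle\oplus\mathfrak{m}$. The form $F$ is the polarization (the unique symmetric $d$-linear form with $F(v,\ldots,v)=f(v)$) of the irreducible homogeneous polynomial $f$ of degree $d$ defining the hypersurface, where one may assume that $f$ does not contain the term $x_0^d$. Conversely, given $(R,F)$, take $W$ from the definition of an invariant form; the group $\exp(W)\cong\mathbb{G}_a^n$ acts on $\mathbb{P}(R)\cong\mathbb{P}^{n+1}$ by multiplication and the hypersurface is given by $F(v,\ldots,v)=0$.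
   Formalization: A form counts as irreducible only if it is not a product of two forms satisfying all conditions of invariance except F_i(1,…,1)=0 (with that condition kept for the factors the claim fails); actions are compared up to automorphisms of P^{n+1} and of G_a^n. *)

(* Defs.v *)
From HB Require Import structures.
From mathcomp Require Import all_boot all_order all_algebra all_fingroup all_field.
From mathcomp Require Import mpoly.

Set Implicit Arguments.
Unset Strict Implicit.
Unset Printing Implicit Defensive.

Import GRing.Theory.
Local Open Scope ring_scope.

(* Vectors are row vectors; matrices act on them from the right.               *)

Section ProjectiveSpace.

Variables (K : fieldType) (N : nat).

(* P^(N-1), as the set of lines of K^N. *)
Definition proj := {L : {vspace 'rV[K]_N} | \dim L == 1%N}.

Definition vanishes_at (p : {mpoly K[N]}) (L : proj) : Prop :=
  forall x : 'rV[K]_N, x \in val L -> p.@[x 0] = 0.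

Definition zariski_closed (Z : proj -> Prop) : Prop :=
  exists S : {mpoly K[N]} -> Prop,
    (forall p, S p -> exists e, p \is e.-homog) /\
    (forall L, Z L <-> forall p, S p -> vanishes_at p L).

Definition irreducible_mpoly (f : {mpoly K[N]}) : Prop :=
  [/\ f != 0, f \isn't a GRing.unit
    & forall g h, f = g * h -> g \is a GRing.unit \/ h \is a GRing.unit].

Definition defining_equation (d : nat) (f : {mpoly K[N]}) (H : proj -> Prop) :=
  [/\ f \is d.-homog, irreducible_mpoly f
    & forall L, H L <-> vanishes_at f L].

Definition hypersurface (d : nat) (H : proj -> Prop) : Prop :=
  exists f, defining_equation d f H.

End ProjectiveSpace.

Section Morphisms.

Variables (K : fieldType) (k N : nat).

(* Value at (g, x) of a polynomial in N variables whose coefficients are      *)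
(* polynomials in k further variables.                                        *)
Definition bieval (p : {mpoly {mpoly K[k]}[N]}) (g : 'rV[K]_k) (x : 'rV[K]_N) :
  K := (map_mpoly (meval (g 0)) p).@[x 0].

(* phi is a morphism of varieties A^k x P^(N-1) -> P^(N-1): on a principal    *)
(* open neighbourhood h != 0 of any given point, it is given by N polynomials *)
(* which are homogeneous of the same degree in the projective coordinates.    *)
(* They have no common zero there, as the line on the left is not zero.       *)
Definition morphism_AP (phi : 'rV[K]_k -> proj K N -> proj K N) : Prop :=
  forall (g0 : 'rV[K]_k) (L0 : proj K N),
  exists (e e' : nat) (p : 'I_N -> {mpoly {mpoly K[k]}[N]})
         (h : {mpoly {mpoly K[k]}[N]}),
    [/\ forall i, p i \is e.-homog,
        h \is e'.-homog,
        forall x : 'rV[K]_N, val L0 = <[x]>%VS -> bieval h g0 x != 0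
      & forall (g : 'rV[K]_k) (L : proj K N) (x : 'rV[K]_N),
          val L = <[x]>%VS -> bieval h g x != 0 ->
          val (phi g L) = <[\row_i bieval (p i) g x]>%VS].

Definition polynomial_map (s : 'rV[K]_k -> 'rV[K]_k) : Prop :=
  exists p : 'I_k -> {mpoly K[k]}, forall g i, s g 0 i = (p i).@[g 0].

(* Automorphisms of the algebraic group G_a^k. *)
Definition Ga_automorphism (s : 'rV[K]_k -> 'rV[K]_k) : Prop :=
  [/\ {morph s : g h / g + h}, polynomial_map s
    & exists t, [/\ cancel s t, cancel t s & polynomial_map t]].

End Morphisms.

(* Endomorphisms of P^(N-1) are the morphisms A^0 x P^(N-1) -> P^(N-1).       *)
Definition proj_automorphism (K : fieldType) (N : nat)
    (phi : proj K N -> proj K N) : Prop :=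
  exists psi : proj K N -> proj K N,
    [/\ cancel phi psi, cancel psi phi,
        morphism_AP (fun _ : 'rV[K]_0 => phi)
      & morphism_AP (fun _ : 'rV[K]_0 => psi)].

Record additive_action (K : fieldType) (n d : nat) := AdditiveAction {
  hsurf : proj K n.+2 -> Prop;
  aact : 'rV[K]_n -> proj K n.+2 -> proj K n.+2;
  hsurfP : hypersurface d hsurf;
  aact_morphism : morphism_AP aact;
  aact0 : forall L, aact 0 L = L;
  aactD : forall g h L, aact (g + h) L = aact g (aact h L);
  aact_effective : forall g, (forall L, aact g L = L) -> g = 0;
  aact_invariant : forall g L, hsurf L -> hsurf (aact g L);
  aact_open_orbit : exists L0, hsurf L0 /\
    exists Z, zariski_closed Z /\
      forall L, (exists g, L = aact g L0) <-> hsurf L /\ ~ Z L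
}.

(* "One is obtained from the other via an automorphism of P^(n+1)" identifies *)
(* the two transformation groups, so G_a^n may be reparametrized by an        *)
(* automorphism s. For hsurf X = hsurf Y the automorphism preserves hsurf X.  *)
Definition equivalent_actions (K : fieldType) (n d : nat)
    (X Y : additive_action K n d) : Prop :=
  exists (phi : proj K n.+2 -> proj K n.+2) (s : 'rV[K]_n -> 'rV[K]_n),
    [/\ proj_automorphism phi, Ga_automorphism s,
        forall L, hsurf X L <-> hsurf Y (phi L)
      & forall g L, phi (aact X g L) = aact Y (s g) (phi L)].

Definition is_ideal (K : fieldType) (R : falgType K) (I : {vspace R}) : Prop :=
  forall a x : R, x \in I -> a * x \in I.

Definition maximal_ideal (K : fieldType) (R : falgType K) (I : {vspace R}) :=
  [/\ is_ideal I, I != fullv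
    & forall J : {vspace R}, is_ideal J -> (I <= J)%VS -> J = I \/ J = fullv].

Record local_algebra (K : fieldType) := LocalAlgebra {
  la_sort :> falgType K;
  la_mulC : commutative (fun x y : la_sort => x * y);
  la_max : {vspace la_sort};
  la_maxP : maximal_ideal la_max;
  la_max_unique : forall J, maximal_ideal J -> J = la_max
}.

Section Forms.

Variables (K : fieldType) (R : local_algebra K).

Notation form d := ({ffun 'I_d -> R} -> K).

Definition upd d (b : {ffun 'I_d -> R}) (i : 'I_d) (x : R) : {ffun 'I_d -> R} :=
  [ffun j => if j == i then x else b j].

Definition diag d (x : R) : {ffun 'I_d -> R} := [ffun=> x].

Definition symmetric_multilinear d (F : form d) : Prop :=
  (forall b i c x y,
     F (upd b i (c *: x + y)) = c * F (upd b i x) + F (upd b i y)) /\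
  (forall (s : 'S_d) (b : {ffun 'I_d -> R}), F [ffun i => b (s i)] = F b).

(* [agenv W] is the subalgebra with unit generated by W. *)
Definition generating_hyperplane (W : {vspace R}) : Prop :=
  [/\ (W <= la_max R)%VS, \dim (la_max R) = (\dim W).+1 & agenv W = fullv].

(* Invariance with respect to W, without the condition F(1, ..., 1) = 0.      *)
Definition preinvariant_wrt d (W : {vspace R}) (F : form d) : Prop :=
  [/\ symmetric_multilinear F,
      exists b : {ffun 'I_d -> R}, (forall i, b i \in la_max R) /\ F b != 0,
      generating_hyperplane W
    & forall a (b : {ffun 'I_d -> R}), a \in W ->
        \sum_(i < d) F (upd b i (a * b i)) = 0].

Definition invariant_wrt d (W : {vspace R}) (F : form d) : Prop :=
  F (diag d 1) = 0 /\ preinvariant_wrt W F.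

Definition invariant_form d (F : form d) : Prop := exists W, invariant_wrt W F.

Definition is_product d d1 d2 (F : form d) (F1 : form d1) (F2 : form d2) :=
  d = (d1 + d2)%N /\
  forall v, F (diag d v) = F1 (diag d1 v) * F2 (diag d2 v).

(* The factors are not required to vanish at (1, ..., 1): in K[x]/(x^3), with *)
(* q = x_0 x_2 - x_1^2 / 2 and W = <x>, both q and q - x_0^2 satisfy the      *)
(* remaining conditions, and so the invariant form with associated polynomial *)
(* q (q - x_0^2), whose zero locus is a union of two conics, is reducible.    *)
Definition irreducible_form d (F : form d) : Prop :=
  invariant_form F /\
  ~ exists (d1 d2 : nat) (W : {vspace R}) (F1 : form d1) (F2 : form d2),
      [/\ (0 < d1)%N && (0 < d2)%N,
          preinvariant_wrt W F1, preinvariant_wrt W F2 & is_product F F1 F2].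

(* exp(x) for x in the maximal ideal: then x ^+ k = 0 for k >= \dim {:R}.     *)
Definition nexp (x : R) : R :=
  \sum_(k < \dim {:R}) (k`!%:R : K)^-1 *: x ^+ k.

End Forms.

Record form_pair (K : fieldType) (n d : nat) := FormPair {
  fp_alg : local_algebra K;
  fp_dim : \dim {: fp_alg} = n.+2;
  fp_form : {ffun 'I_d -> fp_alg} -> K;
  fp_irr : irreducible_form fp_form
}.

Arguments fp_form {K n d} f.

(* Equality of pairs (R, F): isomorphism of algebras, and F up to a scalar.   *)
Definition equivalent_pairs (K : fieldType) (n d : nat)
    (p q : form_pair K n d) : Prop :=
  exists (phi : {lrmorphism fp_alg p -> fp_alg q}) (c : K),
    [/\ bijective phi, c != 0
      & forall b : {ffun 'I_d -> fp_alg p}, fp_form q [ffun i => phi (b i)] = c * fp_form p b].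

(* A polynomial matrix P, read as the map g |-> P(g), and the image of the    *)
(* Lie algebra of G_a^n under its differential at 0.                          *)
Definition rep (K : fieldType) (n N : nat) (P : 'M[{mpoly K[n]}]_N)
    (g : 'rV[K]_n) : 'M[K]_N := map_mx (meval (g 0)) P.

Definition partial0 (K : fieldType) (n N : nat) (P : 'M[{mpoly K[n]}]_N)
    (i : 'I_n) : 'M[K]_N :=
  map_mx (fun p : {mpoly K[n]} => p^`M(i).@[fun=> 0]) P.

Definition lie_image (K : fieldType) (n N : nat)
    (P : 'M[{mpoly K[n]}]_N.+1) : {vspace 'M[K]_N.+1} :=
  <<[seq partial0 P i | i <- enum 'I_n]>>%VS.

(* From actions to pairs: P is a faithful rational representation inducing    *)
(* the action, v0 a cyclic vector lying over the hypersurface (this is the    *)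
(* normalization that f has no term x_0^d), Phi identifies R with the algebra *)
(* generated by the image of the Lie algebra, r |-> v0 * Phi r identifies R   *)
(* with K^(n+2), and F is the polarization of the equation f in R.            *)
Definition pair_of_action (K : fieldType) (n d : nat)
    (X : additive_action K n d) (p : form_pair K n d) : Prop :=
  exists (P : 'M[{mpoly K[n]}]_n.+2) (v0 : 'rV[K]_n.+2) (f : {mpoly K[n.+2]})
         (Phi : {lrmorphism fp_alg p -> 'M[K]_n.+2}),
    [/\ [/\ rep P 0 = 1%:M,
            forall g h, rep P (g + h) = rep P g *m rep P h,
            injective (rep P)
          & forall g (L : proj K n.+2) (x : 'rV[K]_n.+2), val L = <[x]>%VS ->
              val (aact X g L) = <[x *m rep P g]>%VS],
        forall x, exists2 A, A \in agenv (lie_image P) & x = v0 *m A,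
        injective Phi /\
          (forall A, A \in agenv (lie_image P) <-> exists r, A = Phi r),
        defining_equation d f (hsurf X) /\ f.@[v0 0] = 0
      & forall r, fp_form p (diag d r) = f.@[(v0 *m Phi r) 0]].

(* From pairs to actions: iota identifies G_a^n with W, hence with exp(W),    *)
(* which acts on R by multiplication; psi identifies P(R) with P^(n+1).       *)
Definition action_of_pair (K : fieldType) (n d : nat)
    (p : form_pair K n d) (X : additive_action K n d) : Prop :=
  exists (W : {vspace fp_alg p}) (iota : {linear 'rV[K]_n -> fp_alg p})
         (psi : {linear fp_alg p -> 'rV[K]_n.+2}),
    [/\ invariant_wrt W (fp_form p),
        injective iota /\ (forall a, a \in W <-> exists g, a = iota g),
        bijective psi,
        forall g (L : proj K n.+2) r, val L = <[psi r]>%VS ->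
          val (aact X g L) = <[psi (nexp (iota g) * r)%R]>%VS
      & forall (L : proj K n.+2) r, val L = <[psi r]>%VS ->
          (hsurf X L <-> fp_form p (diag d r) = 0)].

(* The relations ab and ba induce mutually inverse maps between the classes   *)
(* of A modulo eqA and the classes of B modulo eqB.                           *)
Definition one_to_one_correspondence (A B : Type)
    (eqA : A -> A -> Prop) (eqB : B -> B -> Prop)
    (ab : A -> B -> Prop) (ba : B -> A -> Prop) : Prop :=
  [/\ (forall a, exists b, ab a b) /\ (forall b, exists a, ba b a),
      forall a a' b b', ab a b -> ab a' b' -> eqA a a' -> eqB b b',
      forall b b' a a', ba b a -> ba b' a' -> eqB b b' -> eqA a a',
      forall a b a', ab a b -> ba b a' -> eqA a a'
    & forall b a b', ba b a -> ab a b' -> eqB b b'].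

(* Main.v *)
Require Import Defs.
From HB Require Import structures.
From mathcomp Require Import all_boot all_order all_algebra all_fingroup all_field.
From mathcomp Require Import mpoly.
From Stdlib Require Import Classical.
From mathcomp Require Import ring zify.

(* A morphism A^k x P^(N-1) -> P^(N-1) whose fibres are automorphisms is given *)
(* by a matrix of polynomials in the k parameters, because K[A^k] and the      *)
(* polynomial rings over it are factorial. Hence an additive action comes from *)
(* a rational representation, which is g |-> exp(D g) for commuting nilpotent  *)
(* D g. The open orbit is dense in a hypersurface of degree at least 2, so it  *)
(* spans K^(n+2) and any vector v0 over it is cyclic; r |-> v0 r identifies    *)
(* K^(n+2) with the local algebra R generated by W = D(K^n), and the action    *)
(* with multiplication by exp(W). Invariance of F is the derivative of         *)
(* F(exp(w) r, ..., exp(w) r) = F(r, ..., r).                                  *)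
(* Conversely, let (R, F) be given. Writing 1 + y = exp(w + s u) with w in W   *)
(* and u outside W turns F(1 + y) into a polynomial in s = s(y), and           *)
(* irreducibility of F forces the zeros of F outside the maximal ideal to be   *)
(* the multiples of elements of exp(W): the action has an open orbit.          *)
(* Finally, W is determined by F, so that isomorphisms of pairs give           *)
(* equivalences of actions. A linear map T inducing an equivalence of actions  *)
(* satisfies T(w r) = sigma(w) T(r) for w in W, so that T = T(1) phi for an    *)
(* isomorphism of algebras phi, and T(1) is a multiple of an element of        *)
(* exp(W') because F' vanishes there.                                          *)

Set Implicit Arguments.
Unset Strict Implicit.
Unset Printing Implicit Defensive.

Import GRing.Theory.
Local Open Scope ring_scope.

(** * Factorial domains *)

(** The two relations are tied together by [action_of_pair_of_action]: a pair obtained from an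
    action gives that action back. Once every action has a pair ([exists_pair_of_action]) and every
    pair an action ([exists_action_of_pair]), compatibility with equivalence and both round trips
    become comparisons of two instances of [action_of_pair]. These are settled by
    [equivalent_actions_of_pairs] and [equivalent_pairs_of_actions].

    Geometry enters through factoriality of polynomial rings. It turns the local equations of a
    morphism into global ones ([charts_global]), whose degree is one when the morphism is invertible
    ([inverse_degree_one]); removing the scalar ambiguity makes an action a rational representation
    ([rep_of_action]). It also makes an irreducible equation prime, and a prime polynomial divides
    every polynomial vanishing on its zeros ([prime_nullstellensatz]). Hence a vector over the open
    orbit is cyclic: a hyperplane containing the orbit would contain a hypersurface of degree at
    least 2 ([orbit_cyclic]).

    The passage between group and Lie algebra is polynomial, because all the operators involved are
    nilpotent. A representation is the exponential of its differential ([rep_exp]), every element of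
    1 + m is an exponential ([nexp_nlog]), and a form is unchanged by exp(W) exactly when its
    infinitesimal variation along W vanishes ([infinitesimal0_nexp], [nexp_infinitesimal0]).

    The decisive fact for the converse is [zero_exp_orbit]: outside the maximal ideal, the zeros of
    an irreducible invariant form are the nonzero multiples of elements of exp(W). It provides the
    open orbit, and it shows that a linear equivalence of actions sends 1 to a multiple of an
    exponential. Together with the uniqueness of W ([invariant_hyperplane_unique]) and the
    factorization of an intertwiner into a unit and an algebra isomorphism
    ([lrmorphism_of_intertwiner]), it matches the equivalences on the two sides. *)

Section Divisibility.

Variable A : idomainType.
Implicit Types a b p q : A.

Definition dvdr p a : Prop := exists q, a = q * p.

Definition prime_elt p : Prop :=
  [/\ p != 0, p \isn't a GRing.unit
    & forall a b, dvdr p (a * b) -> dvdr p a \/ dvdr p b].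

Definition irreducible_elt p : Prop :=
  [/\ p != 0, p \isn't a GRing.unit
    & forall a b, p = a * b -> a \is a GRing.unit \/ b \is a GRing.unit].

Lemma dvdrr p : dvdr p p. Proof. by exists 1; rewrite mul1r. Qed.

Lemma dvdr0 p : dvdr p 0. Proof. by exists 0; rewrite mul0r. Qed.

Lemma dvdr_mull p a b : dvdr p b -> dvdr p (a * b).
Proof. by case=> q ->; exists (a * q); rewrite mulrA. Qed.

Lemma dvdr_mulr p a b : dvdr p a -> dvdr p (a * b).
Proof. by rewrite mulrC; apply: dvdr_mull. Qed.

Lemma dvdrD p a b : dvdr p a -> dvdr p b -> dvdr p (a + b).
Proof. by case=> q -> [r ->]; exists (q + r); rewrite mulrDl. Qed.

Lemma dvdrN p a : dvdr p a -> dvdr p (- a).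
Proof. by case=> q ->; exists (- q); rewrite mulNr. Qed.

Lemma dvdr_sum (I : Type) (r : seq I) (P : pred I) (F : I -> A) p :
  (forall i, P i -> dvdr p (F i)) -> dvdr p (\sum_(i <- r | P i) F i).
Proof. by move=> h; elim/big_ind: _ => //; [apply: dvdr0 | apply: dvdrD]. Qed.

Lemma unit_neq0 a : a \is a GRing.unit -> a != 0.
Proof. by apply: contraTneq => ->; rewrite unitr0. Qed.

Lemma prime_elt_unitM p u : prime_elt p -> u \is a GRing.unit ->
  prime_elt (u * p).
Proof.
case=> p0 pU pP uU; split; first by rewrite mulf_neq0 // unit_neq0.
  by rewrite unitrM (negbTE pU) andbF.
move=> a b [q def_ab]; case: (pP a b); first by exists (q * u); rewrite -mulrA.
  by case=> c ->; left; exists (c / u); rewrite mulrA divrK.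
by case=> c ->; right; exists (c / u); rewrite mulrA divrK.
Qed.

Lemma prime_dvdrM p a b : prime_elt p -> dvdr p (a * b) ->
  dvdr p a \/ dvdr p b.
Proof. by case=> _ _; apply. Qed.

Lemma prime_dvdr_prod p (s : seq A) : prime_elt p -> dvdr p (\prod_(i <- s) i) ->
  exists2 i, i \in s & dvdr p i.
Proof.
move=> [p0 pU pP]; elim: s => [|x s IH].
  rewrite big_nil => -[q /esym pq]; case/negP: pU.
  by apply/unitrPr; exists q; rewrite mulrC.
rewrite big_cons => /pP[px|/IH[i si pi]]; first by exists x; rewrite ?mem_head.
by exists i; rewrite // inE si orbT.
Qed.

Definition factorial_ring : Prop := forall a, a != 0 ->
  exists u (s : seq A),
    [/\ u \is a GRing.unit, (forall p, p \in s -> prime_elt p)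
      & a = u * \prod_(p <- s) p].

Lemma irreducible_prime p : factorial_ring -> irreducible_elt p -> prime_elt p.
Proof.
move=> facA [p0 pU pI]; case: (facA p p0) => u [s [uU sP def_p]].
case: s sP def_p => [|q s] sP def_p.
  by rewrite def_p big_nil mulr1 uU in pU.
have qP : prime_elt q by apply: sP; rewrite mem_head.
rewrite big_cons mulrCA in def_p.
case: (pI _ _ def_p) => [qU|rU]; first by case: qP => _ /negP[].
by rewrite def_p mulrC; apply: prime_elt_unitM.
Qed.

Lemma prime_irreducible p : prime_elt p -> irreducible_elt p.
Proof.
case=> p0 pU pP; split=> // a b def_p.
have: dvdr p (a * b) by rewrite -def_p; apply: dvdrr.
case/pP=> -[c def_c]; move: def_p; rewrite {}def_c.
  rewrite mulrAC -{1}[p]mul1r => /(mulIf p0) /esym cb.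
  by right; apply/unitrPr; exists c; rewrite mulrC.
rewrite mulrA -{1}[p]mul1r => /(mulIf p0) /esym ac.
by left; apply/unitrPr; exists c.
Qed.

End Divisibility.

(** * Gauss's theorem: polynomials over a factorial ring *)

Section PolyFactorial.

Variable A : idomainType.
Implicit Types (a p : A) (f g h : {poly A}).

Lemma scale_poly_inj a : a != 0 -> injective (fun f => a *: f).
Proof.
move=> a0 f g; rewrite -!mul_polyC.
by have /mulfI : a%:P != 0 by [rewrite polyC_eq0]; apply.
Qed.

Lemma dvdr_polyC p f : dvdr p%:P f <-> forall i, dvdr p f`_i.
Proof.
split=> [[q ->] i|pf]; first by exists q`_i; rewrite coefMC.
rewrite -[f]coefK poly_def; apply: dvdr_sum => i _.
case: (pf i) => q ->; exists (q *: 'X^i).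
by rewrite -!mul_polyC polyCM mulrAC.
Qed.

(** Gauss's lemma, by induction on the sum of the sizes: [p] divides the product of the leading
    coefficients, hence one of them, and that leading term can be subtracted from its polynomial. *)
Lemma prime_polyC p : prime_elt p -> prime_elt p%:P.
Proof.
case=> p0 pU pP; split; rewrite ?polyC_eq0 //.
  by rewrite poly_unitE coefC eqxx (negbTE pU) andbF.
move=> f g; move: {2}(size f + size g)%N (leqnn (size f + size g)) => n.
elim: n f g => [|n IH] f g.
  by rewrite leqn0 addn_eq0 !size_poly_eq0 => /andP[/eqP-> _] _; left; apply: dvdr0.
case: (eqVneq f 0) => [-> _ _|f0]; first by left; apply: dvdr0.
case: (eqVneq g 0) => [-> _ _|g0]; first by right; apply: dvdr0.
have tl (h : {poly A}) : h != 0 ->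
    (size (h - lead_coef h *: 'X^((size h).-1))%R < size h)%N.
  move=> h0; have sh : (0 < size h)%N by rewrite size_poly_gt0.
  rewrite -[X in (_ < X)%N](prednK sh) ltnS; apply/leq_sizeP => j.
  rewrite coefB coefZ coefXn leq_eqVlt => /predU1P[<-|ltj].
    by rewrite eqxx mulr1 subrr.
  rewrite (gtn_eqF ltj) mulr0 subr0 nth_default //.
  by rewrite -(prednK sh).
have pl (h : {poly A}) : dvdr p (lead_coef h) -> dvdr p%:P (lead_coef h *: 'X^((size h).-1)).
  by case=> q ->; exists (q *: 'X^((size h).-1)); rewrite -!mul_polyC polyCM mulrAC.
move=> le_n pfg; have : dvdr p (lead_coef f * lead_coef g).
  by rewrite -lead_coefM; move/dvdr_polyC: pfg; apply.
case/pP=> [plf|plg].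
  case: (IH (f - lead_coef f *: 'X^((size f).-1)) g).
  - by rewrite -ltnS; apply: leq_trans le_n; rewrite ltn_add2r tl.
  - by rewrite mulrBl; apply: dvdrD => //; apply: dvdrN; apply: dvdr_mulr; apply: pl.
  - move=> d; left; rewrite -[f](subrK (lead_coef f *: 'X^((size f).-1))).
    by apply: dvdrD => //; apply: pl.
  - by right.
case: (IH f (g - lead_coef g *: 'X^((size g).-1))).
- by rewrite -ltnS; apply: leq_trans le_n; rewrite ltn_add2l tl.
- by rewrite mulrBr; apply: dvdrD => //; apply: dvdrN; apply: dvdr_mull; apply: pl.
- by left.
- by move=> d; right; rewrite -[g](subrK (lead_coef g *: 'X^((size g).-1))); apply: dvdrD => //; apply: pl.
Qed.

Hypothesis facA : factorial_ring A.

Lemma scale_mul_cancel a f g h : a != 0 -> a *: f = g * h ->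
  exists g' h', [/\ f = g' * h', size g' = size g & size h' = size h].
Proof.
move=> a0; have [u [s [uU sP ->]]] := facA a0.
elim: s sP g h => [|p s IH] sP g h.
  rewrite big_nil mulr1 => fE; exists (u^-1 *: g), h; split=> //.
    by rewrite -scalerAl -fE scalerA mulVr // scale1r.
  by rewrite size_scale // unit_neq0 // unitrV.
have pp : prime_elt p by apply: sP; rewrite mem_head.
have p0 : p != 0 by case: pp.
rewrite big_cons mulrCA -scalerA => fE.
have : dvdr p%:P (g * h).
  by exists ((u * \prod_(j <- s) j) *: f); rewrite -fE -mul_polyC mulrC.
have {}IH := IH (fun q sq => sP q (@mem_behead _ (p :: s) q sq)).
have szC (q : {poly A}) : size (q * p%:P) = size q.
  by rewrite mulrC mul_polyC size_scale.
have canc (q : {poly A}) : p *: ((u * \prod_(j <- s) j) *: f) = q * p%:P ->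
    (u * \prod_(j <- s) j) *: f = q.
  by rewrite [q * _]mulrC mul_polyC; apply: scale_poly_inj.
case/(prime_dvdrM (prime_polyC pp)) => -[q def_q]; rewrite {}def_q in fE *.
  rewrite mulrAC in fE; have [g' [h' [-> sg sh]]] := IH _ _ (canc _ fE).
  by exists g', h'; rewrite szC sg sh.
rewrite mulrA in fE; have [g' [h' [-> sg sh]]] := IH _ _ (canc _ fE).
by exists g', h'; rewrite szC sg sh.
Qed.

Lemma primitive_dvdr f g a : (forall p, prime_elt p -> ~ dvdr p%:P f) ->
  a != 0 -> dvdr f (a *: g) -> dvdr f g.
Proof.
move=> fprim a0; have [u [s [uU sP ->]]] := facA a0.
elim: s sP g => [|p s IH] sP g.
  rewrite big_nil mulr1 => -[q fE]; exists (u^-1 *: q).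
  by rewrite -scalerAl -fE scalerA mulVr // scale1r.
have pp : prime_elt p by apply: sP; rewrite mem_head.
have p0 : p != 0 by case: pp.
rewrite big_cons mulrCA -scalerA => -[q fE].
have : dvdr p%:P (q * f).
  by exists ((u * \prod_(j <- s) j) *: g); rewrite -fE -mul_polyC mulrC.
case/(prime_dvdrM (prime_polyC pp)) => [[r def_q]|/fprim] //.
apply: (IH (fun q sq => sP q (@mem_behead _ (p :: s) q sq))); exists r.
by apply: (scale_poly_inj p0); rewrite fE def_q -mul_polyC [r * _]mulrC mulrA.
Qed.

(** A prime constant dividing [f] divides its leading coefficient, so removing it shortens the
    factorization of the latter; the induction is on the length of that factorization. *)
Lemma primitive_part f : f != 0 -> exists a g,
  [/\ a != 0, f = a *: g & forall p, prime_elt p -> ~ dvdr p%:P g].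
Proof.
move=> f0; have lf0 : lead_coef f != 0 by rewrite lead_coef_eq0.
have [u [s [uU sP def_l]]] := facA lf0.
elim: {s}(size s) {-2}s (leqnn (size s)) sP u f uU def_l f0 lf0 =>
    [|n IH] s le_s sP u f uU def_l f0 lf0.
  exists 1, f; split; rewrite ?oner_neq0 ?scale1r // => p pp pf.
  have := (dvdr_polyC p f).1 pf (size f).-1; rewrite -lead_coefE def_l.
  move: le_s; rewrite leqn0 => /nilP->; rewrite big_nil mulr1 => -[q def_u].
  by case: pp => _ /negP[]; move: uU; rewrite def_u unitrM => /andP[].
have [[p pp pf]|nex] :=
    classic (exists2 p : A, prime_elt p & dvdr p%:P f); last first.
  exists 1, f; split; rewrite ?oner_neq0 ?scale1r // => p pp pf.
  by case: nex; exists p.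
have p0 : p != 0 by case: pp.
have := (dvdr_polyC p f).1 pf (size f).-1; rewrite -lead_coefE def_l => pl.
have : exists2 i, i \in s & dvdr p i.
  case: (pp) => _ _ /(_ _ _ pl)[[q def_u]|]; last exact: prime_dvdr_prod.
  by case: pp => _ /negP[]; move: uU; rewrite def_u unitrM => /andP[].
case=> i si [q def_i].
have qU : q \is a GRing.unit.
  have [_ _ /(_ _ _ def_i)[//|]] := prime_irreducible (sP i si).
  by case: pp => _ /negbTE->.
case: pf => g def_f.
have f'0 : g != 0 by apply: contraNneq f0 => g0; rewrite def_f g0 mul0r.
have le_s' : (size (rem i s) <= n)%N by rewrite size_rem //; case: (s) le_s.
have lE : lead_coef g = (u * q) * \prod_(j <- rem i s) j.
  apply: (mulIf p0); rewrite -[in LHS](lead_coefC p) -lead_coefM -def_f def_l.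
  by rewrite (perm_big _ (perm_to_rem si)) big_cons {1}def_i /=; ring.
have [|||a [h [a0 def_g hP]]] := IH _ le_s' _ (u * q) g _ lE f'0.
- by move=> j /mem_rem /sP.
- by rewrite unitrM uU qU.
- by rewrite lead_coef_eq0.
by exists (p * a), h; split; rewrite ?mulf_neq0 // def_f def_g mulrC mul_polyC scalerA.
Qed.

Lemma factorial_poly : factorial_ring {poly A}.
Proof.
move=> f; move: {2}(size f) (leqnn (size f)) => n.
elim: n f => [|n IH] f; first by rewrite size_poly_leq0 => /eqP->; rewrite eqxx.
move=> le_f f0.
have facC a : a != 0 -> exists u s, [/\ u \is a GRing.unit,
    (forall p : {poly A}, p \in s -> prime_elt p) & a%:P = u * \prod_(p <- s) p].
  move=> a0; have [u [s [uU sP ->]]] := facA a0.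
  exists u%:P, (map polyC s); split; first by rewrite rmorph_unit.
    by move=> p /mapP[q sq ->]; apply/prime_polyC/sP.
  by rewrite big_map polyCM rmorph_prod.
have facM (g h : {poly A}) : (exists u s, [/\ u \is a GRing.unit,
    (forall p : {poly A}, p \in s -> prime_elt p) & g = u * \prod_(p <- s) p]) ->
  (exists u s, [/\ u \is a GRing.unit,
    (forall p : {poly A}, p \in s -> prime_elt p) & h = u * \prod_(p <- s) p]) ->
  exists u s, [/\ u \is a GRing.unit,
    (forall p : {poly A}, p \in s -> prime_elt p) & g * h = u * \prod_(p <- s) p].
  case=> u [s [uU sP ->]] [v [t [vU tP ->]]]; exists (u * v), (s ++ t); split.
  - by rewrite unitrM uU vU.
  - by move=> p; rewrite mem_cat => /orP[/sP|/tP].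
  by rewrite big_cat /=; ring.
have [a [g [a0 def_f gP]]] := primitive_part f0.
have g0 : g != 0 by apply: contraNneq f0 => g0; rewrite def_f g0 scaler0.
have szg : size g = size f by rewrite def_f size_scale.
rewrite def_f -mul_polyC; apply: (facM); first exact: facC.
have [/size_poly1P[c c0 ->]|sz1] := boolP (size g == 1%N); first exact: facC.
(* A primitive [g] either splits into two factors of smaller size, covered by the induction, or is
   itself shown to be prime. *)
have [[g1 [g2 [def_g lt1 lt2]]]|nex] := classic (exists g1 g2 : {poly A},
    [/\ g = g1 * g2, (size g1 < size g)%N & (size g2 < size g)%N]).
  have := g0; rewrite {1}def_g mulf_eq0 negb_or => /andP[g10 g20].
  rewrite def_g; apply: (facM); apply: IH => //; rewrite -ltnS.
    by apply: leq_trans lt1 _; rewrite szg.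
  by apply: leq_trans lt2 _; rewrite szg.
exists 1, [:: g]; rewrite unitr1 big_seq1 mul1r; split=> // p.
rewrite inE => /eqP->{p}; split=> //.
  by rewrite poly_unitE negb_and sz1.
move=> h1 h2 [q def_h].
have dgh : (g %| h1 * h2) by rewrite def_h dvdp_mull.
have true_dvd (h : {poly A}) : (g %| h) -> dvdr g h.
  case/Pdiv.Idomain.dvdpP => -[c r] /= c0 cr.
  by apply: (primitive_dvdr gP c0); exists r.
(* The gcd divides [g] only up to a constant; cancelling this constant gives a true factorization of
   [g], in which one factor must be constant. So the gcd is either trivial or associated to [g]. *)
have /Pdiv.Idomain.dvdpP[[c r] /= c0 cr] := dvdp_gcdl g h1.
have [g1 [g2 [def_g sz1' sz2']]] := scale_mul_cancel c0 cr.
have g10 : g1 != 0 by apply: contraNneq g0 => e; rewrite def_g e mul0r.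
have g20 : g2 != 0 by apply: contraNneq g0 => e; rewrite def_g e mulr0.
have szM : size g = (size g1 + size g2).-1 by rewrite {1}def_g size_mul.
have [cop|ncop] := boolP (coprimep g h1).
  by right; apply: true_dvd; rewrite Gauss_dvdpr in dgh.
left; apply: true_dvd; rewrite /coprimep -sz2' in ncop.
have := g10; rewrite -size_poly_gt0 => s1; have := g20; rewrite -size_poly_gt0 => s2.
have [s11|s11] := eqVneq (size g1) 1%N; last first.
  case: nex; exists g1, g2; split=> //; rewrite szM -ltnS prednK ?addn_gt0 ?s1 //.
    by rewrite -addn1 addSn -addnS leq_add2l ltn_neqAle s2 andbT eq_sym.
  by rewrite -[(size g2).+1]add1n -addSn leq_add2r ltn_neqAle s1 andbT eq_sym.
have eqs : size (gcdp g h1) = size g by rewrite -sz2' szM s11.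
have : gcdp g h1 %= g by rewrite -dvdp_size_eqp ?dvdp_gcdl // eqs.
by case/andP=> _ /dvdp_trans; apply; apply: dvdp_gcdr.
Qed.

End PolyFactorial.

Section Transport.

Variables (A B : idomainType) (phi : {rmorphism A -> B}).
Hypothesis phi_bij : bijective phi.

Lemma prime_transport p : prime_elt (phi p) -> prime_elt p.
Proof.
have [psi phiK psiK] := phi_bij; case=> p0 pU pP; split.
- by apply: contraNneq p0 => ->; rewrite rmorph0.
- by apply: contra pU; apply: rmorph_unit.
move=> a b [q def_ab]; have : dvdr (phi p) (phi a * phi b).
  by exists (phi q); rewrite -!rmorphM def_ab.
case/pP=> -[c def_c]; [left|right]; exists (psi c).
  by apply: (can_inj phiK); rewrite rmorphM /= psiK.
by apply: (can_inj phiK); rewrite rmorphM /= psiK.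
Qed.

Lemma prime_rmorph p : prime_elt p -> prime_elt (phi p).
Proof.
have [psi phiK psiK] := phi_bij; case=> p0 pU pP; split.
- by rewrite -(rmorph0 phi) (inj_eq (can_inj phiK)).
- apply: contra pU => /unitrPr[y]; rewrite -(psiK y) -rmorphM -(rmorph1 phi).
  by move/(can_inj phiK) => py; apply/unitrPr; exists (psi y).
move=> a b [q]; rewrite -(psiK a) -(psiK b) -(psiK q) -!rmorphM.
move/(can_inj phiK) => def_ab; case: (pP (psi a) (psi b)); first by exists (psi q).
  by case=> c ->; left; exists (phi c); rewrite rmorphM.
by case=> c ->; right; exists (phi c); rewrite rmorphM.
Qed.

Lemma factorial_transport : factorial_ring B -> factorial_ring A.
Proof.
have [psi phiK psiK] := phi_bij; move=> facB a a0.
have [|u [s [uU sP def_a]]] := facB (phi a).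
  by rewrite -(rmorph0 phi) (inj_eq (can_inj phiK)).
exists (psi u), (map psi s); split.
- apply/unitrPr; exists (psi u^-1); apply: (can_inj phiK).
  by rewrite rmorphM rmorph1 /= !psiK divrr.
- by move=> p /mapP[q sq ->]; apply: prime_transport; rewrite psiK; apply: sP.
apply: (can_inj phiK); rewrite rmorphM /= psiK def_a; congr (_ * _).
rewrite big_map rmorph_prod /=; apply: eq_bigr => i _; by rewrite psiK.
Qed.

End Transport.

(** * Tuples without a common prime factor *)

Section PrimitiveTuple.

Variables (B : idomainType) (N : nat).
Hypothesis facB : factorial_ring B.
Implicit Types p q r : 'I_N -> B.

(** The candidate for [d] is [r j / q j]. Each prime factor of [q j] fails to divide some [q i], so
    by the proportionality it divides [r j]; hence the quotient lies in the ring. *)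
Lemma primitive_tuple_proportional q j :
    q j != 0 -> (forall x, prime_elt x -> exists i, ~ dvdr x (q i)) ->
  forall r, (forall i k, r i * q k = r k * q i) ->
  exists d, forall i, r i = d * q i.
Proof.
move=> qj0 qprim r rq; have [u [s [uU sP def_qj]]] := facB qj0.
have main a z : (forall i, (\prod_(x <- s) x) * z i = a * q i) ->
    dvdr (\prod_(x <- s) x) a.
  elim: s sP {def_qj} a => [|x s IH] sP a zP.
    by exists a; rewrite big_nil mulr1.
  have px : prime_elt x by apply: sP; rewrite mem_head.
  have x0 : x != 0 by case: px.
  have [i ndi] := qprim x px.
  have : dvdr x (a * q i).
    by rewrite -zP big_cons -mulrA; apply: dvdr_mulr; apply: dvdrr.
  case/(prime_dvdrM px) => [[b def_a]|//]; rewrite {}def_a in zP *.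
  have [|k|e def_b] := IH _ b.
  - by move=> y sy; apply: sP; rewrite inE sy orbT.
  - by apply: (mulfI x0); rewrite mulrA -[x * _](big_cons _ _ _ _ xpredT id) zP; ring.
  by exists e; rewrite def_b big_cons /=; ring.
have prodE : \prod_(x <- s) x = u^-1 * q j by rewrite def_qj mulKr.
have [|d def_rj] := main (u^-1 * r j) r.
  by move=> i; rewrite prodE -!mulrA [q j * _]mulrC rq.
exists d => i; apply: (mulIf qj0); rewrite rq.
rewrite -[r j](mulVKr uU) def_rj prodE.
by rewrite (mulrCA d) mulVKr ?unitrV // mulrAC.

Qed.

Lemma primitive_tuple p j : p j != 0 -> exists c q,
  [/\ forall i, p i = c * q i, q j != 0
    & forall x, prime_elt x -> exists i, ~ dvdr x (q i)].
Proof.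
move=> pj0; have [u [s [uU sP def_pj]]] := facB pj0.
elim: {s}(size s) {-2}s (leqnn (size s)) sP u p uU def_pj pj0 =>
    [|n IH] s le_s sP u p uU def_pj pj0.
  exists 1, p; split=> // [i|x px]; first by rewrite mul1r.
  exists j => -[q def_q]; move: def_pj; move: le_s; rewrite leqn0 => /nilP->.
  rewrite big_nil mulr1 => def_u; case: px => _ /negP[].
  by move: uU; rewrite -def_u def_q unitrM => /andP[].
have [[x px xp]|nex] :=
  classic (exists2 x, prime_elt x & forall i, dvdr x (p i)); last first.
  exists 1, p; split=> // [i|x px]; first by rewrite mul1r.
  apply: NNPP => nex'; case: nex; exists x => // i.
  by apply: NNPP => nd; apply: nex'; exists i.
have x0 : x != 0 by case: px.
have [q def_q] : exists q, forall i, p i = q i * x.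
  exact: (fin_all_exists xp).
have := xp j; rewrite def_pj.
case/(prime_dvdrM px) => [[v def_u]|/(prime_dvdr_prod px)[y sy [v def_y]]].
  by case: px => _ /negP[]; move: uU; rewrite def_u unitrM => /andP[].
have vU : v \is a GRing.unit.
  have [_ _ /(_ _ _ def_y)[//|]] := prime_irreducible (sP y sy).
  by case: px => _ /negbTE->.
have qj0 : q j != 0 by apply: contraNneq pj0 => q0; rewrite def_q q0 mul0r.
have le_s' : (size (rem y s) <= n)%N by rewrite size_rem //; case: (s) le_s.
have qjE : q j = (u * v) * \prod_(z <- rem y s) z.
  apply: (mulIf x0); rewrite -def_q def_pj.
  by rewrite (perm_big _ (perm_to_rem sy)) big_cons {1}def_y /=; ring.
have [||c [q' [q'E q'j q'P]]] := IH _ le_s' _ (u * v) q _ qjE qj0.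
- by move=> z /mem_rem /sP.
- by rewrite unitrM uU vU.
by exists (c * x), q'; split=> // i; rewrite def_q q'E; ring.
Qed.

End PrimitiveTuple.

(** * Polynomials in n + 1 variables as polynomials in the last variable *)

Section Muni.

Variables (n : nat) (R : comNzRingType).
Implicit Types p q : {mpoly R[n.+1]}.

Local Notation widen := (widen_ord (leqnSn n)).

Lemma muni_X_widen (i : 'I_n) : muni ('X_(widen i) : {mpoly R[n.+1]}) = ('X_i)%:P.
Proof.
rewrite muniE msuppX big_seq1 mcoeffX eqxx scale1r mnm1E.
rewrite (_ : widen i == ord_max = false); last first.
  by apply/negbTE; rewrite -val_eqE /= neq_ltn ltn_ord.
rewrite expr0 alg_polyC; congr ('X_[_])%:P; apply/mnmP => j.
by rewrite !mnmE -val_eqE.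
Qed.

Lemma muni_X_max : muni ('X_ord_max : {mpoly R[n.+1]}) = 'X.
Proof.
rewrite muniE msuppX big_seq1 mcoeffX eqxx scale1r mnm1E eqxx expr1.
rewrite (_ : [multinom _ | i < n] = 0%MM) ?mpolyX0 ?scale1r //.
apply/mnmP => j; rewrite !mnmE -val_eqE /=.
by rewrite gtn_eqF // ltn_ord.
Qed.

Lemma muni_mwiden (q : {mpoly R[n]}) : muni (mwiden q) = q%:P.
Proof.
rewrite /mwiden /mmap raddf_sum /= [in RHS](mpolyE q) rmorph_sum /=.
apply: eq_bigr => m _; rewrite muniM muniC -mul_mpolyC polyCM; congr (_ * _).
rewrite mpolyXE_id !rmorph_prod /=; apply: eq_bigr => i _.
by rewrite !rmorphXn /= muni_X_widen.
Qed.

Lemma muni_mmulti (q : {poly {mpoly R[n]}}) : muni (mmulti q) = q.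
Proof.
rewrite /mmulti raddf_sum /= -[RHS]coefK poly_def; apply: eq_bigr => i _.
by rewrite muniM muni_mwiden rmorphXn /= muni_X_max mul_polyC.
Qed.

Lemma mmulti_muni p : mmulti (muni p) = p.
Proof.
have mmultiwE k (q : {poly {mpoly R[n]}}) : (size q <= k)%N ->
    mmulti q = \sum_(i < k) mwiden q`_i * 'X_ord_max ^+ i.
  move=> le_k; rewrite /mmulti (big_ord_widen k (fun i => mwiden q`_i * 'X_ord_max ^+ i)) //.
  rewrite big_mkcond /=; apply: eq_bigr => i _; case: ltnP => // le.
  by rewrite nth_default // mwiden0 mul0r.
have mmultiD : {morph @mmulti n R : q r / q + r}.
  move=> q r; pose k := maxn (size q) (size r).
  rewrite (mmultiwE k) ?size_polyD // (mmultiwE k q) ?leq_maxl //.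
  rewrite (mmultiwE k r) ?leq_maxr // -big_split /=; apply: eq_bigr => i _.
  by rewrite coefD mwidenD mulrDl.
rewrite [in LHS]muniE [in RHS](mpolyE p).
elim: (msupp p) => [|m s IH]; first by rewrite !big_nil /mmulti size_poly0 big_ord0.
rewrite !big_cons mmultiD IH; congr (_ + _).
rewrite (mmultiwE (m ord_max).+1); last first.
  by apply: leq_trans (size_scale_leq _ _) _; rewrite size_polyXn.
rewrite big_ord_recr /= big1 ?add0r => [|i _]; last first.
  by rewrite coefZ coefXn (ltn_eqF (ltn_ord i)) mulr0 mwiden0 mul0r.
rewrite coefZ coefXn eqxx mulr1 mwidenZ mwidenX -scalerAl; congr (_ *: _).
rewrite mpolyXn -mpolyXD; congr 'X_[_]; apply/mnmP => i.
rewrite mnmDE mulmnE mnm1E; have [j ->|->] := unliftP ord_max i; last first.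
  by rewrite mnmwiden_ordmax eqxx add0n mul1n.
have -> : lift ord_max j = widen j by apply: ord_inj; rewrite lift_max.
by rewrite mnmwiden_widen mnmE -val_eqE /= gtn_eqF ?ltn_ord // mul0n addn0.
Qed.

Lemma muni_bij : bijective (@muni n R).
Proof. by exists (@mmulti n R); [apply: mmulti_muni | apply: muni_mmulti]. Qed.

Lemma meval_muni p (v : 'I_n.+1 -> R) :
  p.@[v] = (map_poly (meval (fun i => v (widen i))) (muni p)).[v ord_max].
Proof.
rewrite muniE [in LHS](mpolyE p) !raddf_sum /= horner_sum.
apply: eq_bigr => m _; rewrite mevalZ mevalX map_polyZ map_polyXn /=.
rewrite hornerZ hornerXn mevalZ mevalX big_ord_recr /= mulrA; congr (_ * _ * _).
by apply: eq_bigr => i _; rewrite mnmE.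
Qed.

Definition snoc (v : 'I_n -> R) (t : R) (i : 'I_n.+1) : R :=
  if unlift ord_max i is Some j then v j else t.

Lemma snoc_widen v t i : snoc v t (widen i) = v i.
Proof.
have -> : widen i = lift ord_max i by apply: ord_inj; rewrite lift_max.
by rewrite /snoc liftK.
Qed.

Lemma snoc_max v t : snoc v t ord_max = t.
Proof. by rewrite /snoc unlift_none. Qed.

Lemma meval_muni_snoc p v t :
  p.@[snoc v t] = (map_poly (meval v) (muni p)).[t].
Proof.
rewrite meval_muni snoc_max; congr (_.[t]); apply/polyP => i.
by rewrite !coef_map /=; apply: meval_eq => j; rewrite snoc_widen.
Qed.

End Muni.

Lemma factorial_mpoly (A : idomainType) n :
  factorial_ring A -> factorial_ring {mpoly A[n]}.
Proof.
move=> facA; elim: n => [|n IH].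
  apply: (@factorial_transport _ A (mcoeff (0%MM : 'X_{1..0}))) facA.
  exists (@mpolyC 0 A) => [p|c]; last exact: mpolyCK.
  by rewrite [RHS]nvar0_mpolyC.
apply: (@factorial_transport _ {poly {mpoly A[n]}} (@muni n A)).
  exact: muni_bij.
exact: factorial_poly.
Qed.

Lemma factorial_field (K : fieldType) : factorial_ring K.
Proof.
move=> a a0; exists a, [::]; rewrite big_nil mulr1 unitfE; split=> //.
Qed.

(** Up to a constant, [f] is a product of [gcdp f g] and a cofactor, and the prime [f] divides one
    of them: if it divides the cofactor, the gcd is constant; if it divides the gcd, it divides [g]
    up to a constant, which primality removes. *)
Lemma prime_coprimep (A : idomainType) (f g : {poly A}) :
  prime_elt f -> (1 < size f)%N -> coprimep f g \/ dvdr f g.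
Proof.
case=> f0 fU fD szf.
have true_dvd : f %| g -> dvdr f g.
  case/Pdiv.Idomain.dvdpP => -[c r] /= c0 cr.
  have : dvdr f (c%:P * g) by exists r; rewrite mul_polyC.
  case/fD => // -[s sE]; have : size (s * f) = 1%N by rewrite -sE size_polyC c0.
  have s0 : s != 0 by apply: contraNneq c0 => s0; rewrite -polyC_eq0 sE s0 mul0r.
  rewrite size_mul //; move: s0 szf; rewrite -size_poly_gt0; lia.
have [cop|ncop] := boolP (coprimep f g); [by left | right; apply: true_dvd].
have /Pdiv.Idomain.dvdpP[[c r] /= c0 cr] := dvdp_gcdl f g.
have : dvdr f (r * gcdp f g) by exists c%:P; rewrite -cr mul_polyC.
case/fD => -[s sE]; last first.
  by apply: dvdp_trans (dvdp_gcdr f g); rewrite [X in _ %| X]sE dvdp_mull.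
have cf0 : c *: f != 0 by rewrite -mul_polyC mulf_neq0 // polyC_eq0.
have [s0 d0] : s != 0 /\ gcdp f g != 0.
  apply/andP; rewrite -negb_or; apply: contraNN cf0; rewrite cr sE.
  by case/orP=> /eqP->; rewrite ?mul0r ?mulr0.
have : size (c *: f) = size f by rewrite size_scale.
rewrite cr sE size_mul ?mulf_neq0 // size_mul //.
move: s0 d0 szf ncop; rewrite -!size_poly_gt0 coprimep_def; lia.
Qed.

(** The constant of a Bezout relation with cleared denominators plays the role of the resultant: it
    vanishes under every specialization for which [f] and [g] acquire a common root. *)
Lemma coprimep_resultant (A B : idomainType) (f g : {poly A}) : coprimep f g ->
  exists2 c, c != 0 & forall (e : {rmorphism A -> B}) t,
    (map_poly e f).[t] = 0 -> (map_poly e g).[t] = 0 -> e c = 0.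
Proof.
case/Bezout_coprimepP=> -[u w] /= /Pdiv.Idomain.eqpP[[c1 c2] /= /andP[c10 c20] uw].
exists c2 => // e t ft gt.
have := congr1 (fun p : {poly A} => (map_poly e p).[t]) uw.
rewrite -!mul_polyC mulr1 !rmorphM rmorphD !rmorphM /= !map_polyC /= !hornerE.
by rewrite ft gt !mulr0 addr0 mulr0 => <-.
Qed.

(** * A Nullstellensatz for prime hypersurfaces *)

Section Zeros.

Variable K : closedFieldType.

Lemma poly_nonzero_point (q : {poly K}) : (forall t, q.[t] = 0) -> q = 0.
Proof.
move=> q0; apply/eqP/negPn/negP => /closed_nonrootP[x].
by rewrite /root q0 eqxx.
Qed.

Lemma mpoly_nonzero_point n (p : {mpoly K[n]}) : p != 0 ->
  exists v, p.@[v] != 0.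
Proof.
elim: n p => [|n IH] p p0.
  exists (fun _ => 0); apply: contraNneq p0 => pE.
  by rewrite [p]nvar0_mpolyC mevalC in pE; rewrite [p]nvar0_mpolyC pE mpolyC0.
have q0 : muni p != 0.
  by rewrite -(raddf0 (@muni n K)) (inj_eq (bij_inj (muni_bij _ _))).
have [v lv] : exists v, (lead_coef (muni p)).@[v] != 0.
  by apply: IH; rewrite lead_coef_eq0.
have : map_poly (meval v) (muni p) != 0.
  by rewrite -lead_coef_eq0 lead_coef_map_eq // lead_coef_eq0.
case/closed_nonrootP => t nt; exists (snoc v t).
by rewrite meval_muni_snoc.
Qed.

Lemma mpoly_fun_inj n (p q : {mpoly K[n]}) : (forall v, p.@[v] = q.@[v]) -> p = q.
Proof.
move=> pq; apply/eqP; rewrite -subr_eq0; apply/negPn/negP.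
by case/mpoly_nonzero_point => v; rewrite mevalB pq subrr eqxx.
Qed.

(* If f does not involve the last variable, pass to the coefficients of g;    *)
(* otherwise a Bezout relation u f + v g = c between coprime f and g gives a  *)
(* zero of f at which c != 0.                                                 *)
Lemma prime_nullstellensatz n (f g : {mpoly K[n]}) : prime_elt f ->
  (forall v, f.@[v] = 0 -> g.@[v] = 0) -> dvdr f g.
Proof.
elim: n f g => [|n IH] f g fP fg.
  case: fP => f0 /negP[]; rewrite [f]nvar0_mpolyC.
  have : f@_0%MM != 0 by rewrite -(mpolyC_eq0 0) -nvar0_mpolyC.
  by rewrite -unitfE; apply: rmorph_unit.
have [/= f'0 f'U f'D] := prime_rmorph (muni_bij n K) fP.
suff [q def_q] : dvdr (muni f) (muni g).
  by exists (mmulti q); apply: (bij_inj (muni_bij n K)); rewrite muniM muni_mmulti.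
have [szf|szf] := leqP (size (muni f)) 1%N.
  have def_f := size1_polyC szf; set c := (muni f)`_0 in def_f.
  have cP : prime_elt c.
    split; first by rewrite -polyC_eq0 -def_f.
      by move: f'U; rewrite def_f; apply/contra/rmorph_unit.
    move=> a b [q ab]; have : dvdr (muni f) (a%:P * b%:P).
      by exists q%:P; rewrite def_f -!polyCM ab.
    case/f'D => -[r]; rewrite def_f => rE; [left|right]; exists r`_0.
      by rewrite -coefMC -rE coefC eqxx.
    by rewrite -coefMC -rE coefC eqxx.
  rewrite def_f; apply/dvdr_polyC => i; apply: IH => // v cv.
  have : map_poly (meval v) (muni g) = 0.
    apply: poly_nonzero_point => t; rewrite -meval_muni_snoc; apply: fg.
    by rewrite meval_muni_snoc def_f map_polyC hornerC.
  by move/(congr1 (fun p : {poly K} => p`_i)); rewrite coef_map coef0.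
have [cop|//] := prime_coprimep (muni g) (And3 f'0 f'U f'D) szf.
have [c c0 cP] := @coprimep_resultant _ K _ _ cop.
have [v] : exists v, (c * lead_coef (muni f)).@[v] != 0.
  by apply: mpoly_nonzero_point; rewrite mulf_neq0 // lead_coef_eq0.
rewrite mevalM mulf_eq0 negb_or => /andP[cv lv].
have [t /eqP rt] : exists t, root (map_poly (meval v) (muni f)) t.
  by apply/closed_rootP; rewrite size_map_poly_id0 // neq_ltn szf orbT.
have fv : f.@[snoc v t] = 0 by rewrite meval_muni_snoc.
case/eqP: cv; apply: (cP (meval v) t); first by rewrite -meval_muni_snoc.
by rewrite -meval_muni_snoc; apply: fg.
Qed.

End Zeros.

(** * Multilinear forms and polynomials *)

Section Multilinear.

Variables (K : closedFieldType) (R : local_algebra K) (d : nat).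
Hypothesis charK0 : [pchar K] =i pred0.
Implicit Types (F : {ffun 'I_d -> R} -> K) (b : {ffun 'I_d -> R}).

Lemma upd_id b i : upd b i (b i) = b.
Proof. by apply/ffunP => j; rewrite ffunE; case: eqP => [->|]. Qed.

Lemma multilinear_sum F (M : nat) b i (c : 'I_M -> K) (v : 'I_M -> R) :
  symmetric_multilinear F ->
  F (upd b i (\sum_j c j *: v j)) = \sum_j c j * F (upd b i (v j)).
Proof.
case=> Flin _.
have F0 : F (upd b i 0) = 0.
  have := Flin b i (-1) 0 0; rewrite scaler0 addr0 mulN1r => /eqP.
  by rewrite addNr => /eqP.
elim/big_rec2: _ => [|j x y _ <-]; first exact: F0.
by rewrite Flin.
Qed.

Lemma multilinear_expand F (M : nat) (c : 'I_d -> 'I_M -> K) (v : 'I_M -> R) :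
  symmetric_multilinear F ->
  F [ffun i => \sum_j c i j *: v j] =
  \sum_(phi : {ffun 'I_d -> 'I_M})
     (\prod_i c i (phi i)) * F [ffun i => v (phi i)].
Proof.
(* [std k c] says that the rows of [c] from [k] on are standard basis vectors. The slots are
   expanded one at a time: for [k = 0] a single term survives, and for [k = d] nothing is assumed on
   [c]. *)
move=> Fml; pose std (k : nat) (c : 'I_d -> 'I_M -> K) :=
  forall i : 'I_d, (k <= i)%N -> exists l, forall j, c i j = (j == l)%:R.
suff ind k : forall c, (k <= d)%N -> std k c ->
    F [ffun i => \sum_j c i j *: v j] = \sum_(phi : {ffun 'I_d -> 'I_M})
       (\prod_i c i (phi i)) * F [ffun i => v (phi i)].
  by apply: (ind d) => // i; rewrite leqNgt ltn_ord.
elim: k {c} => [|k IH] c le_k cP.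
  have [phi0 phi0P] : exists phi : 'I_d -> 'I_M, forall i j, c i j = (j == phi i)%:R.
    exact: (fin_all_exists (fun i => cP i (leq0n i))).
  rewrite (bigD1 (finfun phi0)) //= [X in _ + X]big1 ?addr0.
    rewrite big1 ?mul1r => [|i _]; last by rewrite phi0P ffunE eqxx.
    congr F; apply/ffunP => i; rewrite !ffunE (bigD1 (phi0 i)) //= big1 ?addr0.
      by rewrite phi0P eqxx scale1r.
    by move=> j /negbTE nj; rewrite phi0P nj scale0r.
  move=> phi nphi; have /existsP[i ni] : [exists i, phi i != phi0 i].
    apply: contraNT nphi; rewrite negb_exists => /forallP h.
    by apply/eqP/ffunP => i; rewrite ffunE; apply/eqP; have := h i; rewrite negbK.
  by rewrite (bigD1 i) //= phi0P (negbTE ni) !mul0r.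
pose ik := Ordinal le_k.
pose c' j i l := if i == ik then (l == j)%:R else c i l.
have upE j : upd [ffun i => \sum_j c i j *: v j] ik (v j) =
    [ffun i => \sum_l c' j i l *: v l].
  apply/ffunP => i; rewrite !ffunE /c'; case: eqP => // _.
  rewrite (bigD1 j) //= eqxx scale1r big1 ?addr0 // => l /negbTE->.
  by rewrite scale0r.
rewrite -[in LHS](upd_id [ffun i => _] ik) [X in upd _ _ X]ffunE.
rewrite multilinear_sum //.
under eq_bigr => j _.
  rewrite upE IH ?(ltnW le_k) //; last first.
    move=> i le_i; rewrite /c'; case: eqP => [_|ne]; first by exists j.
    apply: cP; rewrite ltn_neqAle le_i andbT; apply/eqP => e.
    by case: ne; apply: val_inj.
  over.
under eq_bigr => j _ do rewrite big_distrr /=.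
rewrite exchange_big /=; apply: eq_bigr => phi _.
rewrite (bigD1 (phi ik)) //= [X in _ + X]big1 ?addr0 => [|j nj].
  rewrite mulrA; congr (_ * _); rewrite (bigD1 ik) //= [RHS](bigD1 ik) //=.
  rewrite /c' !eqxx mul1r; congr (_ * _).
  by apply: eq_bigr => i /negbTE->.
by rewrite (bigD1 ik) //= /c' eqxx eq_sym (negbTE nj) !mul0r mulr0.
Qed.

Lemma diag_coord F (M : nat) (x : 'I_M -> K) (v : 'I_M -> R) :
  symmetric_multilinear F ->
  F (diag d (\sum_j x j *: v j)) =
  (\sum_(phi : {ffun 'I_d -> 'I_M}) F [ffun i => v (phi i)] *:
     \prod_i 'X_(phi i) : {mpoly K[M]}).@[x].
Proof.
move=> Fml; transitivity (F [ffun i => \sum_j x j *: v j]).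
  by congr F; apply/ffunP => i; rewrite !ffunE.
rewrite (multilinear_expand (fun=> x)) // raddf_sum /=.
apply: eq_bigr => phi _; rewrite mevalZ mulrC rmorph_prod /=; congr (_ * _).
by apply: eq_bigr => i _; rewrite mevalXU.
Qed.

Lemma mpoly_of_form F (N : nat) (psi : {linear R -> 'rV[K]_N}) :
  symmetric_multilinear F -> bijective psi ->
  exists f : {mpoly K[N]}, f \is d.-homog /\
    forall r, f.@[psi r 0] = F (diag d r).
Proof.
move=> Fml [psi' psiK psi'K]; pose v j := psi' (delta_mx 0 j).
exists (\sum_(phi : {ffun 'I_d -> 'I_N}) F [ffun i => v (phi i)] *:
          \prod_i 'X_(phi i)); split; last first.
  move=> r; rewrite -(diag_coord (psi r 0) v Fml); congr (F (diag d _)).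
  apply: (can_inj psiK); rewrite linear_sum [RHS]row_sum_delta.
  by apply: eq_bigr => j _; rewrite linearZ /= psi'K.
apply: rpred_sum => phi _; apply: dhomogZ.
rewrite mprodXE dhomogX /= mdeg_sum.
by rewrite (eq_bigr (fun=> 1%N)) => [|i _]; rewrite ?mdeg1 // sum1_card card_ord.
Qed.

Lemma mul_natr_neq0 k : (0 < k)%N -> (k%:R : K) != 0.
Proof. by rewrite lt0n => k0; rewrite (pcharf0P K).1. Qed.

Lemma sum_U_inj (phi : {ffun 'I_d -> 'I_d}) :
  (\sum_i U_(phi i))%MM = [multinom 1%N | _ < d] -> injective phi.
Proof.
move=> phiE i j eq_ij; apply/eqP/negPn/negP => ne_ij.
move/mnmP/(_ (phi i)): phiE; rewrite mnmE mnm_sumE (bigD1 i) //= (bigD1 j) /=.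
  by rewrite !mnm1E eq_ij eqxx.
by rewrite eq_sym.
Qed.

(** Expand [F] on the diagonal at the combination of the [b j] with indeterminate coefficients t_j.
    The monomial t_0 ... t_(d-1) arises only from permutations of the indices, so by symmetry its
    coefficient is a positive integer times [F b]. *)
Lemma polarization F b : symmetric_multilinear F ->
  (forall t : 'I_d -> K, F (diag d (\sum_j t j *: b j)) = 0) -> F b = 0.
Proof.
move=> Fml F0.
have id_in : (\sum_(i < d) U_([ffun k : 'I_d => k] i))%MM == [multinom 1%N | _ < d].
  apply/eqP/mnmP => j; rewrite mnmE mnm_sumE (bigD1 j) //= big1 => [|i /negbTE ni];
    by rewrite ffunE mnm1E ?eqxx ?ni.
have := mpoly_fun_inj (fun t => etrans (esym (diag_coord t b Fml)) (etrans (F0 t) (esym (meval0 t)))).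
move/(congr1 (mcoeff [multinom 1%N | _ < d])); rewrite mcoeff0 raddf_sum /=.
under eq_bigr => phi _ do rewrite mprodXE mcoeffZ mcoeffX.
rewrite (bigID (fun phi : {ffun 'I_d -> 'I_d} =>
  (\sum_i U_(phi i))%MM == [multinom 1%N | _ < d])) /= [X in _ + X]big1 ?addr0.
  rewrite (eq_bigr (fun=> F b)) => [|phi /eqP phiE].
    rewrite sumr_const -mulr_natr => /eqP; rewrite mulf_eq0 => /orP[/eqP //|].
    rewrite (negbTE (mul_natr_neq0 _)) //; apply/card_gt0P.
    by exists [ffun i => i]; apply: id_in.
  rewrite phiE eqxx mulr1; have phi_inj := sum_U_inj phiE.
  rewrite -[RHS](Fml.2 (perm phi_inj) b); congr F.
  by apply/ffunP => i; rewrite !ffunE permE.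
by move=> phi /negbTE->; rewrite mulr0.
Qed.

Lemma polarization_diag F : symmetric_multilinear F ->
  (forall r, F (diag d r) = 0) -> forall b, F b = 0.
Proof. by move=> Fml F0 b; apply: polarization. Qed.

Lemma form_of_mpoly (N : nat) (f : {mpoly K[N]}) (psi : {linear R -> 'rV[K]_N}) :
  f \is d.-homog -> exists F, symmetric_multilinear F /\
    forall r, F (diag d r) = f.@[psi r 0].
Proof.
move=> /dhomogP fd.
suff: exists F, symmetric_multilinear F /\ forall r,
    F (diag d r) = (\sum_(m <- msupp f) f@_m *: 'X_[m]).@[psi r 0].
  by rewrite -mpolyE.
elim: (msupp f) fd => [|m s IH] fd.
  exists (fun=> 0); split=> [|r]; last by rewrite big_nil meval0.
  by split=> // *; rewrite mulr0 addr0.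
have [G [[Glin Gsym] Gdiag]] := IH (fun m' sm' => fd m' (@mem_behead _ (m :: s) m' sm')).
(* [m2s m] lists the variables of the monomial with multiplicity. The corresponding product of
   coordinates, one for each argument, is then averaged over all permutations of the arguments. *)
have dm : size (m2s m) == d by rewrite size_m2s; apply/eqP/fd/mem_head.
pose t := Tuple dm.
have def_m : m = (\sum_j U_(tnth t j))%MM.
  rewrite -[LHS]s2mK; apply/mnmP => i; rewrite mnmE mnm_sumE -sum1_count.
  rewrite -[X in \sum_(_ <- X | _) _]/(tval t) big_tuple big_mkcond /=.
  by apply: eq_bigr => j _; rewrite mnm1E; case: eqP.
exists (fun b => f@_m * ((d`!)%:R^-1 *
  \sum_(s : 'S_d) \prod_j psi (b (s j)) 0 (tnth t j)) + G b); split; last first.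
  move=> r; rewrite big_cons mevalD mevalZ Gdiag; congr (_ * _ + _).
  rewrite (eq_bigr (fun=> ('X_[m]).@[psi r 0])) => [|u _].
    rewrite sumr_const card_Sn -[X in _ * X]mulr_natl mulKf //.
    by rewrite mul_natr_neq0 // fact_gt0.
  rewrite def_m -mprodXE rmorph_prod /=; apply: eq_bigr => j _.
  by rewrite mevalXU ffunE.
split=> [b i c x y|u b].
  rewrite Glin; set A := \sum_(_ : 'S_d) _; set B := \sum_(_ : 'S_d) _.
  set C := \sum_(_ : 'S_d) _.
  suff -> : A = c * B + C by ring.
  rewrite /A /B /C big_distrr -big_split /=; apply: eq_bigr => u _.
  pose k := (u^-1)%g i; have uk : u k = i by rewrite permKV.
  rewrite (bigD1 k) //= [X in _ = c * X + _](bigD1 k) //= [X in _ = _ + X](bigD1 k) //= !ffunE uk eqxx linearP !mxE mulrDl mulrA.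
  have eqp z : \prod_(j | j != k) psi (upd b i z (u j)) 0 (tnth t j) =
               \prod_(j | j != k) psi (b (u j)) 0 (tnth t j).
    apply: eq_bigr => j nj; rewrite ffunE -uk (inj_eq perm_inj).
    by rewrite (negbTE nj).
  by rewrite !eqp.
rewrite Gsym; congr (_ * (_ * _) + _).
rewrite [RHS](reindex_inj (mulIg u)) /=; apply: eq_bigr => w _.
by apply: eq_bigr => j _; rewrite ffunE permM.
Qed.

Lemma deriv_prod (I : eqType) (s : seq I) (g : I -> {poly K}) : uniq s ->
  (\prod_(i <- s) g i)^`() =
  \sum_(i <- s) \prod_(j <- s) (if j == i then (g j)^`() else g j).
Proof.
elim: s => [|i s IH] /=; first by rewrite !big_nil derivC.
case/andP=> si us; rewrite !big_cons derivM IH // eqxx; congr (_ * _ + _).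
  apply: eq_big_seq => j sj; rewrite ifN //.
  by apply: contraNneq si => <-.
rewrite big_distrr; apply: eq_big_seq => j sj /=; rewrite big_cons ifN //.
by apply: contraNneq si => ->.
Qed.

(** Leibniz rule along a polynomial curve: the derivative of the diagonal value is the sum over the
    slots of [F] with the velocity put in that slot. *)
Lemma deriv_diag_curve F (M : nat) (c : 'I_M -> {poly K}) (v : 'I_M -> R) :
  symmetric_multilinear F ->
  exists q : {poly K}, forall t,
    q.[t] = F (diag d (\sum_j (c j).[t] *: v j)) /\
    q^`().[t] = \sum_i F (upd (diag d (\sum_j (c j).[t] *: v j)) i
                              (\sum_j (c j)^`().[t] *: v j)).
Proof.
move=> Fml.
exists (\sum_(phi : {ffun 'I_d -> 'I_M}) F [ffun i => v (phi i)] *: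
          \prod_i c (phi i)) => t; split.
  rewrite diag_coord // raddf_sum horner_sum; apply: eq_bigr => phi _ /=.
  rewrite hornerZ mevalZ rmorph_prod horner_prod; congr (_ * _).
  by apply: eq_bigr => i _ /=; rewrite mevalXU.
pose c1 (i k : 'I_d) j := (if k == i then (c j)^`() else c j).[t].
transitivity (\sum_(i < d) F [ffun k => \sum_j c1 i k j *: v j]); last first.
  apply: eq_bigr => i _; congr F; apply/ffunP => k.
  by rewrite !ffunE /c1; case: ifP => _.
under [RHS]eq_bigr => i _ do rewrite multilinear_expand //.
rewrite exchange_big raddf_sum horner_sum; apply: eq_bigr => phi _ /=.
rewrite derivZ hornerZ deriv_prod ?index_enum_uniq // horner_sum big_distrr /=.
apply: eq_bigr => i _; rewrite mulrC horner_prod; congr (_ * _).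
Qed.

(** The Lie derivative of [F] along multiplication by [a]; invariance of a form with respect to W
    says that it vanishes for [a] in W. *)
Definition infinitesimal F (a : R) b : K := \sum_(i < d) F (upd b i (a * b i)).

Lemma infinitesimal_multilinear F a :
  symmetric_multilinear F -> symmetric_multilinear (infinitesimal F a).
Proof.
case=> Flin Fsym; split=> [b i c x y|s b]; rewrite /infinitesimal.
  rewrite big_distrr -big_split /=; apply: eq_bigr => k _.
  have updE z : upd (upd b i z) k (a * upd b i z k) =
      if k == i then upd b i (a * z) else upd (upd b k (a * b k)) i z.
    apply/ffunP => j; case: (eqVneq k i) => [->|ki]; rewrite !ffunE.
      by rewrite eqxx; case: eqP.
    rewrite (negbTE ki); case: (eqVneq j k) => [->|//].
    by rewrite (negbTE ki).
  rewrite !updE; case: ifP => _; last exact: Flin.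
  by rewrite mulrDr -scalerAr Flin.
rewrite [RHS](reindex_inj (@perm_inj _ s)) /=; apply: eq_bigr => i _.
rewrite -[RHS](Fsym s); congr F; apply/ffunP => j.
by rewrite !ffunE (inj_eq perm_inj).
Qed.

End Multilinear.

(** * Local algebras *)

Import VectorInternalTheory.

Section SeparatingFunctional.

Variables (K : fieldType) (V : vectType K).

Lemma separating_functional (U : {vspace V}) (u : V) : u \notin U ->
  exists l : {linear V -> K^o}, (forall x, x \in U -> l x = 0) /\ l u = 1.
Proof.
move=> uU; have [N [p [pE pU p0]]] : exists N (p : V -> 'rV[K]_N),
    [/\ forall a x y, p (a *: x + y) = a *: p x + p y,
        forall x, x \in U -> p x = 0 & p u != 0].
  exists (dim V), (fun x => v2r (x - projv U x)); split=> [a x y|x xU|].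
  - by rewrite linearP opprD addrACA -scalerBr linearP.
  - by rewrite projv_id // subrr linear0.
  apply: contra uU => /eqP /(canRL v2rK) /eqP; rewrite linear0 subr_eq0 => /eqP->.
  exact: memv_proj.
have [j pj] : exists j, p u 0 j != 0.
  by apply/existsP; apply: contraNT p0; rewrite negb_exists => /forallP h;
     apply/eqP/rowP => j; rewrite mxE; apply/eqP; have := h j; rewrite negbK.
pose l x : K^o := (p u 0 j)^-1 * p x 0 j.
have l_lin : linear l.
  move=> a x y; have pjE : p (a *: x + y) 0 j = a * p x 0 j + p y 0 j.
    by rewrite pE !mxE.
  by rewrite /l pjE mulrDr mulrCA.
pose lM := GRing.isLinear.Build K V K^o _ l l_lin.
pose L : {linear V -> K^o} := HB.pack l lM.
exists L; split=> [x xU|] /=; first by rewrite /l (pU _ xU) mxE mulr0.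
by rewrite /l mulVf.
Qed.

Lemma exists_coordinates (N : nat) : \dim {:V} = N ->
  exists psi : {linear V -> 'rV[K]_N}, bijective psi.
Proof.
rewrite dimvf => <-; exists (@v2r K V : {linear V -> 'rV_(dim V)}).
by exists r2v; [apply: v2rK | apply: r2vK].
Qed.

End SeparatingFunctional.

Lemma exists_parametrization (K : fieldType) (V : vectType K) (W : {vspace V})
    (n : nat) : \dim W = n ->
  exists iota : {linear 'rV[K]_n -> V},
    injective iota /\ (forall a, a \in W <-> exists g, a = iota g).
Proof.
move=> dW; have := @exists_coordinates K (subvs_of W) n; rewrite dimvf /= => /(_ dW).
case=> psi [psi' psiK psi'K].
have lin' : linear psi'.
  move=> a x y; apply: (can_inj psiK); rewrite linearP /= !psi'K //.
pose i x := vsval (psi' x).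
have i_lin : linear i by move=> a x y; rewrite /i lin' linearP.
pose iM := GRing.isLinear.Build K 'rV[K]_n V _ i i_lin.
pose I : {linear 'rV[K]_n -> V} := HB.pack i iM.
exists I; split.
  by move=> x y /val_inj /(can_inj psi'K).
move=> a; split=> [aW|[g ->]]; last exact: subvsP.
by exists (psi (Subvs aW)); rewrite /= /i psiK.
Qed.

HB.instance Definition _ (K : fieldType) (R : local_algebra K) :=
  GRing.PzRing_hasCommutativeMul.Build R (@la_mulC K R).

Section LocalAlgebra.

Variables (K : closedFieldType) (R : local_algebra K).
Implicit Types (a b r x y z : R) (I : {vspace R}).

Local Notation m := (la_max R).
Local Notation D := (\dim {:R}).

Lemma max_ideal_mull a x : x \in m -> a * x \in m.
Proof. by have [h _ _] := la_maxP R; apply: h. Qed.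

Lemma max_ideal_mulr a x : x \in m -> x * a \in m.
Proof. by rewrite mulrC; apply: max_ideal_mull. Qed.

Lemma one_notin_max : 1 \notin m.
Proof.
have [mI mP _] := la_maxP R; apply: contra mP => m1.
by rewrite eqEsubv subvf; apply/subvP => x _; rewrite -[x]mulr1; apply: mI.
Qed.

Lemma proper_ideal_sub_max I : is_ideal I -> I != fullv -> (I <= m)%VS.
Proof.
move: {2}(D - \dim I)%N (leqnn (D - \dim I)%N) => k.
elim: k I => [|k IH] I le_k II IP.
  case/negP: IP; rewrite eqEdim subvf /=; move: le_k.
  by rewrite leqn0 subn_eq0.
have [IM|nIM] := classic (maximal_ideal I); first by rewrite (la_max_unique IM).
have [J [JI IJ JP nJ]] : exists J : {vspace R},
    [/\ is_ideal J, (I <= J)%VS, J != fullv & J != I].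
  apply: NNPP => nex; case: nIM; split=> // J JI IJ; apply: NNPP => nJ.
  apply: nex; exists J; split=> //; apply/eqP => e; apply: nJ; by [left | right].
apply: (subv_trans IJ); apply: IH => //.
have lt : (\dim I < \dim J)%N.
  by rewrite ltn_neqAle (dimvS IJ) (dimv_leqif_eq IJ) andbT eq_sym.
have := dimvS (subvf J); move: le_k lt; lia.
Qed.

Lemma notin_max_inv a : a \notin m -> exists b, a * b = 1.
Proof.
move=> am; pose J := (<[a]> * {:R})%VS.
have JE x : x \in J -> exists b, x = a * b.
  have -> : J = limg (amull a).
    apply/eqP; rewrite eqEsubv; apply/andP; split.
      apply/prodvP => _ b /vlineP[k ->] _; apply/memv_imgP.
      exists (k *: b); rewrite ?memvf //.
      by rewrite lfunE /= -scalerAr -scalerAl.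
    apply/subvP => _ /memv_imgP[b _ ->]; rewrite lfunE.
    by apply: memv_mul; rewrite ?memv_line ?memvf.
  by case/memv_imgP => b _ ->; exists b; rewrite lfunE.
have JI : is_ideal J.
  move=> c x /JE[b ->]; rewrite mulrC -mulrA.
  by apply: memv_mul; rewrite ?memv_line ?memvf.
have [JP|nJ] := eqVneq J fullv.
  have [|b def_1] := JE 1; first by rewrite JP memvf.
  by exists b.
case/negP: am; apply: (subvP (proper_ideal_sub_max JI nJ)).
by rewrite -[a]mulr1; apply: memv_mul; rewrite ?memv_line ?memvf.
Qed.

(** The powers 1, a, ..., a^D are linearly dependent, so some a^i is a combination of later powers,
    that is a^i = a^(i+1) b. Since 1 - a b is a unit, a^i = 0. *)
Lemma max_ideal_nilp a : a \in m -> a ^+ D = 0.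
Proof.
move=> am; pose X := [tuple a ^+ i | i < D.+1].
have : ~~ free X.
  apply/negP; rewrite /free => /eqP; rewrite size_tuple => dX.
  by have := dimvS (subvf <<X>>%VS); rewrite dX ltnn.
rewrite freeNE => /existsP[i].
have -> : X`_i = a ^+ i by rewrite -tnth_nth tnth_mktuple.
have /subvP sub : (<<drop i.+1 X>> <= limg (amull (a ^+ i.+1)%R))%VS.
  apply/span_subvP => x /(nthP 0)[k]; rewrite size_drop size_tuple => ltk <-.
  rewrite nth_drop; have ltk' : (i.+1 + k < D.+1)%N by move: ltk; lia.
  rewrite -[(i.+1 + k)%N]/(val (Ordinal ltk')) -tnth_nth tnth_mktuple /= exprD.
  by apply/memv_imgP; exists (a ^+ k); rewrite ?memvf // lfunE.
case/sub/memv_imgP => b _; rewrite lfunE /= exprSr -mulrA => e.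
have [|c def_c] := @notin_max_inv (1 - a * b).
  apply: contra one_notin_max => h; rewrite -(subrK (a * b) 1).
  by rewrite rpredD // max_ideal_mulr.
have ai0 : a ^+ i = 0.
  by rewrite -[LHS]mulr1 -def_c mulrA mulrBr mulr1 -{1}e subrr mul0r.
have le_i : (i <= D)%N by rewrite -ltnS.
by rewrite -(subnK le_i) exprD ai0 mulr0.
Qed.

(** By finite dimension [r] is a root of a nonzero polynomial, which splits over the algebraically
    closed field. If every r - c were a unit, the product of the linear factors would be a unit,
    although it is zero. *)
Lemma max_ideal_residue r : exists c : K, r - c%:A \in m.
Proof.
pose X := [tuple r ^+ i | i < D.+1].
have nfX : ~~ free X.
  apply/negP; rewrite /free => /eqP; rewrite size_tuple => dX.
  by have := dimvS (subvf <<X>>%VS); rewrite dX ltnn.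
have [k [k0 [i ki]]] : exists k : 'I_D.+1 -> K,
    \sum_i k i *: X`_i = 0 /\ exists i, k i != 0.
  apply: NNPP => nex; case/negP: nfX; apply/freeP => k k0 i.
  by apply/eqP/negPn/negP => ki; apply: nex; exists k; split=> //; exists i.
pose p := \poly_(j < D.+1) k (inord j).
have XE (j : 'I_D.+1) : X`_j = r ^+ j by rewrite -tnth_nth tnth_mktuple.
have pr : horner_alg r p = 0.
  rewrite /p poly_def rmorph_sum /= -[RHS]k0; apply: eq_bigr => j _.
  rewrite XE linearZ rmorphXn /= horner_algX inord_val mulr_algl; congr (_ *: _).
have p0 : p != 0.
  apply: contraNneq ki => p0; have := congr1 (fun q : {poly K} => q`_i) p0.
  by rewrite coef_poly ltn_ord inord_val coef0 => ->.
have [s def_p] := closed_field_poly_normal p.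
move: pr; rewrite def_p linearZ rmorph_prod /= mulr_algl => /eqP.
rewrite scaler_eq0 lead_coef_eq0 (negbTE p0) /= => /eqP prod0.
apply: NNPP => nex; have nm (z : K) : r - z%:A \notin m.
  by apply/negP => zm; apply: nex; exists z.
have : exists y, (\prod_(z <- s) horner_alg r ('X - z%:P)) * y = 1.
  elim: (s) => [|z t [y IH]]; first by exists 1; rewrite big_nil mulr1.
  have [w wz] := notin_max_inv (nm z); exists (w * y).
  rewrite big_cons rmorphB /= horner_algX horner_algC mulrACA -[RHS]mulr1.
  by rewrite wz IH.
by case=> y /eqP; rewrite prod0 mul0r eq_sym oner_eq0.
Qed.

Lemma exists_residue : exists l : {linear R -> K^o},
  [/\ l 1 = 1, forall r, r - (l r)%:A \in m & forall r, (l r == 0) = (r \in m)].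
Proof.
have [l [lm l1]] := separating_functional one_notin_max; exists l.
have lP r : r - (l r)%:A \in m.
  have [c rc] := max_ideal_residue r; have := lm _ rc.
  rewrite linearB linearZ /= l1 => /eqP; rewrite subr_eq0 => /eqP->.
  by rewrite /GRing.scale /= mulr1.
split=> // r; apply/eqP/idP => [lr|]; last exact: lm.
by have := lP r; rewrite lr scale0r subr0.
Qed.

Lemma dim_max_ideal : (\dim m).+1 = D.
Proof.
have : (m + <[1]>)%VS = fullv.
  apply/eqP; rewrite eqEsubv subvf /=; apply/subvP => r _.
  have [c rc] := max_ideal_residue r.
  by rewrite -[r](subrK c%:A); apply: memv_add => //; apply: memvZ; apply: memv_line.
move=> <-; rewrite dimv_disjoint_sum; first by rewrite dim_vline oner_eq0 addn1.
apply/eqP; rewrite -subv0; apply/subvP => x; rewrite memv_cap => /andP[xm].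
case/vlineP=> c def_x; move: xm; rewrite def_x; case: (eqVneq c 0) => [->|c0].
  by rewrite scale0r => _; apply: mem0v.
move=> cm; case/negP: one_notin_max.
by rewrite -[1](scalerK c0) memvZ.
Qed.

Lemma nexp_widen M x : x \in m -> (D <= M)%N ->
  nexp x = \sum_(k < M) (k`!%:R : K)^-1 *: x ^+ k.
Proof.
move=> xm le_M; rewrite /nexp (big_ord_widen M (fun k => (k`!%:R : K)^-1 *: x ^+ k)) //.
rewrite big_mkcond; apply: eq_bigr => k _; case: ltnP => // le_k.
by rewrite -(subnK le_k) exprD max_ideal_nilp // mulr0 scaler0.
Qed.

Lemma dim_alg_gt0 : (0 < D)%N.
Proof. by rewrite -dim_max_ideal. Qed.

Lemma nexp0 : nexp (0 : R) = 1.
Proof.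
rewrite /nexp -(prednK dim_alg_gt0) big_ord_recl expr0 fact0 invr1 scale1r.
by rewrite big1 ?addr0 // => k _; rewrite expr0n scaler0.
Qed.

Hypothesis charK0 : [pchar K] =i pred0.

Let fact_neq0 k : (k`!%:R : K) != 0.
Proof. by rewrite (pcharf0P K).1 // -lt0n fact_gt0. Qed.

Lemma nexpD x y : x \in m -> y \in m -> nexp (x + y) = nexp x * nexp y.
Proof.
(* With the bound 2D the triangle i + j < 2D contains every pair with i, j < D; the other pairs
   contribute zero by nilpotency. *)
move=> xm ym; rewrite (@nexp_widen (D + D)) ?leq_addr ?rpredD //.
pose E (z : R) k := (k`!%:R : K)^-1 *: z ^+ k.
have E0 (z : R) k : z \in m -> (D <= k)%N -> E z k = 0.
  by move=> zm le_k; rewrite /E -(subnK le_k) exprD max_ideal_nilp // mulr0 scaler0.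
have term k : E (x + y) k = \sum_(i < k.+1) E x (k - i)%N * E y i.
  rewrite /E exprDn_comm; last exact: mulrC.
  rewrite scaler_sumr; apply: eq_bigr => i _;
  have le_ik : (i <= k)%N by rewrite -ltnS.
  rewrite -scalerAl -scalerAr scalerA -scaler_nat scalerA; congr (_ *: _).
  rewrite -(bin_fact le_ik) !natrM; field.
  by rewrite !fact_neq0 (pcharf0P K).1 // -lt0n bin_gt0.
rewrite (eq_bigr _ (fun (k : 'I_(D + D)) _ => term k)).
have tri n (g : nat -> nat -> R) : \sum_(k < n) \sum_(i < k.+1) g (k - i)%N i =
    \sum_(i < n) \sum_(j < n - i) g j i.
  elim: n => [|n IH]; first by rewrite !big_ord0.
  rewrite big_ord_recr IH [RHS]big_ord_recr /= subSnn big_ord1.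
  rewrite [in LHS]big_ord_recr /= subnn addrA; congr (_ + _).
  rewrite -big_split; apply: eq_bigr => i _ /=.
  by rewrite subSn ?(ltnW (ltn_ord i)) // big_ord_recr.
rewrite (tri _ (fun j i => E x j * E y i)) /nexp mulrC big_distrl /=.
rewrite (big_ord_widen (D + D) (fun i => E y i * \sum_(j < D) E x j)) ?leq_addr //.
rewrite [RHS]big_mkcond; apply: eq_bigr => i _; case: ltnP => [ltiD|leDi]; last first.
  by rewrite big1 // => j _; rewrite (E0 y) // mulr0.
rewrite mulrC big_distrl /=.
have le_D : (D <= D + D - i)%N by rewrite leq_subRL ?leq_add2r; lia.
rewrite (big_ord_widen _ (fun j => E x j * E y i) le_D) [RHS]big_mkcond.
apply: eq_bigr => j _; case: ltnP => // leDj.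
by rewrite (E0 x) // mul0r.
Qed.

End LocalAlgebra.

(** * The logarithm on 1 + m *)

Section Logarithm.

Variables (K : closedFieldType) (R : local_algebra K).
Hypothesis charK0 : [pchar K] =i pred0.
Implicit Types (a b r x y z : R).

Local Notation m := (la_max R).
Local Notation D := (\dim {:R}).

Lemma nexp_taylor x : x \in m -> exists g, nexp x = 1 + x + x ^+ 2 * g.
Proof.
move=> xm; rewrite (@nexp_widen _ _ D.+2) //; last by do 2 apply: leqW.
rewrite !big_ord_recl expr0 expr1 fact0 invr1 !scale1r addrA.
exists (\sum_(i < D) ((i.+2)`!%:R : K)^-1 *: x ^+ i); congr (_ + _).
by rewrite big_distrr /=; apply: eq_bigr => i _; rewrite -scalerAr -exprD.
Qed.

Lemma nexp_sub1 x : x \in m -> nexp x - 1 \in m.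
Proof.
move=> xm; have [g ->] := nexp_taylor xm.
have -> : 1 + x + x ^+ 2 * g - 1 = (1 + x * g) * x by ring.
exact: max_ideal_mull.
Qed.

(* Newton iteration for the logarithm: 1 + y is the product of the            *)
(* exponentials of eps y 0, ..., eps y (k - 1) and of 1 + eps y k, and the    *)
(* error eps y k is divisible by y ^+ (k + 1).                                *)
Fixpoint newton_error y k : R :=
  if k is k'.+1 then (1 + newton_error y k') * nexp (- newton_error y k') - 1
  else y.

Lemma newton_error_dvd y k : y \in m -> exists h, newton_error y k = y ^+ k.+1 * h.
Proof.
move=> ym; elim: k => [|k [h def_e]] /=; first by exists 1; rewrite mulr1.
have em : newton_error y k \in m.
  by rewrite def_e exprS -mulrA mulrC max_ideal_mull.
have [|g ->] := @nexp_taylor (- newton_error y k); first by rewrite rpredN.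
set e := newton_error y k in def_e em *.
exists (y ^+ k * h ^+ 2 * (g * (1 + e) - 1)).
have -> : (1 + e) * (1 - e + (- e) ^+ 2 * g) - 1 = e ^+ 2 * (g * (1 + e) - 1) by ring.
by rewrite {1}def_e !exprS expr0; ring.
Qed.

Lemma newton_error_max y k : y \in m -> newton_error y k \in m.
Proof.
move=> ym; have [h ->] := newton_error_dvd k ym.
by rewrite exprS -mulrA mulrC max_ideal_mull.
Qed.

Definition nlog y : R := \sum_(k < D) newton_error y k.

Lemma nlog_max y : y \in m -> nlog y \in m.
Proof. by move=> ym; apply: rpred_sum => k _; apply: newton_error_max. Qed.

Lemma nlog0 : nlog 0 = 0.
Proof.
rewrite /nlog big1 // => k _; elim: (val k) => [|j IH] //=.
by rewrite IH oppr0 nexp0 addr0 mulr1 subrr.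
Qed.

Lemma nexp_nlog y : y \in m -> nexp (nlog y) = 1 + y.
Proof.
move=> ym; have step k : nexp (\sum_(j < k) newton_error y j) *
    (1 + newton_error y k) = 1 + y.
  elim: k => [|k IH]; first by rewrite big_ord0 nexp0 mul1r.
  have em := newton_error_max k ym.
  rewrite big_ord_recr /= (nexpD charK0) //; last first.
    by apply: rpred_sum => j _; apply: newton_error_max.
  rewrite -[RHS]IH -mulrA; congr (_ * _); rewrite [1 + (_ - 1)]addrC subrK.
  by rewrite mulrCA -(nexpD charK0) ?rpredN // subrr nexp0 mulr1.
have := step D; rewrite -/(nlog y); have [h ->] := newton_error_dvd D ym.
by rewrite exprS max_ideal_nilp // mulr0 mul0r addr0 mulr1.
Qed.

Lemma nexp_unit a : a \in m -> nexp a * nexp (- a) = 1.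
Proof. by move=> am; rewrite -(nexpD charK0) ?rpredN // subrr nexp0. Qed.

(** The Taylor formula reads exp(a) - 1 = a (1 + a g), and the second factor is a unit. *)
Lemma nexp_inj1 a : a \in m -> nexp a = 1 -> a = 0.
Proof.
move=> am; have [g ->] := nexp_taylor am => /eqP.
rewrite -addrA addrC -subr_eq0 addrK => /eqP e.
have [|c def_c] := @notin_max_inv _ _ (1 + a * g).
  apply: contra (one_notin_max R) => h; rewrite -(addrK (a * g) 1).
  by rewrite rpredB // max_ideal_mulr.
rewrite -[LHS]mulr1 -def_c mulrA.
by have -> : a * (1 + a * g) = a + a ^+ 2 * g; [ring | rewrite e mul0r].
Qed.

End Logarithm.

(** * Maps that are polynomial in linear coordinates *)

Section PolynomialMaps.

Variables (K : closedFieldType) (R : local_algebra K) (N : nat).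
Variables (psi : {linear R -> 'rV[K]_N}) (psi' : 'rV[K]_N -> R).
Hypotheses (psiK : cancel psi psi') (psi'K : cancel psi' psi).

Definition polynomial_fun (g : R -> K) : Prop :=
  exists p : {mpoly K[N]}, forall r, g r = p.@[psi r 0].

Definition polynomial_endo (G : R -> R) : Prop :=
  exists p : 'I_N -> {mpoly K[N]}, forall r j, psi (G r) 0 j = (p j).@[psi r 0].

Let v j : R := psi' (delta_mx 0 j).

Let coordE r : r = \sum_j psi r 0 j *: v j.
Proof.
apply: (can_inj psiK); rewrite linear_sum [LHS]row_sum_delta.
by apply: eq_bigr => j _; rewrite linearZ /= psi'K.
Qed.

Lemma polynomial_endo_const c : polynomial_endo (fun=> c).
Proof. by exists (fun j => (psi c 0 j)%:MP) => r j; rewrite mevalC. Qed.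

Lemma polynomial_endo_id : polynomial_endo id.
Proof. by exists (fun j => 'X_j) => r j; rewrite mevalXU. Qed.

Lemma polynomial_endoD G H : polynomial_endo G -> polynomial_endo H ->
  polynomial_endo (fun r => G r + H r).
Proof.
case=> p pE [q qE]; exists (fun j => p j + q j) => r j.
by rewrite linearD mxE pE qE mevalD.
Qed.

Lemma polynomial_endoZ c G : polynomial_endo G ->
  polynomial_endo (fun r => c *: G r).
Proof.
case=> p pE; exists (fun j => c *: p j) => r j.
by rewrite linearZ mxE pE mevalZ.
Qed.

Lemma polynomial_endo_sum k (G : nat -> R -> R) :
  (forall i, polynomial_endo (G i)) ->
  polynomial_endo (fun r => \sum_(i < k) G i r).
Proof.
move=> GP; elim: k => [|k [p pE]].
  have [p pE] := polynomial_endo_const 0; exists p => r j.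
  by rewrite big_ord0 (pE r).
have [q qE] := polynomial_endoD (ex_intro _ p pE) (GP k).
by exists q => r j; rewrite big_ord_recr /= qE.
Qed.

Lemma polynomial_endoM G H : polynomial_endo G -> polynomial_endo H ->
  polynomial_endo (fun r => G r * H r).
Proof.
case=> p pE [q qE].
exists (fun j => \sum_k \sum_l psi (v k * v l) 0 j *: (p k * q l)) => r j.
rewrite {1}[G r]coordE {1}[H r]coordE big_distrl linear_sum summxE raddf_sum /=.
apply: eq_bigr => k _; rewrite big_distrr linear_sum summxE raddf_sum /=.
apply: eq_bigr => l _; rewrite -scalerAl -scalerAr mevalZ mevalM !linearZ !mxE.
by rewrite pE qE; ring.
Qed.

Lemma polynomial_endoX k G : polynomial_endo G ->
  polynomial_endo (fun r => G r ^+ k).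
Proof.
move=> GP; elim: k => [|k [p pE]]; first exact: polynomial_endo_const.
have [q qE] := polynomial_endoM GP (ex_intro _ p pE).
by exists q => r j; rewrite exprS qE.
Qed.

Lemma polynomial_endo_nexp G : polynomial_endo G ->
  polynomial_endo (fun r => nexp (G r)).
Proof.
move=> GP; apply: (@polynomial_endo_sum _ (fun k r => (k`!%:R : K)^-1 *: G r ^+ k)) => k.
by apply: polynomial_endoZ; apply: polynomial_endoX.
Qed.

Lemma polynomial_endo_nlog : polynomial_endo (@nlog K R).
Proof.
apply: (@polynomial_endo_sum _ (fun k r => newton_error r k)).
elim=> [|k IH]; first exact: polynomial_endo_id.
rewrite /=; apply: polynomial_endoD; last exact: polynomial_endo_const.
apply: polynomial_endoM; first by apply: polynomial_endoD => //; apply: polynomial_endo_const.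
apply: polynomial_endo_nexp.
have [p pE] := polynomial_endoZ (-1) IH; exists p => r j.
by rewrite -scaleN1r pE.
Qed.

Lemma polynomial_fun_linear (l : {linear R -> K^o}) G :
  polynomial_endo G -> polynomial_fun (fun r => l (G r)).
Proof.
case=> p pE; exists (\sum_j l (v j) *: p j) => r.
rewrite {1}[G r]coordE linear_sum raddf_sum; apply: eq_bigr => j _ /=.
by rewrite linearZ mevalZ -pE mulrC.
Qed.

End PolynomialMaps.

(** Substituting q_j / l in [p] creates denominators of degree at most the degree of [p]; a power of
    [l] clears them term by term. *)
Lemma homogenization (K : fieldType) (N M : nat) (p : {mpoly K[N]})
    (q : 'I_N -> {mpoly K[M]}) (l : {mpoly K[M]}) :
  exists e P, forall x, l.@[x] != 0 ->
    P.@[x] = l.@[x] ^+ e * p.@[fun j => (q j).@[x] / l.@[x]].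
Proof.
pose e := msize p; exists e, (\sum_(m <- msupp p) p@_m *:
  (l ^+ (e - mdeg m) * \prod_j q j ^+ m j)) => x lx.
rewrite [in RHS](mpolyE p) !raddf_sum big_distrr /=; apply: eq_big_seq => m sm.
rewrite !mevalZ mevalM mevalX [RHS]mulrCA; congr (_ * _).
rewrite rmorphXn rmorph_prod /=.
have -> : \prod_i ((q i).@[x] / l.@[x]) ^+ m i =
    (\prod_i (q i).@[x] ^+ m i) / l.@[x] ^+ mdeg m.
  under eq_bigr do rewrite expr_div_n.
  by rewrite prodf_div mdegE prodrXr.
have le_m : (mdeg m <= e)%N by apply/ltnW/msize_mdeg_lt.
rewrite -[in RHS](subnK le_m) exprD -mulrA; congr (_ * _).
rewrite [RHS]mulrC divfK ?expf_neq0 //.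
by apply: eq_bigr => i _; rewrite rmorphXn.
Qed.

(** * Invariant forms *)

Section HomogeneousFactors.

Variables (K : idomainType) (N : nat).
Implicit Types f g h : {mpoly K[N]}.

(** The ring morphism f(x) |-> f(x T); the coefficient of T^k is the homogeneous component of degree
    k. *)
Let theta : {mpoly K[N]} -> {poly {mpoly K[N]}} :=
  mmap (polyC \o @mpolyC N K) (fun i => 'X_i *: 'X).

Let thetaE f : theta f = \sum_(m <- msupp f) (f@_m *: 'X_[m]) *: 'X^(mdeg m).
Proof.
apply: eq_bigr => m _; rewrite /mmap1 /= -!mul_polyC -mul_mpolyC polyCM -mulrA.
congr (_ * _); under eq_bigr do rewrite -mul_polyC exprMn.
rewrite big_split /= mdegE -prodrXr; congr (_ * _).
rewrite mpolyXE_id rmorph_prod; apply: eq_bigr => i _.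
by rewrite rmorphXn.
Qed.

Let theta1 f : (theta f).[1] = f.
Proof.
rewrite thetaE horner_sum [RHS]mpolyE; apply: eq_bigr => m _.
by rewrite hornerZ hornerXn expr1n mulr1.
Qed.

Let theta_coef f k : (theta f)`_k \is k.-homog.
Proof.
rewrite thetaE coef_sum; apply: rpred_sum => m _.
rewrite coefZ coefXn; case: eqP => [->|_]; last by rewrite mulr0 rpred0.
by rewrite mulr1; apply: dhomogZ; rewrite dhomogX.
Qed.

Let thetaM f g : theta (f * g) = theta f * theta g.
Proof. by rewrite /theta mmap_is_multiplicative. Qed.

Lemma polyX_factor (A : idomainType) (p q : {poly A}) c k : c != 0 ->
  p * q = c *: 'X^k -> exists a i, p = a *: 'X^i.
Proof.
elim: k p q => [|k IH] p q c0 pq.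
  rewrite expr0 alg_polyC in pq; exists p`_0, 0; rewrite expr0 alg_polyC.
  apply: size1_polyC; have : size (p * q) = 1%N by rewrite pq size_polyC c0.
  have p0 : p != 0.
    apply: contraNneq c0 => p0; move/eqP: pq; rewrite p0 mul0r eq_sym polyC_eq0 //.
  have q0 : q != 0.
    apply: contraNneq c0 => q0; move/eqP: pq; rewrite q0 mulr0 eq_sym polyC_eq0 //.
  by rewrite size_mul //; move: p0 q0; rewrite -!size_poly_gt0; lia.
have X0 : 'X != 0 :> {poly A} by rewrite polyX_eq0.
have r0 (u : {poly A}) : u.[0] = 0 -> exists u', u = u' * 'X.
  by move/eqP/factor_theorem => [u' ->]; exists u'; rewrite subr0.
have : p.[0] * q.[0] = 0.
  by rewrite -hornerM pq hornerZ hornerXn expr0n mulr0.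
move/eqP; rewrite mulf_eq0 => /orP[]/eqP/r0[u def_u]; move: pq; rewrite def_u.
  rewrite mulrAC exprSr scalerAl => /(mulIf X0) /(IH _ _ c0) [a [i ->]].
  by exists a, i.+1; rewrite exprSr scalerAl.
by rewrite mulrA exprSr scalerAl => /(mulIf X0) /(IH _ _ c0).
Qed.

(** [theta f] is the monomial f T^d. A factor of a monomial in T over a domain is a monomial, so
    [theta g] has a single component. *)
Lemma homogeneous_factor d f g h : f != 0 -> f \is d.-homog -> f = g * h ->
  exists k, g \is k.-homog.
Proof.
move=> f0 /dhomogP fd fgh.
have tf : theta f = f *: 'X^d.
  rewrite thetaE [in RHS](mpolyE f) scaler_suml; apply: eq_big_seq => m sm.
  by rewrite (fd m sm).
have := thetaM g h; rewrite -fgh tf => /esym /(polyX_factor f0) [a [k def_g]].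
exists k; have := theta_coef g k.
by rewrite -{2}(theta1 g) def_g coefZ coefXn eqxx mulr1 hornerZ hornerXn expr1n mulr1.
Qed.

End HomogeneousFactors.

Section HomogeneousFactorsField.

Variables (K : fieldType) (N : nat).
Implicit Types f g h : {mpoly K[N]}.

Lemma homog0_unit g : g != 0 -> g \is 0.-homog -> g \is a GRing.unit.
Proof.
move=> g0 /dhomogP gd; have def_g : g = (g@_0)%:MP.
  apply: msize1_polyC; rewrite msizeE; apply/bigmax_leqP_seq => m sm _.
  by rewrite (gd m sm).
by rewrite def_g; apply: rmorph_unit; rewrite unitfE -(mpolyC_eq0 N) -def_g.
Qed.

Lemma unit_homog0 g : g \is a GRing.unit -> g \is 0.-homog.
Proof.
case/andP=> /eqP-> _; apply/dhomogP => m; rewrite msuppC; case: eqP => // _.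
by rewrite inE => /eqP->; rewrite /= mdeg0.
Qed.

Lemma homog_factors d f g h : f != 0 -> f \is d.-homog -> f = g * h ->
  g \isn't a GRing.unit -> h \isn't a GRing.unit ->
  exists d1 d2, [/\ (0 < d1)%N && (0 < d2)%N, d = (d1 + d2)%N,
    g \is d1.-homog & h \is d2.-homog].
Proof.
move=> f0 fd fgh gU hU.
have [d1 g1] := homogeneous_factor f0 fd fgh.
have [d2 h2] : exists k, h \is k.-homog.
  by apply: (homogeneous_factor f0 fd (h := g)); rewrite mulrC.
have /andP[g0 h0] : (g != 0) && (h != 0) by rewrite -negb_or -mulf_eq0 -fgh.
exists d1, d2; split=> //; last first.
  apply: (dhomog_uniq f0 fd); rewrite fgh; exact: dhomogM.
apply/andP; split; rewrite lt0n.
  by apply: contra gU => /eqP d10; apply: homog0_unit => //; rewrite d10 in g1.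
by apply: contra hU => /eqP d20; apply: homog0_unit => //; rewrite d20 in h2.
Qed.

Lemma homog_scale d f c v : f \is d.-homog ->
  f.@[fun i => c * v i] = c ^+ d * f.@[v].
Proof.
move=> /dhomogP fd; rewrite (mpolyE f) !raddf_sum big_distrr /=.
apply: eq_big_seq => m sm; rewrite !mevalZ !mevalX mulrCA; congr (_ * _).
under eq_bigr do rewrite exprMn.
by rewrite big_split /= prodrXr -mdegE (fd m sm).
Qed.

End HomogeneousFactorsField.

Lemma prime_dvdrX (A : idomainType) (p a : A) k : prime_elt p ->
  dvdr p (a ^+ k) -> dvdr p a.
Proof.
move=> pP; elim: k => [|k IH]; last by rewrite exprS => /(prime_dvdrM pP)[].
rewrite expr0 => -[q pq]; case: pP => _ /negP[]; apply/unitrPr.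
by exists q; rewrite mulrC.
Qed.

(** * Invariance of forms along exponentials *)

Section InvariantForms.

Variables (K : closedFieldType) (R : local_algebra K).
Hypothesis charK0 : [pchar K] =i pred0.
Implicit Types (a b r x y z : R) (W : {vspace R}).

Local Notation m := (la_max R).
Local Notation D := (\dim {:R}).

Lemma deriv_eq0_const (q : {poly K}) : q^`() = 0 -> q = (q`_0)%:P.
Proof.
move=> q'0; apply/polyP => -[|i]; rewrite coefC //=.
have := congr1 (fun p : {poly K} => p`_i) q'0; rewrite coef_deriv coef0 => /eqP.
by rewrite -mulr_natr mulf_eq0 (pcharf0P K).1 // orbF => /eqP.
Qed.

Section Curve.

Variables (d : nat) (F : {ffun 'I_d -> R} -> K).
Hypothesis Fml : symmetric_multilinear F.

(** The curve t |-> exp(t a) r has velocity a exp(t a) r, so the Leibniz rule becomes the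
    infinitesimal variation along [a]. *)
Lemma nexp_curve a r : a \in m -> exists q : {poly K}, forall t,
  q.[t] = F (diag d (nexp (t *: a) * r)) /\
  q^`().[t] = infinitesimal F a (diag d (nexp (t *: a) * r)).
Proof.
move=> am; pose v (k : nat) : R := (k`!%:R : K)^-1 *: (a ^+ k * r).
have [q qP] := deriv_diag_curve (fun k : 'I_D => 'X^k) (fun k : 'I_D => v k) Fml.
exists q => t; have [-> ->] := qP t.
have curveE : \sum_(j < D) ('X^j).[t] *: v j = nexp (t *: a) * r.
  rewrite /nexp big_distrl; apply: eq_bigr => k _ /=.
  by rewrite hornerXn /v exprZn -!scalerAl !scalerA mulrC.
rewrite curveE; split=> //; rewrite /infinitesimal; apply: eq_bigr => i _.
congr (F (upd _ _ _)); rewrite [X in _ * X]ffunE -curveE big_distrr /=.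
(* Differentiating kills the constant term, and multiplying by [a] kills the last term since a^D =
   0; the remaining terms match after a shift of index. *)
rewrite -(prednK (dim_alg_gt0 R)) big_ord_recl [RHS]big_ord_recr /=.
rewrite expr0 derivC horner0 scale0r add0r [X in _ + X](_ : _ = 0) ?addr0; last first.
  rewrite /v /= -!scalerAr mulrA -exprS prednK ?dim_alg_gt0 //.
  by rewrite max_ideal_nilp // mul0r !scaler0.
apply: eq_bigr => k _; rewrite derivXn /= /bump add1n hornerMn !hornerXn.
rewrite add0n /v -!scalerAr !scalerA mulrA -exprS; congr (_ *: _).
rewrite -mulr_natr factS natrM invfM -mulrA mulVKf //.
by rewrite (pcharf0P K).1.
Qed.

Lemma infinitesimal0_nexp a r : a \in m ->
  (forall b : {ffun 'I_d -> R}, infinitesimal F a b = 0) ->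
  F (diag d (nexp a * r)) = F (diag d r).
Proof.
move=> am Fa; have [q qP] := nexp_curve r am.
have /deriv_eq0_const def_q : q^`() = 0.
  by apply: poly_nonzero_point => t; have [_ ->] := qP t; apply: Fa.
have [q1 _] := qP 1; have [q0 _] := qP 0; move: q0 q1.
by rewrite scale0r nexp0 mul1r scale1r => <- <-; rewrite def_q !hornerC.
Qed.

Lemma nexp_infinitesimal0 a : a \in m ->
  (forall t r, F (diag d (nexp (t *: a) * r)) = F (diag d r)) ->
  forall b : {ffun 'I_d -> R}, infinitesimal F a b = 0.
Proof.
move=> am Fa; apply: (polarization_diag charK0).
  exact: infinitesimal_multilinear.
move=> r; have [q qP] := nexp_curve r am.
have [_ <-] : q.[0] = F (diag d r) /\ q^`().[0] = infinitesimal F a (diag d r).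
  by have := qP 0; rewrite scale0r nexp0 mul1r.
have -> : q = (q.[0])%:P.
  apply/eqP; rewrite -subr_eq0; apply/eqP/poly_nonzero_point => t.
  rewrite !hornerE; have [-> _] := qP t; have [-> _] := qP 0.
  by rewrite !Fa subrr.
by rewrite derivC horner0.
Qed.

End Curve.

Section IrreducibleForms.

Variables (d : nat) (F : {ffun 'I_d -> R} -> K) (N : nat).
Variables (psi : {linear R -> 'rV[K]_N}) (f : {mpoly K[N]}).
Hypotheses (psi_bij : bijective psi) (fd : f \is d.-homog).
Hypothesis fF : forall r, f.@[psi r 0] = F (diag d r).

Let fun_inj (p q : {mpoly K[N]}) :
  (forall r, p.@[psi r 0] = q.@[psi r 0]) -> p = q.
Proof.
have [psi' _ psi'K] := psi_bij; move=> pq; apply: mpoly_fun_inj => v.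
have := pq (psi' (\row_i v i)); rewrite psi'K.
have e : (\row_j v j) 0 =1 v by move=> i; rewrite mxE.
by rewrite (meval_eq p e) (meval_eq q e).
Qed.

Lemma form_mpoly_neq0 W : preinvariant_wrt W F -> f != 0.
Proof.
case=> Fml [b [_ Fb]] _ _; apply: contraNneq Fb => f0.
by apply/eqP; apply: (polarization_diag charK0) => // r; rewrite -fF f0 meval0.
Qed.

(** Along exp(t a) r the product of the two factors is constant. Where f(r) is nonzero, both factors
    are therefore constant polynomials in t, and the variation of [F1] vanishes at r. Hence this
    variation times [f] is zero everywhere, and [f] can be cancelled. *)
Lemma preinvariant_factor W (g h : {mpoly K[N]}) d1 d2
    (F1 : {ffun 'I_d1 -> R} -> K) (F2 : {ffun 'I_d2 -> R} -> K) :
  preinvariant_wrt W F -> f = g * h ->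
  symmetric_multilinear F1 -> (forall r, F1 (diag d1 r) = g.@[psi r 0]) ->
  symmetric_multilinear F2 -> (forall r, F2 (diag d2 r) = h.@[psi r 0]) ->
  preinvariant_wrt W F1.
Proof.
move=> WF fgh F1ml F1g F2ml F2h; have f0 := form_mpoly_neq0 WF.
have [Fml [b0 [b0m Fb0]] genW Fa] := WF; split=> //.
  apply: NNPP => nex; case/eqP: Fb0; apply: (polarization charK0) => // t.
  rewrite -fF fgh mevalM -F1g; set x := \sum_j _.
  have xm : x \in m by apply: rpred_sum => j _; apply: rpredZ; apply: b0m.
  have [->|nz] := eqVneq (F1 (diag d1 x)) 0; first by rewrite mul0r.
  by case: nex; exists (diag d1 x); split=> // i; rewrite ffunE.
move=> a b aW; have [Wm _ _] := genW.
have am : a \in m by apply: (subvP Wm).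
rewrite -/(infinitesimal F1 a b); apply: (polarization_diag charK0).
  exact: infinitesimal_multilinear.
have [u [_ uP]] := mpoly_of_form (infinitesimal_multilinear a F1ml) psi_bij.
suff u0 : u = 0 by move=> r; rewrite -uP u0 meval0.
suff /eqP : u * f = 0 by rewrite mulf_eq0 (negbTE f0) orbF => /eqP.
apply: fun_inj => r; rewrite meval0 mevalM uP.
have [->|fr] := eqVneq f.@[psi r 0] 0; first by rewrite mulr0.
have [q1 q1P] := nexp_curve F1ml r am.
suff -> : infinitesimal F1 a (diag d1 r) = 0 by rewrite mul0r.
have [_] := q1P 0; rewrite scale0r nexp0 mul1r => <-.
suff sz : (size q1 <= 1)%N by rewrite [q1](size1_polyC sz) derivC horner0.
have [q2 q2P] := nexp_curve F2ml r am.
have q12 : q1 * q2 = (f.@[psi r 0])%:P.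
  apply/eqP; rewrite -subr_eq0; apply/eqP/poly_nonzero_point => t.
  rewrite !hornerE; have [-> _] := q1P t; have [-> _] := q2P t.
  rewrite F1g F2h -mevalM -fgh !fF infinitesimal0_nexp ?subrr ?memvZ //.
  by move=> b'; apply: Fa; apply: memvZ.
have : size (q1 * q2) = 1%N by rewrite q12 size_polyC fr.
have /andP[q10 q20] : (q1 != 0) && (q2 != 0).
  by rewrite -negb_or -mulf_eq0 q12 polyC_eq0.
rewrite size_mul //; move: q10 q20; rewrite -!size_poly_gt0.
by case: (size q1) (size q2) => [|[|k]] [|l] //; rewrite addSn addnS.
Qed.

Lemma irreducible_form_mpoly : (0 < d)%N -> irreducible_form F ->
  irreducible_mpoly f.
Proof.
move=> d0 [[W [F1 WF]] Firr]; have f0 := form_mpoly_neq0 WF.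
split=> // [|g h fgh].
  apply/negP => /unit_homog0 fd0; have := dhomog_uniq f0 fd fd0.
  by move: d0 => /[swap] ->.
apply: NNPP => /not_or_and[/negP gU /negP hU].
have [d1 [d2 [d12 def_d gd hd]]] := homog_factors f0 fd fgh gU hU.
have [G [Gml Gg]] := form_of_mpoly charK0 psi gd.
have [H [Hml Hh]] := form_of_mpoly charK0 psi hd.
case: Firr; exists d1, d2, W, G, H; split=> //.
- exact: (preinvariant_factor WF fgh Gml Gg Hml Hh).
- by apply: (preinvariant_factor WF _ Hml Hh Gml Gg); rewrite mulrC.
by split=> // v; rewrite -fF fgh mevalM Gg Hh.
Qed.

Hypothesis f_prime : prime_elt f.

(* Write 1 + y = exp (w + s u) with w in W and u outside W. Then F (1 + y) is *)
(* a polynomial in s = s(y); homogenizing its factorization, the prime f      *)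
(* divides a single factor s(y) - s_j, and s_j = 0 as F vanishes at 1.        *)
Lemma zero_exp_orbit W r : invariant_wrt W F ->
  F (diag d r) = 0 -> r \notin m -> exists c w, [/\ c != 0, w \in W & r = c *: nexp w].
Proof.
case=> F1 WF; have f0 := form_mpoly_neq0 WF.
have [Fml _ [Wm dW _] Fa] := WF.
have [psi' psiK psi'K] := psi_bij.
have [u um uW] : exists2 u, u \in m & u \notin W.
  apply: NNPP => nex; have /dimvS : (m <= W)%VS.
    by apply/subvP => x xm; apply: NNPP => /negP xW; apply: nex; exists x.
  by rewrite dW ltnn.
have [ell [ell1 ell_sub ell0]] := exists_residue R.
have [s [sW su]] := separating_functional uW.
have mE z : z \in m -> z - s z *: u \in W.
  have u0 : u != 0 by apply: contraNneq uW => ->; rewrite mem0v.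
  have dWu : (W + <[u]>)%VS = m.
    apply/eqP; rewrite eqEdim subv_add Wm /= -memvE um /= dW.
    rewrite dimv_disjoint_sum; first by rewrite dim_vline u0 addn1.
    apply/eqP; rewrite -subv0; apply/subvP => x; rewrite memv_cap => /andP[xW].
    case/vlineP=> c def_x; have c0 : c = 0.
      by rewrite -(sW x xW) def_x linearZ /= su /GRing.scale /= mulr1.
    by rewrite def_x c0 scale0r mem0v.
  rewrite -dWu => /memv_addP[w wW [_ /vlineP[c ->] ->]].
  have -> : s (w + c *: u) = c.
    by rewrite linearD linearZ /= (sW w wW) su add0r /GRing.scale /= mulr1.
  by rewrite addrK.
have FZ c x : F (diag d (c *: x)) = c ^+ d * F (diag d x).
  rewrite -!fF linearZ -(homog_scale _ _ fd); apply: meval_eq => i.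
  by rewrite mxE.
have [L LE] := polynomial_fun_linear psiK psi'K ell (polynomial_endo_id psi).
have [S SE] := polynomial_fun_linear psiK psi'K s
  (polynomial_endo_nlog psiK psi'K).
have [e [P PE]] := homogenization S (fun j => 'X_j - (psi 1 0 j) *: L) L.
pose y x := (ell x)^-1 *: x - 1.
have ym x : ell x != 0 -> y x \in m.
  move=> lx; rewrite -ell0 linearB linearZ /= ell1.
  by rewrite /GRing.scale /= mulVf // subrr.
have def_x x : ell x != 0 -> x = ell x *: (1 + y x).
  by move=> lx; rewrite /y addrC subrK scalerA divff // scale1r.
have {}PE x : ell x != 0 -> P.@[psi x 0] = ell x ^+ e * s (nlog (y x)).
  move=> lx; rewrite PE -LE // SE; congr (_ * _); apply: meval_eq => j.
  rewrite mevalB mevalXU mevalZ -LE /y linearB linearZ !mxE mulrBl.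
  by rewrite mulrC mulfK.
(* [chi] is the one-variable polynomial F(exp(t u)); by invariance under exp(W), F at exp(w + t u)
   is its value at t. *)
have [chi chiE] := nexp_curve Fml 1 um.
have key z : z \in m -> F (diag d (1 + z)) = chi.[s (nlog z)].
  move=> zm; have [-> _] := chiE (s (nlog z)); rewrite mulr1.
  have wW := mE _ (nlog_max zm); rewrite -{1}(nexp_nlog charK0 zm).
  rewrite -{1}(subrK (s (nlog z) *: u) (nlog z)) (nexpD charK0) ?memvZ //.
    by rewrite (infinitesimal0_nexp Fml) // => [|b]; [apply: (subvP Wm) | apply: Fa].
  exact: (subvP Wm).
have FE x : ell x != 0 -> F (diag d x) = ell x ^+ d * chi.[s (nlog (y x))].
  by move=> lx; rewrite {1}(def_x x lx) FZ key // ym.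
have [rs def_chi] := closed_field_poly_normal chi.
set kappa := lead_coef chi in def_chi.
have L0 : L != 0.
  by apply: contraNneq (oner_neq0 K) => L0; apply/eqP; rewrite -[LHS]ell1 LE L0 meval0.
have kappa0 : kappa != 0.
  apply: contraNneq (mulf_neq0 f0 L0) => k0; apply/eqP; apply: fun_inj => x.
  rewrite meval0 mevalM -LE fF; have [->|lx] := eqVneq (ell x) 0.
    by rewrite mulr0.
  by rewrite FE // def_chi k0 scale0r horner0 mulr0 mul0r.
have def_f : L * (f * L ^+ (e * size rs)) =
    L ^+ d.+1 * (kappa%:MP * \prod_(z <- rs) (P - z *: L ^+ e)).
  apply: fun_inj => x; rewrite !mevalM !rmorphXn /= -LE.
  have [->|lx] := eqVneq (ell x) 0; first by rewrite exprS !mul0r.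
  rewrite fF FE // mevalC def_chi hornerZ horner_prod rmorph_prod /=.
  rewrite [in RHS](eq_bigr (fun z : K => (ell x : K) ^+ e * ('X - z%:P).[s (nlog (y x)) : K])); last first.
    by move=> z _; rewrite mevalB mevalZ rmorphXn /= -LE PE // !hornerE; ring.
  rewrite big_split /= big_const_seq count_predT iter_mulr_1 exprM exprS; ring.
have at1 g : dvdr f g -> g.@[psi 1 0] = 0.
  by case=> q ->; rewrite mevalM fF F1 mulr0.
have y1 : y 1 = 0 by rewrite /y ell1 invr1 scale1r subrr.
have ell10 : ell 1 != 0 by rewrite ell1 oner_neq0.
have fP : dvdr f P.
  have : dvdr f (L * (f * L ^+ (e * size rs))).
    by apply: dvdr_mull; apply: dvdr_mulr; apply: dvdrr.
  rewrite def_f => /(prime_dvdrM f_prime)[/(prime_dvdrX f_prime)/at1|].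
    by rewrite -LE ell1 => /eqP; rewrite oner_eq0.
  case/(prime_dvdrM f_prime) => [/at1|].
    by rewrite mevalC => /eqP; rewrite (negbTE kappa0).
  rewrite -(big_map (fun z : K => P - z *: L ^+ e) xpredT id).
  case/(prime_dvdr_prod f_prime) => _ /mapP[z _ ->] /[dup] /at1.
  rewrite mevalB mevalZ rmorphXn /= -LE PE // y1 nlog0 linear0 ell1 !expr1n.
  by rewrite mul1r mulr1 sub0r => /eqP; rewrite oppr_eq0 => /eqP->; rewrite scale0r subr0.
move=> Fr rm; have lr : ell r != 0 by rewrite ell0.
exists (ell r), (nlog (y r)); split=> //; last first.
  by rewrite (nexp_nlog charK0) ?ym //; apply: def_x.
have : P.@[psi r 0] = 0 by case: fP => q ->; rewrite mevalM fF Fr mulr0.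
rewrite PE // => /eqP; rewrite mulf_eq0 expf_eq0 (negbTE lr) andbF /= => /eqP sy.
by have := mE _ (nlog_max (ym _ lr)); rewrite sy scale0r subr0.
Qed.

(** Two distinct hyperplanes span m, so [F] would be unchanged by exp(m) = 1 + m. Since F(1) = 0, it
    would vanish at every unit, and [f] times the residue form would be zero. *)
Lemma invariant_hyperplane_unique W W' :
  invariant_wrt W F -> invariant_wrt W' F -> W = W'.
Proof.
case=> F1 WF [_ W'F]; have f0 := form_mpoly_neq0 WF.
have [Fml _ [Wm dW _] Fa] := WF; have [_ _ [W'm dW' _] Fa'] := W'F.
have [psi' psiK psi'K] := psi_bij.
apply: NNPP => neW; case/negP: f0; apply/eqP.
have WW' : (W + W')%VS = m.
  apply/eqP; rewrite eqEdim subv_add Wm W'm /= dW.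
  rewrite ltn_neqAle (dimv_leqif_eq (addvSl W W')) (dimvS (addvSl W W')) andbT.
  apply/eqP => WE; case: neW; apply/eqP; rewrite eq_sym eqEdim; apply/andP; split.
    by rewrite WE addvSr.
  by rewrite -ltnS -dW' dW.
have Fm a (b : {ffun 'I_d -> R}) : a \in m -> infinitesimal F a b = 0.
  rewrite -WW' => /memv_addP[w wW [w' wW' ->]].
  have Flin i x z : F (upd b i (x + z)) = F (upd b i x) + F (upd b i z).
    by case: Fml => /(_ b i 1 x z); rewrite scale1r mul1r.
  rewrite /infinitesimal; under eq_bigr do rewrite mulrDl Flin.
  by rewrite big_split /= (Fa _ b wW) (Fa' _ b wW') addr0.
have [ell [ell1 ell_sub ell0]] := exists_residue R.
have [L LE] := polynomial_fun_linear psiK psi'K ell (polynomial_endo_id psi).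
have L0 : L != 0.
  by apply: contraNneq (oner_neq0 K) => L0; apply/eqP; rewrite -[LHS]ell1 LE L0 meval0.
suff /eqP : f * L = 0 by rewrite mulf_eq0 (negbTE L0) orbF => /eqP.
apply: fun_inj => x; rewrite meval0 mevalM -LE; have [->|lx] := eqVneq (ell x) 0.
  by rewrite mulr0.
have ym : (ell x)^-1 *: x - 1 \in m.
  rewrite -ell0 linearB linearZ /= ell1.
  by rewrite /GRing.scale /= mulVf // subrr.
have def_x : x = ell x *: (1 + ((ell x)^-1 *: x - 1)).
  by rewrite addrC subrK scalerA divff // scale1r.
have -> : f.@[psi x 0] = ell x ^+ d * F (diag d (1 + ((ell x)^-1 *: x - 1))).
  rewrite -fF -(homog_scale _ _ fd); apply: meval_eq => i.
  by rewrite {1}def_x linearZ mxE.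
rewrite -(nexp_nlog charK0 ym) -[nexp _]mulr1 (infinitesimal0_nexp Fml) ?nlog_max //.
  by rewrite F1 mulr0 mul0r.
by move=> b; apply: Fm; apply: nlog_max.
Qed.

End IrreducibleForms.

End InvariantForms.

(** * Morphisms of projective space *)

Section ProjectiveLines.

Variables (K : fieldType) (N : nat).
Implicit Types (x y : 'rV[K]_N) (L : proj K N).

Fact line_dim x : x != 0 -> \dim <[x]> == 1%N.
Proof. by rewrite dim_vline => ->. Qed.

Definition line x (x0 : x != 0) : proj K N := Sub <[x]>%VS (line_dim x0).

Lemma proj_vec L : exists2 x, x != 0 & val L = <[x]>%VS.
Proof.
have L1 := valP L; exists (vpick (val L)).
  by rewrite vpick0 -dimv_eq0 (eqP L1).
apply/eqP; rewrite eq_sym eqEdim -memvE memv_pick (eqP L1) dim_vline.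
by rewrite vpick0 -dimv_eq0 (eqP L1).
Qed.

Lemma proj_vec_neq0 L x : val L = <[x]>%VS -> x != 0.
Proof.
by move=> Lx; have := valP L; rewrite Lx dim_vline; case: (x != 0).
Qed.

Lemma vline_eqP x y : x != 0 -> <[x]>%VS = <[y]>%VS -> exists2 c, c != 0 & x = c *: y.
Proof.
move=> x0 xy; have : x \in <[y]>%VS by rewrite -xy memv_line.
case/vlineP=> c def_x; exists c => //.
by apply: contraNneq x0 => c0; rewrite def_x c0 scale0r.
Qed.

Lemma vline_scale c x : c != 0 -> <[c *: x]>%VS = <[x]>%VS.
Proof.
move=> c0; apply/eqP; rewrite eqEsubv -!memvE memvZ ?memv_line //=.
by rewrite -[x in x \in _](scalerK c0) memvZ // memv_line.
Qed.

End ProjectiveLines.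

Lemma proportional_linear (K : fieldType) (U V : lmodType K) (f g : {linear U -> V}) :
  injective g -> (forall u, exists c, f u = c *: g u) ->
  exists c, forall u, f u = c *: g u.
Proof.
move=> g_inj fg.
have [[u0 u00]|nex] := classic (exists u : U, u != 0); last first.
  exists 0 => u; have [->|u0] := eqVneq u 0; last by case: nex; exists u.
  by rewrite scale0r linear0.
have [c0 fu0] := fg u0; exists c0 => u.
have [[l def_u]|nl] := classic (exists l, u = l *: u0).
  by rewrite def_u !linearZ /= fu0 !scalerA mulrC.
have [c fu] := fg u; have [e] := fg (u + u0).
rewrite !linearD /= fu fu0 => /eqP; rewrite -subr_eq0 opprD addrACA -!scalerBl.
rewrite addr_eq0 -scaleNr -!linearZ => /eqP /g_inj; have [->|ce] := eqVneq c e.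
  rewrite subrr scale0r => /esym/eqP; rewrite scaler_eq0 (negbTE u00) orbF.
  by rewrite oppr_eq0 subr_eq0 => /eqP->.
move=> h; case: nl; exists ((c - e)^-1 * - (c0 - e)).
by rewrite -scalerA -h scalerK // subr_eq0.
Qed.

(** * Homogeneous polynomials with parameters *)

Section Evaluation.

Variables (K : closedFieldType).

Lemma mpoly_row_inj N (p q : {mpoly K[N]}) :
  (forall x : 'rV[K]_N, p.@[x 0] = q.@[x 0]) -> p = q.
Proof.
move=> pq; apply: mpoly_fun_inj => v.
have e : (\row_j v j) 0 =1 v by move=> i; rewrite mxE.
by have := pq (\row_j v j); rewrite (meval_eq p e) (meval_eq q e).
Qed.

Variables (B : idomainType) (T : Type) (ev : T -> {rmorphism B -> K}) (N : nat).
Hypothesis ev_inj0 : forall b, (forall g, ev g b = 0) -> b = 0.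
Implicit Types (p q : {mpoly B[N]}) (g : T) (x : 'rV[K]_N).

Definition eval_at p g x : K := (map_mpoly (ev g) p).@[x 0].

Lemma eval_atM p q g x : eval_at (p * q) g x = eval_at p g x * eval_at q g x.
Proof. by rewrite /eval_at rmorphM mevalM. Qed.

Lemma eval_atB p q g x : eval_at (p - q) g x = eval_at p g x - eval_at q g x.
Proof. by rewrite /eval_at rmorphB mevalB. Qed.

Lemma eval_at0 g x : eval_at 0 g x = 0.
Proof. by rewrite /eval_at !rmorph0. Qed.

Lemma eval_atX i g x : eval_at 'X_i g x = x 0 i.
Proof. by rewrite /eval_at map_mpolyX mevalXU. Qed.

Lemma eval_at_inj0 p : (forall g x, eval_at p g x = 0) -> p = 0.
Proof.
move=> p0; apply/mpolyP => m; rewrite mcoeff0; apply: ev_inj0 => g.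
rewrite -mcoeff_map_mpoly.
suff -> : map_mpoly (ev g) p = 0 by rewrite mcoeff0.
by apply: mpoly_row_inj => x; rewrite meval0 -[LHS]/(eval_at p g x) p0.
Qed.

Lemma eval_at_homog e p g : p \is e.-homog -> map_mpoly (ev g) p \is e.-homog.
Proof.
move=> /dhomogP pe; apply/dhomogP => m; rewrite mcoeff_msupp mcoeff_map_mpoly => pm.
by apply: pe; rewrite mcoeff_msupp; apply: contraNneq pm => ->; rewrite raddf0.
Qed.

End Evaluation.

Lemma common_degree (B : idomainType) (N M : nat) (c : {mpoly B[N]}) e
    (q : 'I_M -> {mpoly B[N]}) : c != 0 ->
  (forall i, c * q i \is e.-homog) -> exists e', forall i, q i \is e'.-homog.
Proof.
move=> c0 cq.
have [[j qj]|nex] := classic (exists j, q j != 0); last first.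
  exists 0 => i; have [->|qi] := eqVneq (q i) 0; first exact: dhomog0.
  by case: nex; exists i.
have [k0 ck] : exists k0, c \is k0.-homog.
  exact: (@homogeneous_factor _ _ e _ c (q j) (mulf_neq0 c0 qj) (cq j) erefl).
exists (e - k0)%N => i; have [->|qi] := eqVneq (q i) 0; first exact: dhomog0.
have [k1 qk] : exists k1, q i \is k1.-homog.
  exact: (@homogeneous_factor _ _ e _ (q i) c (mulf_neq0 c0 qi) (cq i) (mulrC _ _)).
have := dhomog_uniq (mulf_neq0 c0 qi) (cq i) (dhomogM ck qk).
by move=> ->; rewrite addnC addnK.
Qed.

(** * Gluing the charts of a morphism *)

Section Globalization.

Variables (K : closedFieldType) (B : idomainType) (T : Type).
Variables (ev : T -> {rmorphism B -> K}) (n : nat).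
Hypothesis ev_inj0 : forall b, (forall g, ev g b = 0) -> b = 0.
Hypothesis facB : factorial_ring B.
Local Notation N := n.+2.
Local Notation A := {mpoly B[N]}.
Implicit Types (p q : 'I_N -> A) (h : A) (g : T) (L : proj K N) (x : 'rV[K]_N).
Variables (phi : T -> proj K N -> proj K N) (g00 : T).

Definition chart p h : Prop := forall g L x, val L = <[x]>%VS ->
  eval_at ev h g x != 0 -> val (phi g L) = <[\row_i eval_at ev (p i) g x]>%VS.

Hypothesis phiP : forall g0 L0, exists e p h, [/\ forall i, p i \is e.-homog,
  forall x, val L0 = <[x]>%VS -> eval_at ev h g0 x != 0 & chart p h].

Let facA : factorial_ring A.
Proof. exact: factorial_mpoly. Qed.

Let coord0 : (delta_mx 0 0 : 'rV[K]_N) != 0.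
Proof.
apply/eqP => /matrixP /(_ 0 0); rewrite !mxE !eqxx /= => /eqP.
by rewrite oner_eq0.
Qed.

Let chart_minors p q h h' : chart p h -> chart q h' -> h != 0 -> h' != 0 ->
  forall i l, p i * q l = p l * q i.
Proof.
move=> ph qh h0 h'0 i l; apply/eqP; rewrite -subr_eq0; apply/eqP.
(* The factors [h] and [h'] confine the check to the common domain of the charts, and ['X_0]
   disposes of the zero vector, which spans no line. *)
suff /eqP : 'X_0 * (h * h') * (p i * q l - p l * q i) = 0.
  rewrite !mulf_eq0 (negbTE h0) (negbTE h'0) !orbF.
  by rewrite -msupp_eq0 msuppX /= => /eqP.
apply: (eval_at_inj0 ev_inj0) => g x; rewrite !eval_atM eval_atB !eval_atM eval_atX.
have [->|x0] := eqVneq x 0; first by rewrite mxE !mul0r.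
have [->|hx] := eqVneq (eval_at ev h g x) 0; first by rewrite mul0r mulr0 mul0r.
have [->|h'x] := eqVneq (eval_at ev h' g x) 0; first by rewrite !mulr0 mul0r.
have E0 := qh g (line x0) x erefl h'x.
have E1 := ph g (line x0) x erefl hx.
have [c c0 pE] := vline_eqP (proj_vec_neq0 E1) (etrans (esym E1) E0).
have pE' j : eval_at ev (p j) g x = c * eval_at ev (q j) g x.
  by have /rowP/(_ j) := pE; rewrite !mxE.
by rewrite !pE' [c * _ * _]mulrAC subrr mulr0.
Qed.

(* On any two charts the local equations are proportional, hence multiples of *)
(* the primitive tuple obtained from one of them.                             *)
Lemma charts_global : exists e q, (forall i, q i \is e.-homog) /\
  forall g L x, val L = <[x]>%VS ->
    val (phi g L) = <[\row_i eval_at ev (q i) g x]>%VS.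
Proof.
have [e0 [p0 [h0 [p0e h0x p0P]]]] := phiP g00 (line coord0).
have h0_neq0 : h0 != 0.
  by apply: contraNneq (h0x (delta_mx 0 0) erefl) => ->; rewrite eval_at0.
have [j p0j] : exists j, p0 j != 0.
  have := proj_vec_neq0 (p0P g00 (line coord0) _ erefl (h0x _ erefl)).
  move=> nz; apply: NNPP => nex; case/negP: nz; apply/eqP/rowP => i; rewrite !mxE.
  have [->|pi] := eqVneq (p0 i) 0; first by rewrite eval_at0.
  by case: nex; exists i.
have [c [q [def_p0 qj qprim]]] := primitive_tuple facA p0j.
have c0 : c != 0 by apply: contraNneq p0j => c0; rewrite def_p0 c0 mul0r.
have [e qe] : exists e, forall i, q i \is e.-homog.
  by apply: (common_degree (c := c) (e := e0)) => // i; rewrite -def_p0.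
exists e, q; split=> // g L x Lx.
have [e1 [p1 [h1 [_ h1x p1P]]]] := phiP g L.
have h1_neq0 : h1 != 0.
  by apply: contraNneq (h1x x Lx) => ->; rewrite eval_at0.
have minors := chart_minors p1P p0P h1_neq0 h0_neq0.
have [d dP] : exists d, forall i, p1 i = d * q i.
  apply: (primitive_tuple_proportional facA qj qprim) => i l.
  by apply: (mulfI c0); rewrite mulrCA -def_p0 minors def_p0 mulrCA.
(* The chart at the given point has a nonzero value there, equal to [d] times the value of [q]; so
   [d] is nonzero and [q] spans the same line. *)
have E1 := p1P g L x Lx (h1x x Lx).
have rowE : \row_i eval_at ev (p1 i) g x = eval_at ev d g x *: \row_i eval_at ev (q i) g x.
  by apply/rowP => i; rewrite !mxE dP eval_atM.
rewrite E1 rowE; apply: vline_scale; apply: contraNneq (proj_vec_neq0 E1) => d0.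
by rewrite rowE d0 scale0r.
Qed.

End Globalization.

Lemma morphism_global (K : closedFieldType) (k n : nat)
    (phi : 'rV[K]_k -> proj K n.+2 -> proj K n.+2) :
  morphism_AP phi -> exists e (q : 'I_n.+2 -> {mpoly {mpoly K[k]}[n.+2]}),
    (forall i, q i \is e.-homog) /\
    forall g L x, val L = <[x]>%VS ->
      val (phi g L) = <[\row_i bieval (q i) g x]>%VS.
Proof.
move=> phiP; pose ev (g : 'rV[K]_k) : {rmorphism {mpoly K[k]} -> K} := meval (g 0).
have ev_inj0 (b : {mpoly K[k]}) : (forall g, ev g b = 0) -> b = 0.
  by move=> b0; apply: mpoly_row_inj => g; rewrite meval0; apply: b0.
apply: (charts_global ev_inj0 _ 0) => [|g0 L0].
  by apply: factorial_mpoly; apply: factorial_field.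
have [e [e' [p [h [pe _ hx pP]]]]] := phiP g0 L0.
by exists e, p, h.
Qed.

Lemma meval_poly_curve (K : comNzRingType) N (f : {mpoly K[N]}) (c : 'I_N -> {poly K}) :
  exists q : {poly K}, forall t, q.[t] = f.@[fun i => (c i).[t]].
Proof.
exists (mmap polyC c f) => t; rewrite /mmap mevalE horner_sum.
apply: eq_bigr => m _; rewrite hornerM hornerC; congr (_ * _).
rewrite horner_prod; apply: eq_bigr => i _.
by rewrite horner_exp.
Qed.

Lemma nonvanishing_const (K : closedFieldType) (q : {poly K}) :
  (forall t, q.[t] != 0) -> forall t, q.[t] = q.[0].
Proof.
move=> q0 t; have [sz|] := boolP (size q == 1%N).
  by rewrite [q]size1_polyC ?(eqP sz) // !hornerC.
by case/closed_rootP => x; rewrite /root (negbTE (q0 x)).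
Qed.

Lemma natr_inj (K : fieldType) (charK0 : [pchar K] =i pred0) a b :
  (a%:R == b%:R :> K) = (a == b).
Proof.
wlog le_ab : a b / (a <= b)%N.
  by move=> h; case: (leqP a b) => [/h //|/ltnW/h]; rewrite eq_sym => ->; apply: eq_sym.
by rewrite eq_sym -subr_eq0 -natrB // (pcharf0P K).1 // subn_eq0 eqn_leq le_ab.
Qed.

(** * Invertible morphisms are linear *)

Section DegreeOne.

Variables (K : closedFieldType) (n : nat).
Hypothesis charK0 : [pchar K] =i pred0.
Local Notation N := n.+2.
Variables (p q : 'I_N -> {mpoly K[N]}) (e e' : nat).
Hypotheses (pe : forall i, p i \is e.-homog) (qe : forall i, q i \is e'.-homog).

Let Q (x : 'rV[K]_N) : 'rV[K]_N := \row_i (q i).@[x 0].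
Let G (x : 'rV[K]_N) : 'rV[K]_N := \row_i (p i).@[Q x 0].

Hypothesis GP : forall x, x != 0 -> exists2 c, c != 0 & G x = c *: x.

Let GZ c x : G (c *: x) = c ^+ (e' * e) *: G x.
Proof.
apply/rowP => i; rewrite !mxE exprM -(homog_scale _ _ (pe i)); apply: meval_eq => j.
rewrite !mxE -(homog_scale _ _ (qe j)); apply: meval_eq => l.
by rewrite mxE.
Qed.

(** On this affine line the coordinate [b] equals 1, so the scalar relating G x to x is the [b]
    coordinate of G x. It is a polynomial in t without zeros, hence constant. *)
Let line_const (a b : 'I_N) : a != b -> exists2 c, c != 0 &
  forall t, G (t *: delta_mx 0 a + delta_mx 0 b) =
            c *: (t *: delta_mx 0 a + delta_mx 0 b).
Proof.
move=> ab; pose x t : 'rV[K]_N := t *: delta_mx 0 a + delta_mx 0 b.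
have xb t : x t 0 b = 1 by rewrite !mxE !eqxx eq_sym (negbTE ab) /= mulr0 add0r.
have x0 t : x t != 0.
  apply/eqP => /rowP/(_ b); rewrite xb mxE => /eqP; by rewrite oner_eq0.
pose xp i : {poly K} := (i == a)%:R *: 'X + ((i == b)%:R)%:P.
have xpE t i : (xp i).[t] = x t 0 i by rewrite !hornerE !mxE /= mulrC.
have [Qp QpE] : exists Qp : 'I_N -> {poly K}, forall i t, (Qp i).[t] = Q (x t) 0 i.
  apply: (@fin_all_exists _ (fun=> {poly K})
    (fun i r => forall t, r.[t] = Q (x t) 0 i)) => i; have [r rE] := meval_poly_curve (q i) xp.
  by exists r => t; rewrite rE mxE; apply: meval_eq => j; apply: xpE.
have [r rE] := meval_poly_curve (p b) Qp.
have {}rE t : r.[t] = G (x t) 0 b.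
  by rewrite rE mxE; apply: meval_eq => j; apply: QpE.
have GxE t : G (x t) = r.[t] *: x t.
  have [c c0 cE] := GP (x0 t); rewrite cE; congr (_ *: _).
  by rewrite rE cE mxE xb mulr1.
have r0 t : r.[t] != 0.
  have [c c0 cE] := GP (x0 t).
  by rewrite rE cE mxE xb mulr1.
by exists r.[0] => // t; rewrite -(nonvanishing_const r0 t); apply: GxE.
Qed.

(* Compare G at (1, 1) and (2, 1) through the lines (t, 1) and (1, t). *)
Lemma inverse_degree_one : e = 1%N.
Proof.
have ne : (0 : 'I_N) != 1 by [].
have ne' : (1 : 'I_N) != 0 by [].
have [c c0 cE] := line_const ne; have [c' c'0 c'E] := line_const ne'.
have xa (a b : 'I_N) (t : K) : a != b ->
    (t *: delta_mx 0 a + delta_mx 0 b : 'rV[K]_N) 0 a = t.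
  by move=> /negbTE ab; rewrite !mxE !eqxx ab mulr1 addr0.
have xb (a b : 'I_N) (t : K) : a != b ->
    (t *: delta_mx 0 a + delta_mx 0 b : 'rV[K]_N) 0 b = 1.
  by rewrite eq_sym => /negbTE ab; rewrite !mxE !eqxx ab mulr0 add0r.
have cc' : c = c'.
  have e1 : 1 *: delta_mx 0 0 + delta_mx 0 1 =
      1 *: delta_mx 0 1 + delta_mx 0 0 :> 'rV[K]_N by rewrite !scale1r addrC.
  have := congr1 (fun v : 'rV[K]_N => v 0 1) (cE 1).
  by rewrite [RHS]mxE xb // e1 c'E [LHS]mxE xa // !mulr1.
have two0 : (2%:R : K) != 0 by rewrite (pcharf0P K).1.
have e2 : 2%:R *: delta_mx 0 0 + delta_mx 0 1 =
    2%:R *: (2%:R^-1 *: delta_mx 0 1 + delta_mx 0 0) :> 'rV[K]_N.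
  by rewrite scalerDr scalerA divff // scale1r addrC.
have := congr1 (fun v : 'rV[K]_N => v 0 0) (cE 2%:R).
rewrite [RHS]mxE xa // e2 GZ c'E cc' mxE [X in _ * X]mxE xb // mulr1.
rewrite [RHS]mulrC => /(mulIf c'0) /eqP.
rewrite -natrX (natr_inj charK0) -[X in _ == X]expn1 => /eqP /(expnI (ltnSn 1)) /eqP.
by rewrite muln_eq1 => /andP[_ /eqP].
Qed.

End DegreeOne.

Lemma homog1E (A : comNzRingType) N (p : {mpoly A[N]}) : p \is 1.-homog ->
  p = \sum_j p@_U_(j) *: 'X_j.
Proof.
move=> /dhomogP pd; apply/mpolyP => m; rewrite raddf_sum /=.
have [pm|] := boolP (m \in msupp p).
  have /eqP := pd m pm; rewrite mdeg_eq1 => /existsP[i /eqP->].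
  rewrite (bigD1 i) //= mcoeffZ mcoeffX eqxx mulr1 big1 ?addr0 // => j nj.
  by rewrite mcoeffZ mcoeffX eq_mnm1 (negbTE nj) mulr0.
move=> pm; rewrite (memN_msupp_eq0 pm) big1 // => j _.
rewrite mcoeffZ mcoeffX; case: eqP => [e|_]; last by rewrite mulr0.
by rewrite e (memN_msupp_eq0 pm) mul0r.
Qed.

Lemma eval_at_linear (K : closedFieldType) (B : idomainType) (T : Type)
    (ev : T -> {rmorphism B -> K}) N (p : {mpoly B[N]}) g (x : 'rV[K]_N) :
  p \is 1.-homog -> eval_at ev p g x = \sum_j x 0 j * ev g p@_U_(j).
Proof.
move=> p1; rewrite {1}(homog1E p1) /eval_at (rmorph_sum (map_mpoly (ev g))) rmorph_sum.
apply: eq_bigr => j _ /=.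
by rewrite map_mpolyZ map_mpolyX mevalZ mevalXU mulrC.
Qed.

Section Linearization.

Variables (K : closedFieldType) (k n : nat).
Hypothesis charK0 : [pchar K] =i pred0.
Local Notation N := n.+2.

(** The degree of the global equations is the same for all parameters, so the inverse morphism at
    the single parameter [g0] forces them to be linear in the projective coordinates. *)
Lemma linearize (phi : 'rV[K]_k -> proj K N -> proj K N) g0
    (psi : proj K N -> proj K N) :
  morphism_AP phi -> morphism_AP (fun _ : 'rV[K]_0 => psi) ->
  (forall L, phi g0 (psi L) = L) ->
  exists M : 'M[{mpoly K[k]}]_N, forall g L x, val L = <[x]>%VS ->
    val (phi g L) = <[x *m rep M g]>%VS.
Proof.
move=> /morphism_global[e [p [pe pP]]] /morphism_global[e' [q [qe qP]]] phipsi.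
pose pg i := map_mpoly (meval (g0 0)) (p i).
pose q0 i := map_mpoly (meval ((0 : 'rV[K]_0) 0)) (q i).
have pge i : pg i \is e.-homog.
  exact: (@eval_at_homog K _ _ (fun g : 'rV[K]_k => meval (g 0))).
have q0e i : q0 i \is e'.-homog.
  exact: (@eval_at_homog K _ _ (fun g : 'rV[K]_0 => meval (g 0))).
have e1 : e = 1%N.
  apply: (inverse_degree_one charK0 pge q0e) => x x0.
  have E := pP g0 _ _ (qP 0 (line x0) x erefl); rewrite phipsi /= in E.
  have [c c0 xE] := vline_eqP x0 E; exists c^-1; first by rewrite invr_eq0.
  by rewrite [X in _ = _ *: X]xE scalerK.
rewrite {}e1 in pe {pge}.
pose M : 'M[{mpoly K[k]}]_N := \matrix_(j, i) (p i)@_U_(j).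
exists M => g L x Lx; rewrite (pP g L x Lx); congr <[_]>%VS; apply/rowP => i.
rewrite !mxE.
rewrite -[LHS]/(eval_at (fun g : 'rV[K]_k => meval (g 0)) (p i) g x).
by rewrite eval_at_linear //; apply: eq_bigr => j _; rewrite !mxE.
Qed.

End Linearization.

Section Representation.

Variables (K : closedFieldType) (n N : nat).
Implicit Types (P : 'M[{mpoly K[n]}]_N) (g h : 'rV[K]_n).

Definition rep_curve P g : 'M[{poly K}]_N :=
  map_mx (mmap polyC (fun i => g 0 i *: 'X)) P.

Lemma rep_curveE P g t : map_mx (horner_eval t) (rep_curve P g) = rep P (t *: g).
Proof.
apply/matrixP => i j; rewrite !mxE /horner_eval /mmap mevalE horner_sum.
apply: eq_bigr => m _; rewrite hornerM hornerC horner_prod; congr (_ * _).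
by apply: eq_bigr => l _; rewrite horner_exp !hornerE mxE mulrC.
Qed.

End Representation.

Lemma proportional_mx (K : fieldType) N (A B : 'M[K]_N) : \det B != 0 ->
  (forall x : 'rV[K]_N, x != 0 -> <[x *m A]>%VS = <[x *m B]>%VS) ->
  exists c, A = c *: B.
Proof.
move=> B0 AB; have B_inj : injective (mulmxr B : 'rV[K]_N -> 'rV[K]_N).
  move=> x y /= xy; apply/eqP; rewrite -subr_eq0; apply: contraNT B0 => xy0.
  by apply/det0P; exists (x - y); rewrite // mulmxBl xy subrr.
have [|c cE] := @proportional_linear _ _ _ (mulmxr A) (mulmxr B) B_inj.
  move=> x /=; have [->|x0] := eqVneq x 0; first by exists 0; rewrite !mul0mx scaler0.
  have : x *m A \in <[x *m B]>%VS by rewrite -AB // memv_line.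
  by case/vlineP=> c cE; exists c.
exists c; apply/row_matrixP => i; rewrite linearZ /= !rowE.
exact: cE.
Qed.

Lemma morphism_id (K : closedFieldType) k N :
  morphism_AP (fun (_ : 'rV[K]_k) (L : proj K N) => L).
Proof.
move=> g0 L0; exists 1%N, 0%N, (fun i => 'X_i), 1; split.
- by move=> i; rewrite dhomogX /= mdeg1.
- exact: dhomog1.
- by move=> x _; rewrite /bieval rmorph1 meval1 oner_neq0.
move=> g L x Lx _; rewrite Lx; congr <[_]>%VS; apply/rowP => i.
by rewrite mxE /bieval map_mpolyX mevalXU.
Qed.

(** The linearization is multiplicative up to a scalar. Along a line through the origin of the
    parameter space this scalar is a quotient of polynomials without zeros, hence constant, and the
    normalization at 0 makes it 1. Effectiveness of the action gives injectivity. *)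
Lemma rep_of_action (K : closedFieldType) (charK0 : [pchar K] =i pred0) n d
    (X : additive_action K n d) :
  exists P : 'M[{mpoly K[n]}]_n.+2,
    [/\ rep P 0 = 1%:M, forall g h, rep P (g + h) = rep P g *m rep P h,
        injective (rep P)
      & forall g (L : proj K n.+2) x, val L = <[x]>%VS ->
          val (aact X g L) = <[x *m rep P g]>%VS].
Proof.
have [M ME] := linearize charK0 (aact_morphism X) (@morphism_id K 0 n.+2) (aact0 X).
have lineE g x (x0 : x != 0) : val (aact X g (line x0)) = <[x *m rep M g]>%VS.
  exact: ME.
have M_det g : \det (rep M g) != 0.
  by apply/det0P => -[x x0 xM]; have := proj_vec_neq0 (lineE g x x0); rewrite xM eqxx.
have [l lE] : exists l, rep M 0 = l *: 1%:M.
  apply: proportional_mx => [|x x0]; first by rewrite det1 oner_neq0.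
  by rewrite -lineE aact0 mulmx1.
have l0 : l != 0.
  apply: contraNneq (M_det 0) => l0.
  by rewrite lE l0 detZ expr0n mul0r.
pose P : 'M[{mpoly K[n]}]_n.+2 := map_mx (fun p => l^-1 *: p) M.
have PE g : rep P g = l^-1 *: rep M g.
  by apply/matrixP => i j; rewrite !mxE mevalZ.
have P0 : rep P 0 = 1%:M by rewrite PE lE scalerA mulVf // scale1r.
have P_det g : \det (rep P g) != 0.
  by rewrite PE detZ mulf_neq0 // expf_neq0 // invr_eq0.
have actE g (L : proj K n.+2) (x : 'rV[K]_n.+2) : val L = <[x]>%VS ->
    val (aact X g L) = <[x *m rep P g]>%VS.
  by move=> Lx; rewrite (ME g L x Lx) PE -scalemxAr vline_scale // invr_eq0.
have PD g h : rep P (g + h) = rep P h *m rep P g.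
  pose B := rep_curve P h *m rep_curve P g.
  (* If P(t (g + h)) = c B(t), then multiplying by the adjugate gives c det B(t) times the identity,
     so [u] expresses c det B as a polynomial in t. *)
  pose u := (rep_curve P (g + h) *m \adj B) 0 0.
  have BE t : map_mx (horner_eval t) B = rep P (t *: h) *m rep P (t *: g).
    by rewrite map_mxM !rep_curveE.
  have bE t : (\det B).[t] = \det (rep P (t *: h) *m rep P (t *: g)).
    by rewrite -BE det_map_mx.
  have b0 t : (\det B).[t] != 0 by rewrite bE det_mulmx mulf_neq0.
  have cE t : exists c, rep P (t *: (g + h)) = c *: (rep P (t *: h) *m rep P (t *: g)).
    apply: proportional_mx => [|x x0]; first by rewrite det_mulmx mulf_neq0.
    rewrite -(actE _ (line x0)) // scalerDr aactD mulmxA.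
    by rewrite (actE _ _ _ (actE _ (line x0) x erefl)).
  have uE t : exists2 c, rep P (t *: (g + h)) = c *: (rep P (t *: h) *m rep P (t *: g))
      & u.[t] = c * (\det B).[t].
    have [c cP] := cE t; exists c => //.
    have -> : u.[t] = map_mx (horner_eval t) (rep_curve P (g + h) *m \adj B) 0 0.
      by rewrite mxE.
    rewrite map_mxM map_mx_adj rep_curveE BE cP -scalemxAl mul_mx_adj bE.
    by rewrite !mxE eqxx mulr1n.
  have u0 t : u.[t] != 0.
    have [c cP ->] := uE t; rewrite mulf_neq0 //; apply: contraNneq (P_det (t *: (g + h))) => c0.
    by rewrite cP c0 detZ expr0n mul0r.
  have [c0 c0P u0E] := uE 0; have [c1 c1P u1E] := uE 1.
  move: c0P c1P; rewrite !scale0r !scale1r P0 mulmx1.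
  move/matrixP/(_ 0 0); rewrite !mxE eqxx mulr1 => c01.
  have := nonvanishing_const u0 1; rewrite u0E u1E (nonvanishing_const b0 1) -c01.
  by move=> /(mulIf (b0 0)) ->; rewrite scale1r.
exists P; split=> // [g h|g h gh]; first by rewrite addrC PD.
apply/eqP; rewrite -subr_eq0; apply/eqP/(@aact_effective _ _ _ X) => L.
have [x _ Lx] := proj_vec L; apply: val_inj.
rewrite (actE _ _ _ Lx) addrC PD gh -PD addNr P0 mulmx1.
by rewrite Lx.
Qed.

(** * Representations of the vector group *)

Section RepresentationExponential.

Variables (K : closedFieldType) (n N' : nat).
Hypothesis charK0 : [pchar K] =i pred0.
Local Notation N := N'.+1.
Variable P : 'M[{mpoly K[n]}]_N.
Hypotheses (P0 : rep P 0 = 1%:M)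
  (PD : forall g h, rep P (g + h) = rep P g *m rep P h).
Implicit Types (g h : 'rV[K]_n) (A B : 'M[K]_N).

Definition differential g : 'M[K]_N := \sum_i g 0 i *: partial0 P i.

Lemma differential_is_linear : linear differential.
Proof.
move=> a g h; rewrite /differential scaler_sumr -big_split; apply: eq_bigr => i _.
by rewrite !mxE scalerDl scalerA.
Qed.

HB.instance Definition _ := GRing.isLinear.Build K 'rV[K]_n 'M[K]_N _
  differential differential_is_linear.

Let Q g i j : {poly K} := rep_curve P g i j.

Let QE g i j t : (Q g i j).[t] = rep P (t *: g) i j.
Proof. by rewrite -rep_curveE mxE. Qed.

Let poly_eq (p q : {poly K}) : (forall t, p.[t] = q.[t]) -> p = q.
Proof.
move=> pq; apply/eqP; rewrite -subr_eq0; apply/eqP/poly_nonzero_point => t.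
by rewrite !hornerE pq subrr.
Qed.

Lemma meval0E (p : {mpoly K[n]}) : p.@[fun=> 0] = p@_0%MM.
Proof.
rewrite {1}(mpolyE p) raddf_sum /=.
have [m0|nm0] := boolP (0%MM \in msupp p).
  rewrite (bigD1_seq 0%MM) ?msupp_uniq //= big1 ?addr0 => [|m m0'].
    by rewrite mevalZ mevalX big1 ?mulr1 // => i _; rewrite mnm0E.
  rewrite mevalZ mevalX; have [i mi] : exists i, m i != 0%N.
    apply/existsP; apply: contraNT m0'; rewrite negb_exists => /forallP h.
    by apply/eqP/mnmP => i; rewrite mnm0E; apply/eqP; have := h i; rewrite negbK.
  by rewrite (bigD1 i) //= expr0n (negbTE mi) mul0r mulr0.
rewrite (memN_msupp_eq0 nm0) big_seq big1 // => m sm.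
rewrite mevalZ mevalX; have [i mi] : exists i, m i != 0%N.
  apply/existsP; apply: contraNT nm0; rewrite negb_exists => /forallP h.
  suff -> : 0%MM = m by [].
  by apply/mnmP => i; rewrite mnm0E; apply/esym/eqP; have := h i; rewrite negbK.
by rewrite (bigD1 i) //= expr0n (negbTE mi) mul0r mulr0.
Qed.

Lemma rep_curve_coef1 g i j : (rep_curve P g i j)`_1 = differential g i j.
Proof.
rewrite summxE mxE; pose p := P i j; rewrite -/p.
rewrite [RHS](eq_bigr (fun l => g 0 l * p@_U_(l))) => [|l _]; last first.
  by rewrite !mxE -/p meval0E mcoeff_deriv add0m mnm0E.
under [RHS]eq_bigr => l _ do rewrite {1}(mpolyE p) raddf_sum big_distrr /=.
rewrite exchange_big /mmap coef_sum; apply: eq_bigr => m _ /=.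
rewrite coefCM; under [RHS]eq_bigr => l _ do rewrite mcoeffZ mulrCA mcoeffX.
rewrite -mulr_sumr; congr (_ * _).
have -> : mmap1 (fun l => g 0 l *: 'X) m = (\prod_l g 0 l ^+ m l) *: 'X^(mdeg m).
  rewrite /mmap1 (eq_bigr (fun l => (g 0 l)%:P ^+ m l * (polyX K) ^+ m l)); last by move=> l _; rewrite -exprMn mul_polyC.
  by rewrite big_split /= mdegE prodrXr -mul_polyC rmorph_prod; congr (_ * _);
     apply: eq_bigr => l _; rewrite rmorphXn.
rewrite coefZ coefXn eq_sym; have [|nm] := boolP (mdeg m == 1%N).
  rewrite mdeg_eq1 mulr1 => /existsP[l /eqP->].
  rewrite (bigD1 l) //= mnm1E eqxx expr1 big1 => [|k nk]; last first.
    by rewrite mnm1E eq_sym (negbTE nk).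
  rewrite (bigD1 l) //= eqxx big1 ?addr0 // => k nk.
  by rewrite eq_mnm1 eq_sym (negbTE nk) mulr0.
rewrite mulr0 big1 // => l _; case: eqP => [e|_]; last by rewrite mulr0.
by rewrite e mdeg1 in nm.
Qed.

Definition rep_coef g k : 'M[K]_N := map_mx (fun q : {poly K} => q`_k) (rep_curve P g).

Lemma rep_coef0 g : rep_coef g 0 = 1.
Proof.
apply/matrixP => i j; rewrite mxE -horner_coef0 -[LHS]/((Q g i j).[0]).
by rewrite QE scale0r P0.
Qed.

(* Differentiate P((s + t) g) = P(s g) P(t g) at t = 0. *)
Lemma rep_coefS g k : rep_coef g k *m differential g = rep_coef g k.+1 *+ k.+1.
Proof.
have main i j : (Q g i j)^`() = \sum_l (Q g l j)`_1 *: Q g i l.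
  apply: poly_eq => s.
  have shift : Q g i j \Po ('X + s%:P) = \sum_l (Q g i l).[s] *: Q g l j.
    apply: poly_eq => t; rewrite horner_comp !hornerE QE scalerDl addrC PD mxE.
    rewrite horner_sum; apply: eq_bigr => l _; by rewrite hornerZ !QE.
  have := congr1 (fun q : {poly K} => (q^`()).[0]) shift.
  rewrite deriv_comp derivD derivX derivC addr0 mulr1 horner_comp !hornerE => ->.
  rewrite raddf_sum !horner_sum; apply: eq_bigr => l _ /=.
  by rewrite derivZ !hornerZ horner_coef0 coef_deriv mulrC mulr1n.
apply/matrixP => i j; rewrite mxE mulmxnE mxE -coef_deriv -[LHS]/(\sum_l _).
rewrite -[rep_curve P g i j]/(Q g i j) main coef_sum; apply: eq_bigr => l _.
by rewrite coefZ mxE -rep_curve_coef1 mulrC.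
Qed.

Lemma rep_coefE g k : rep_coef g k = (k`!%:R : K)^-1 *: differential g ^+ k.
Proof.
elim: k => [|k IH]; first by rewrite rep_coef0 fact0 invr1 scale1r expr0.
have := rep_coefS g k; rewrite IH -scalemxAl => /esym e.
apply: (@scalerI _ _ (k.+1)%:R); rewrite ?unitfE ?(pcharf0P K).1 //.
rewrite scaler_nat e scalerA factS natrM invfM mulVKf ?(pcharf0P K).1 //.
by rewrite exprSr.
Qed.

(** Up to the factor k!, the powers of [differential g] are the coefficients of P(t g), whose
    entries are polynomials in t. *)
Lemma rep_nilp g : exists M, forall k, (M <= k)%N -> differential g ^+ k = 0.
Proof.
exists (\max_(p : 'I_N * 'I_N) size (Q g p.1 p.2))%N => k le_k.
have : rep_coef g k = 0.
  apply/matrixP => i j; rewrite mxE [RHS]mxE nth_default //.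
  apply: leq_trans le_k.
  exact: (@leq_bigmax _ (fun p : 'I_N * 'I_N => size (Q g p.1 p.2)) (i, j)).
rewrite rep_coefE => /eqP; rewrite scaler_eq0 invr_eq0 (pcharf0P K).1 //.
by rewrite -leqn0 leqNgt fact_gt0 => /eqP.
Qed.

Lemma rep_exp g M : (forall k, (M <= k)%N -> differential g ^+ k = 0) ->
  rep P g = \sum_(k < M) (k`!%:R : K)^-1 *: differential g ^+ k.
Proof.
move=> MP; apply/matrixP => i j; rewrite -[g in LHS]scale1r -QE summxE.
have szQ : (size (Q g i j) <= M)%N.
  apply/leq_sizeP => k le_k.
  by have /matrixP/(_ i j) := rep_coefE g k; rewrite MP // scaler0 mxE [RHS]mxE.
rewrite (horner_coef_wide _ szQ); apply: eq_bigr => k _.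
have /matrixP/(_ i j) <- := rep_coefE g k; rewrite mxE expr1n mulr1 //.
Qed.

Lemma rep_commute_differential g B :
  (forall t, rep P (t *: g) *m B = B *m rep P (t *: g)) ->
  differential g *m B = B *m differential g.
Proof.
move=> comm; apply/matrixP => i j; rewrite !mxE.
have e : \sum_l B l j *: Q g i l = \sum_l B i l *: Q g l j.
  apply: poly_eq => t; have /matrixP/(_ i j) := comm t; rewrite !mxE !horner_sum => e.
  transitivity (\sum_l rep P (t *: g) i l * B l j).
    by apply: eq_bigr => l _; rewrite hornerZ QE mulrC.
  by rewrite e; apply: eq_bigr => l _; rewrite hornerZ QE.
have := congr1 (fun q : {poly K} => q`_1) e; rewrite !coef_sum => e1.
transitivity (\sum_l (B l j *: Q g i l)`_1).
  by apply: eq_bigr => l _; rewrite coefZ mulrC rep_curve_coef1.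
by rewrite e1; apply: eq_bigr => l _; rewrite coefZ rep_curve_coef1.
Qed.

Lemma differential_comm g h : differential g *m differential h =
  differential h *m differential g.
Proof.
apply: rep_commute_differential => t; apply/esym.
by apply: rep_commute_differential => s; rewrite -!PD addrC.
Qed.

Hypothesis P_inj : injective (rep P).

Lemma differential_inj : injective differential.
Proof.
move=> g h gh; apply/eqP; rewrite -subr_eq0; apply/eqP/P_inj.
have D0 : differential (g - h) = 0 by rewrite linearB /= gh subrr.
rewrite P0 (@rep_exp _ 1) => [|k k1]; last by rewrite D0 expr0n -leqn0 leqNgt k1.
by rewrite big_ord1 fact0 invr1 scale1r expr0.
Qed.

Lemma lie_imageP A : A \in lie_image P <-> exists g, A = differential g.
Proof.
split=> [|[g ->]]; last first.
  apply: rpred_sum => i _; apply: rpredZ; apply: memv_span.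
  by apply: map_f; rewrite mem_enum.
have /subvP sub : (lie_image P <= limg (linfun differential))%VS.
  apply/span_subvP => _ /mapP[i _ ->]; apply/memv_imgP.
  exists (delta_mx 0 i); rewrite ?memvf // lfunE /= /differential.
  rewrite (bigD1 i) //= mxE !eqxx scale1r big1 ?addr0 // => j nj.
  by rewrite mxE (negbTE nj) andbF scale0r.
by case/sub/memv_imgP => g _ ->; exists g; rewrite lfunE.
Qed.

End RepresentationExponential.

Lemma nilpotent_max (K : closedFieldType) (R : local_algebra K) (a : R) k :
  a ^+ k = 0 -> a \in la_max R.
Proof.
move=> ak; apply/negPn/negP => /notin_max_inv [b ab].
have : (a * b) ^+ k = 0 by rewrite exprMn ak mul0r.
by rewrite ab expr1n => /eqP; rewrite oner_eq0.
Qed.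

(** * Homogeneous polynomials and their zero loci *)

Section HomogeneousPolynomials.

Variables (K : closedFieldType) (N : nat).
Implicit Types f h : {mpoly K[N]}.

Lemma homog_root0 d f : (0 < d)%N -> f \is d.-homog -> f.@[(0 : 'rV[K]_N) 0] = 0.
Proof.
move=> d0 fd; transitivity (0 ^+ d * f.@[(0 : 'rV[K]_N) 0]); last first.
  by rewrite expr0n -leqn0 leqNgt d0 mul0r.
by rewrite -(homog_scale _ _ fd); apply: meval_eq => i; rewrite mul0r mxE.
Qed.

Lemma vanishes_atP d f (L : proj K N) (x : 'rV[K]_N) : f \is d.-homog ->
  val L = <[x]>%VS -> (vanishes_at f L <-> f.@[x 0] = 0).
Proof.
move=> fd Lx; split=> [|fx y]; first by apply; rewrite Lx memv_line.
rewrite Lx => /vlineP[c ->]; transitivity (c ^+ d * f.@[x 0]); last by rewrite fx mulr0.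
by rewrite -(homog_scale _ _ fd); apply: meval_eq => i; rewrite mxE.
Qed.

Lemma irreducible_mpoly_prime f : irreducible_mpoly f -> prime_elt f.
Proof.
by apply: irreducible_prime; apply: factorial_mpoly; apply: factorial_field.
Qed.

Lemma row_nullstellensatz f h : prime_elt f ->
  (forall x : 'rV[K]_N, f.@[x 0] = 0 -> h.@[x 0] = 0) -> dvdr f h.
Proof.
move=> fP fh; apply: prime_nullstellensatz => // v.
have e : (\row_j v j) 0 =1 v by move=> i; rewrite mxE.
by rewrite -(meval_eq f e) -(meval_eq h e); apply: fh.
Qed.

Lemma homog_dvdr_le d d' f h : f != 0 -> h != 0 -> f \is d.-homog ->
  h \is d'.-homog -> dvdr f h -> (d <= d')%N.
Proof.
move=> f0 h0 fd hd [q def_h].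
have [k qk] := homogeneous_factor h0 hd def_h.
have := dhomogM qk fd; rewrite -def_h => /(dhomog_uniq h0 hd) ->.
exact: leq_addl.
Qed.

Lemma homog_proportional d f h : prime_elt f -> f \is d.-homog ->
  h \is d.-homog -> (forall x : 'rV[K]_N, f.@[x 0] = 0 -> h.@[x 0] = 0) ->
  exists c, h = c *: f.
Proof.
move=> fP fd hd /(row_nullstellensatz fP)[q def_h].
have [h0|h0] := eqVneq h 0; first by exists 0; rewrite scale0r.
have [k qk] := homogeneous_factor h0 hd def_h.
have := dhomogM qk fd; rewrite -def_h => /(dhomog_uniq h0 hd).
rewrite -[X in X = _]add0n => /addIn k0; rewrite -{k}k0 in qk.
have q0 : q != 0 by apply: contraNneq h0 => q0; rewrite def_h q0 mul0r.
have /andP[/eqP def_q _] := homog0_unit q0 qk.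
by exists q@_0%MM; rewrite def_h {1}def_q mul_mpolyC.
Qed.

Definition linear_mpoly (c : 'I_N -> K) : {mpoly K[N]} := \sum_j c j *: 'X_j.

Lemma linear_mpoly_homog c : linear_mpoly c \is 1.-homog.
Proof. by apply: rpred_sum => j _; apply: dhomogZ; rewrite dhomogX /= mdeg1. Qed.

Lemma linear_mpolyE c (x : 'I_N -> K) : (linear_mpoly c).@[x] = \sum_j c j * x j.
Proof. by rewrite raddf_sum; apply: eq_bigr => j _ /=; rewrite mevalZ mevalXU. Qed.

Lemma linear_mpoly_prime c : linear_mpoly c != 0 -> prime_elt (linear_mpoly c).
Proof.
move=> c0; apply: irreducible_mpoly_prime; split=> // [|g h gh].
  apply/negP => /unit_homog0 /(dhomog_uniq c0 (linear_mpoly_homog c)).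
  by [].
apply: NNPP => /not_or_and[/negP gU /negP hU].
have [d1 [d2 [/andP[d10 d20] d12 _ _]]] :=
  homog_factors c0 (linear_mpoly_homog c) gh gU hU.
by move: d10 d20 d12; case: d1 d2 => [|d1] [|d2] //; rewrite addnS.
Qed.

End HomogeneousPolynomials.

Lemma functional_mpoly (K : closedFieldType) (R : lmodType K) N
    (psi : {linear R -> 'rV[K]_N}) (l : {linear R -> K^o}) : bijective psi ->
  exists c, forall r, (linear_mpoly c).@[psi r 0] = l r.
Proof.
case=> psi' psiK psi'K; exists (fun j => l (psi' (delta_mx 0 j)) : K) => r.
have rE : r = \sum_j psi r 0 j *: psi' (delta_mx 0 j).
  apply: (can_inj psiK); rewrite linear_sum [LHS]row_sum_delta.
  by apply: eq_bigr => j _; rewrite linearZ /= psi'K.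
rewrite linear_mpolyE [in RHS]rE linear_sum; apply: eq_bigr => j _.
by rewrite linearZ mulrC.
Qed.

Section Substitution.

Variables (K : closedFieldType) (N M : nat).

Definition mpoly_mx (f : {mpoly K[N]}) (A : 'M[K]_(M, N)) : {mpoly K[M]} :=
  f \mPo [tuple linear_mpoly (fun j => A j i) | i < N].

Lemma mpoly_mxE f A (x : 'rV[K]_M) : (mpoly_mx f A).@[x 0] = f.@[(x *m A) 0].
Proof.
rewrite /mpoly_mx comp_mpoly_meval; apply: meval_eq => i.
rewrite tnth_mktuple linear_mpolyE mxE; apply: eq_bigr => j _; exact: mulrC.
Qed.

Lemma mpoly_mx_homog d f A : f \is d.-homog -> mpoly_mx f A \is d.-homog.
Proof.
move=> /dhomogP fd; rewrite /mpoly_mx comp_mpolyE big_seq; apply: rpred_sum => m sm.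
apply: dhomogZ; have <- := fd m sm; rewrite /= mdegE.
elim/big_rec2: _ => [|i k p _ pk]; first exact: dhomog1.
apply: dhomogM => //; rewrite tnth_mktuple.
by have := dhomogMn (m i) (linear_mpoly_homog (fun j => A j i)); rewrite mul1n.
Qed.

End Substitution.

(* P(g) multiplies f by a character of G_a^n, and such characters are trivial. *)
Lemma rep_invariant (K : closedFieldType) n N d (P : 'M[{mpoly K[n]}]_N)
    (f : {mpoly K[N]}) : prime_elt f -> f \is d.-homog ->
  rep P 0 = 1%:M -> (forall g h, rep P (g + h) = rep P g *m rep P h) ->
  (forall g (x : 'rV[K]_N), f.@[x 0] = 0 -> f.@[(x *m rep P g) 0] = 0) ->
  forall g (x : 'rV[K]_N), f.@[(x *m rep P g) 0] = f.@[x 0].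
Proof.
move=> fP fd P0 PD fg g; have f0 : f != 0 by case: fP.
have cP t : exists c, mpoly_mx f (rep P (t *: g)) = c *: f.
  apply: (homog_proportional fP fd (mpoly_mx_homog _ fd)) => x fx.
  by rewrite mpoly_mxE; apply: fg.
have [x0 fx0] : exists x : 'rV[K]_N, f.@[x 0] != 0.
  apply: NNPP => nex; case/negP: f0; apply/eqP/mpoly_row_inj => x; rewrite meval0.
  by apply/eqP/negPn/negP => fx; apply: nex; exists x.
have [q qE] := meval_poly_curve f
  (fun j => (map_mx polyC x0 *m rep_curve P g) 0 j).
have {}qE t : q.[t] = f.@[(x0 *m rep P (t *: g)) 0].
  rewrite qE; apply: meval_eq => j.
  have e : map_mx (horner_eval t) (map_mx polyC x0) = x0.
    by apply/rowP => i; rewrite !mxE /horner_eval hornerC.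
  by rewrite -rep_curveE -[x0 in RHS]e -map_mxM [RHS]mxE.
have c_neq0 t c : mpoly_mx f (rep P (t *: g)) = c *: f -> c != 0.
  move=> cE; apply: contraNneq fx0 => c0.
  have := mpoly_mxE f (rep P (t *: g)) (x0 *m rep P (- (t *: g))).
  by rewrite cE c0 scale0r meval0 -mulmxA -PD addNr P0 mulmx1 => <-.
have q0 t : q.[t] != 0.
  have [c cE] := cP t; rewrite qE -mpoly_mxE cE mevalZ.
  by rewrite mulf_neq0 // (c_neq0 t).
have := nonvanishing_const q0 1; rewrite !qE scale0r scale1r P0 mulmx1.
have [c] := cP 1; rewrite scale1r => cE; rewrite -mpoly_mxE cE mevalZ.
rewrite -[RHS]mul1r => /(mulIf fx0) c1 x.
by rewrite -mpoly_mxE cE c1 scale1r.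
Qed.

(** * From actions to pairs *)

Section RepStructure.

Variables (K : closedFieldType) (n d : nat).
Hypotheses (charK0 : [pchar K] =i pred0) (d_gt0 : (0 < d)%N).
Variables (X : additive_action K n d) (P : 'M[{mpoly K[n]}]_n.+2).
Variables (v0 : 'rV[K]_n.+2) (f : {mpoly K[n.+2]}) (R : local_algebra K).
Variables (Phi : {lrmorphism R -> 'M[K]_n.+2}).
Hypotheses (P0 : rep P 0 = 1%:M)
  (PD : forall g h, rep P (g + h) = rep P g *m rep P h)
  (P_inj : injective (rep P))
  (actE : forall g (L : proj K n.+2) (x : 'rV[K]_n.+2), val L = <[x]>%VS ->
     val (aact X g L) = <[x *m rep P g]>%VS)
  (v0_cyclic : forall x, exists2 A, A \in agenv (lie_image P) & x = v0 *m A)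
  (Phi_inj : injective Phi)
  (PhiP : forall A, A \in agenv (lie_image P) <-> exists r, A = Phi r)
  (fX : defining_equation d f (hsurf X)).

Let psi : {linear R -> 'rV[K]_n.+2} := mulmx v0 \o Phi.

Let psiE r : psi r = v0 *m Phi r. Proof. by []. Qed.

(** Cyclicity gives surjectivity. If [u] kills [v0], then by commutativity it kills every v0 r,
    hence the whole space, and [u = 0] since [Phi] is injective. *)
Lemma cyclic_bij : bijective psi.
Proof.
have psi_surj x : exists r, psi r = x.
  have [A /PhiP[r ->] ->] := v0_cyclic x; by exists r.
have psi_inj : injective psi.
  move=> r s /eqP; rewrite -subr_eq0 -linearB => /eqP; set u := r - s => u0.
  suff /eqP : u = 0 by rewrite subr_eq0 => /eqP.
  apply: Phi_inj; rewrite linear0; apply/row_matrixP => i; rewrite !rowE mulmx0.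
  have [t <-] := psi_surj (delta_mx 0 i).
  rewrite psiE -mulmxA -[Phi t *m _]/(Phi t * Phi u) -rmorphM mulrC rmorphM.
  by rewrite /= -[_ * _]/(_ *m _) mulmxA -psiE u0 mul0mx.
pose psi' := (linfun psi)^-1%VF.
have psiK : cancel psi psi'.
  move=> r; have /lker0_lfunK/(_ r) : lker (linfun psi) == 0%VS.
    by apply/lker0P => a b; rewrite !lfunE; apply: psi_inj.
  by rewrite lfunE.
exists psi' => // x; have [r <-] := psi_surj x.
by rewrite psiK.
Qed.

Lemma cyclic_dim : \dim {:R} = n.+2.
Proof.
have [psi' psiK psi'K] := cyclic_bij.
have ker0 : lker (linfun psi) == 0%VS.
  by apply/lker0P => a b; rewrite !lfunE; apply: (can_inj psiK).
rewrite -(limg_dim_eq (f := linfun psi)); last by rewrite (eqP ker0) capv0.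
suff -> : limg (linfun psi) = fullv by rewrite dimvf dim_matrix [LHS]mul1n.
apply/eqP; rewrite eqEsubv subvf; apply/subvP => x _; apply/memv_imgP.
by exists (psi' x); rewrite ?memvf // lfunE; apply/esym/psi'K.
Qed.

Let iota : {linear 'rV[K]_n -> R} := (linfun Phi)^-1%VF \o differential P.

Let PhiI g : Phi (iota g) = differential P g.
Proof.
have /PhiP[r def_g] : differential P g \in agenv (lie_image P).
  by apply: (subvP (sub_agenv _)); apply/lie_imageP; exists g.
rewrite /iota /= -[LHS](lfunE Phi) limg_lfunVK //.
by apply/memv_imgP; exists r; rewrite ?memvf // lfunE.
Qed.

Let iota_inj : injective iota.
Proof.
move=> g h gh; apply: (differential_inj charK0 P0 PD P_inj).
by rewrite -!PhiI gh.
Qed.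

Let W : {vspace R} := limg (linfun iota).

Let WP a : a \in W <-> exists g, a = iota g.
Proof.
split=> [/memv_imgP[g _ ->]|[g ->]]; first by exists g; rewrite lfunE.
by apply/memv_imgP; exists g; rewrite ?memvf // lfunE.
Qed.

Let W_max : (W <= la_max R)%VS.
Proof.
apply/subvP => a /WP[g ->]; have [M MP] := rep_nilp charK0 P0 PD g.
apply: (@nilpotent_max _ _ _ M); apply: Phi_inj.
by rewrite rmorphXn /= PhiI linear0 MP.
Qed.

Lemma rep_nexp g : rep P g = Phi (nexp (iota g)).
Proof.
have [M MP] := rep_nilp charK0 P0 PD g.
have am : iota g \in la_max R by apply: (subvP W_max); apply/WP; exists g.
rewrite (nexp_widen am (leq_addr M _)) linear_sum.
rewrite (rep_exp charK0 P0 PD (M := \dim {:R} + M)) => [|k le_k].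
  by apply: eq_bigr => k _; rewrite linearZ rmorphXn /= PhiI.
by apply: MP; apply: leq_trans le_k; apply: leq_addl.
Qed.

Let W_generating : generating_hyperplane W.
Proof.
split=> //.
  have -> : \dim W = n; last by apply: succn_inj; rewrite dim_max_ideal cyclic_dim.
  rewrite limg_dim_eq ?dimvf ?dim_matrix ?[LHS]mul1n //.
  suff /eqP-> : lker (linfun iota) == 0%VS by rewrite capv0.
  by apply/lker0P => g h; rewrite !lfunE; apply: iota_inj.
apply/eqP; rewrite eqEsubv subvf; apply/subvP => r _.
have /subvP sub : (agenv (lie_image P) <= linfun Phi @: agenv W)%VS.
  apply: agenv_sub_modl.
    rewrite -memvE; apply/memv_imgP; exists 1; last by rewrite lfunE rmorph1.
    by apply: (subvP (sub1_agenv _)); apply: memv_line.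
  apply/prodvP => _ _ /lie_imageP[g ->] /memv_imgP[s sW ->].
  apply/memv_imgP; exists (iota g * s); last by rewrite !lfunE rmorphM /= PhiI.
  rewrite -agenvM; apply: memv_mul => //; apply: (subvP (sub_agenv _)).
  by apply/WP; exists g.
have /sub/memv_imgP[s sW] : Phi r \in agenv (lie_image P) by apply/PhiP; exists r.
by rewrite lfunE => /Phi_inj ->.
Qed.

Lemma rep_f_invariant g (x : 'rV[K]_n.+2) : f.@[(x *m rep P g) 0] = f.@[x 0].
Proof.
have [fd fI fH] := fX; have fP := irreducible_mpoly_prime fI.
apply: (rep_invariant fP fd P0 PD) => {x}g x fx.
have [->|x0] := eqVneq x 0; first by rewrite mul0mx (homog_root0 d_gt0 fd).
have HL : hsurf X (line x0).
  by apply/fH/(vanishes_atP fd (x := x)).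
have Lg := actE g (erefl : val (line x0) = <[x]>%VS).
by apply/(vanishes_atP fd Lg)/fH; apply: aact_invariant.
Qed.

(** Stated for any symmetric form representing the equation, so that it serves both for a given pair
    and for the construction of one. Invariance under exp(W) comes from that of the equation under
    the group, and is then differentiated. *)
Lemma rep_structure (F : {ffun 'I_d -> R} -> K) :
    symmetric_multilinear F -> f.@[v0 0] = 0 ->
    (forall r, F (diag d r) = f.@[(v0 *m Phi r) 0]) ->
  exists (W : {vspace R}) (iota : {linear 'rV[K]_n -> R})
         (psi : {linear R -> 'rV[K]_n.+2}),
    [/\ [/\ F (diag d 1) = 0, generating_hyperplane W
          & forall a b, a \in W -> infinitesimal F a b = 0],
        injective iota /\ (forall a, a \in W <-> exists g, a = iota g),
        bijective psi /\ (forall r, psi r = v0 *m Phi r),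
        forall g (L : proj K n.+2) r, val L = <[psi r]>%VS ->
          val (aact X g L) = <[psi (nexp (iota g) * r)%R]>%VS
      & forall (L : proj K n.+2) r, val L = <[psi r]>%VS ->
          (hsurf X L <-> F (diag d r) = 0)].
Proof.
move=> Fml fv0 FE; exists W, iota, psi; split.
- split=> // [|a b aW]; first by rewrite FE rmorph1 mulmx1.
  apply: (nexp_infinitesimal0 charK0 Fml); first exact: (subvP W_max).
  move=> t r; have /WP[g ->] := aW; rewrite !FE.
  have -> : t *: iota g = iota (t *: g) by rewrite linearZ.
  by rewrite mulrC rmorphM /= -rep_nexp -[_ * _]/(_ *m _) mulmxA rep_f_invariant.
- by split; [exact: iota_inj | exact: WP].
- by split=> //; apply: cyclic_bij.
- move=> g L r /actE->; rewrite !psiE mulrC rmorphM rep_nexp /=.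
  by rewrite -[Phi r * _]/(_ *m _) mulmxA.
move=> L r Lr; have [fd _ fH] := fX.
by rewrite fH FE (vanishes_atP fd Lr).
Qed.

End RepStructure.

(** This reduces both round trips of the correspondence to the relation [action_of_pair] alone. *)
Lemma action_of_pair_of_action (K : closedFieldType)
    (charK0 : [pchar K] =i pred0) n d (X : additive_action K n d)
    (p : form_pair K n d) : (0 < d)%N ->
  pair_of_action X p -> action_of_pair p X.
Proof.
move=> d0 [P [v0 [f [Phi [[P0 PD P_inj actE] cyc [Phi_inj PhiP] [fX fv0] FE]]]]].
have [[W0 [_ [Fml Fm _ _]]] _] := fp_irr p.
have [W [iota [psi [[F1 Wgen WF] ioP [psi_bij _] aE hE]]]] :=
  rep_structure charK0 d0 P0 PD P_inj actE cyc Phi_inj PhiP fX Fml fv0 FE.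
by exists W, iota, psi; split.
Qed.

(** * A commutative algebra generated by nilpotents is local *)

Section NilpotentlyGenerated.

Variables (K : fieldType) (R : falgType K) (U : {vspace R}).
Hypotheses (R_comm : commutative (fun x y : R => x * y))
  (U_gen : agenv U = fullv)
  (U_nilp : forall a, a \in U -> exists k, a ^+ k = 0).

Let nilp (a : R) := exists k, a ^+ k = 0.

Let nilpD a b : nilp a -> nilp b -> nilp (a + b).
Proof.
case=> k ak [l bl]; exists (k + l)%N; rewrite exprDn_comm; last exact: R_comm.
rewrite big1 // => i _; have [le_i|lt_i] := leqP l i.
  by rewrite -(subnK le_i) [b ^+ _]exprD bl mulr0 mulr0 mul0rn.
have le_k : (k <= k + l - i)%N by lia.
by rewrite -(subnK le_k) [a ^+ _]exprD ak mulr0 mul0r mul0rn.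
Qed.

Let nilpM a b : nilp a -> nilp (a * b).
Proof.
by case=> k ak; exists k; rewrite exprMn_comm ?ak ?mul0r //; apply: R_comm.
Qed.

Definition nil_ideal : {vspace R} := (U * fullv)%VS.

Lemma nil_ideal_nilp a : a \in nil_ideal -> nilp a.
Proof.
rewrite /nil_ideal unlock.
have span_nilp (s : seq R) : (forall b, b \in s -> nilp b) -> a \in <<s>>%VS -> nilp a.
  move=> sN; rewrite -[s]/(tval (in_tuple s)) => /coord_span ->.
  elim/big_ind: _ => [|x y|i _]; [by exists 1%N; rewrite expr1 | exact: nilpD |].
  by rewrite -mulr_algl R_comm; apply/nilpM/sN/mem_nth.
apply: span_nilp => b /allpairsP[[u v] /= [uU _ ->]].
by apply/nilpM/U_nilp/vbasis_mem.
Qed.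

Let nil_idealP : is_ideal nil_ideal.
Proof.
move=> a x xI; rewrite R_comm /nil_ideal.
have /subvP : (nil_ideal * fullv <= U * fullv)%VS.
  by rewrite -prodvA prodvSr // subvf.
by apply; apply: memv_mul; rewrite // memvf.
Qed.

Let one_notin : 1 \notin nil_ideal.
Proof.
by apply/negP => /nil_ideal_nilp[k /eqP]; rewrite expr1n oner_eq0.
Qed.

Let decomposition r : exists c nu, nu \in nil_ideal /\ r = c%:A + nu.
Proof.
have : r \in agenv U by rewrite U_gen memvf.
rewrite agenvEl U_gen => /memv_addP[x /vlineP[c ->] [nu nuI ->]].
by exists c, nu.
Qed.

(** An element outside the nil ideal is a nonzero scalar plus a nilpotent, hence a unit. *)
Let ideal_full (J : {vspace R}) : is_ideal J -> ~~ (J <= nil_ideal)%VS -> J = fullv.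
Proof.
move=> JI /subvPn[r rJ rI]; have [c [nu [nuI def_r]]] := decomposition r.
have c0 : c != 0.
  by apply: contraNneq rI => c0; rewrite def_r c0 scale0r add0r.
have [k nuk] := nil_ideal_nilp nuI.
have nuk' : (- nu) ^+ k = 0 by rewrite exprNn nuk mulr0.
(* The geometric sum for which s (c + nu) = c^k - (-nu)^k = c^k. *)
pose s := \sum_(i < k) (c%:A) ^+ (k.-1 - i) * (- nu) ^+ i.
have sr : s * r = (c ^+ k)%:A.
  rewrite R_comm def_r -{1}(opprK nu) -subrXX_comm; last exact: R_comm.
  by rewrite nuk' subr0 exprZn expr1n.
have J1 : 1 \in J.
  have ck0 : c ^+ k != 0 by rewrite expf_neq0.
  by rewrite -[1](scalerK ck0) -sr memvZ // JI.
by apply/eqP; rewrite eqEsubv subvf; apply/subvP => x _; rewrite -[x]mulr1 JI.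
Qed.

Lemma nil_ideal_maximal : maximal_ideal nil_ideal.
Proof.
split=> // [|J JI IJ].
  by apply: contraNneq one_notin => ->; rewrite memvf.
have [le_J|/ideal_full ->] := boolP (J <= nil_ideal)%VS; [left | by right | by []].
by apply/eqP; rewrite eqEsubv le_J.
Qed.

Lemma nil_ideal_unique J : maximal_ideal J -> J = nil_ideal.
Proof.
case=> JI JP Jmax; have [le_J|/ideal_full Jf] := boolP (J <= nil_ideal)%VS.
  have [<- //|If] := Jmax _ nil_idealP le_J.
  by case/negP: one_notin; rewrite If memvf.
by case/eqP: JP; apply: Jf.
Qed.

Definition nil_local_algebra : local_algebra K :=
  LocalAlgebra R_comm nil_ideal_maximal nil_ideal_unique.

End NilpotentlyGenerated.

(** * Construction of the pair of an action *)

Section PairOfAction.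

Variables (K : closedFieldType) (n d : nat).
Hypotheses (charK0 : [pchar K] =i pred0) (d_ge2 : (2 <= d)%N).
Variables (X : additive_action K n d) (P : 'M[{mpoly K[n]}]_n.+2).
Variables (f : {mpoly K[n.+2]}).
Hypotheses (P0 : rep P 0 = 1%:M)
  (PD : forall g h, rep P (g + h) = rep P g *m rep P h)
  (actE : forall g (L : proj K n.+2) (x : 'rV[K]_n.+2), val L = <[x]>%VS ->
     val (aact X g L) = <[x *m rep P g]>%VS)
  (fX : defining_equation d f (hsurf X)).

Let lie_agenv g : differential P g \in agenv (lie_image P).
Proof. by apply: (subvP (sub_agenv _)); apply/lie_imageP; exists g. Qed.

Lemma rep_in_agenv g : rep P g \in agenv (lie_image P).
Proof.
have [M MP] := rep_nilp charK0 P0 PD g; rewrite (rep_exp charK0 P0 PD MP).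
apply: rpred_sum => k _; apply: rpredZ; elim: (val k) => [|j IH].
  by rewrite expr0; apply: (subvP (sub1_agenv _)); apply: memv_line.
by rewrite exprS -agenvM memv_mul.
Qed.

(* The orbit is dense in the hypersurface, so a hyperplane containing it      *)
(* would contain the hypersurface, which has degree at least 2.               *)
Lemma orbit_cyclic (L0 : proj K n.+2) v0 (Z : proj K n.+2 -> Prop) :
  val L0 = <[v0]>%VS -> hsurf X L0 -> zariski_closed Z ->
  (forall L, (exists g, L = aact X g L0) <-> hsurf X L /\ ~ Z L) ->
  forall x, exists2 A, A \in agenv (lie_image P) & x = v0 *m A.
Proof.
move=> Lv0 HL0 [S [Shom ZS]] orbit.
have [fd fI fH] := fX; have fP := irreducible_mpoly_prime fI.
have f0 : f != 0 by case: fP.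
pose V := (linfun (mulmx v0) @: agenv (lie_image P))%VS.
suff VT : V = fullv.
  move=> x; have : x \in V by rewrite VT memvf.
  by case/memv_imgP => A AL ->; exists A; rewrite ?lfunE.
apply/eqP/negPn/negP => VT.
have [u uV] : exists u, u \notin V.
  by move: VT; rewrite eqEsubv subvf => /subvPn[u _ uV]; exists u.
have [l [lV lu]] := separating_functional uV.
pose ell := linear_mpoly (fun j => l (delta_mx 0 j) : K).
have lE (x : 'rV[K]_n.+2) : ell.@[x 0] = l x.
  rewrite linear_mpolyE [in RHS](row_sum_delta x) linear_sum.
  by apply: eq_bigr => j _; rewrite linearZ mulrC.
have ell0 : ell != 0.
  by apply: contraNneq (oner_neq0 K) => e0; rewrite -lu -lE e0 meval0.
(* An equation of the boundary of the orbit that does not vanish at the base point. Then [ell * z]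
   vanishes on the whole hypersurface: [ell] on the orbit and [z] off it. *)
have [z [zS zL0]] : exists z, S z /\ ~ vanishes_at z L0.
  apply: NNPP => nex; have [_ []] := (orbit L0).1 (ex_intro _ 0 (esym (aact0 X L0))).
  by apply/ZS => z zS; apply: NNPP => nz; apply: nex; exists z.
have [e ze] := Shom z zS.
have : dvdr f (ell * z).
  apply: (row_nullstellensatz fP) => x fx; rewrite mevalM lE.
  have [->|x0] := eqVneq x 0; first by rewrite linear0 mul0r.
  have HL : hsurf X (line x0) by apply/fH/(vanishes_atP fd (x := x)).
  have [ZL|nZL] := classic (Z (line x0)).
    have /(vanishes_atP ze (erefl : val (line x0) = <[x]>%VS)) -> := (ZS _).1 ZL z zS.
    by rewrite mulr0.
  have [g Lg] := (orbit (line x0)).2 (conj HL nZL).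
  rewrite lV ?mul0r //; have : x \in val (line x0) by apply: memv_line.
  rewrite Lg (actE g Lv0) => /vlineP[c ->]; apply: memvZ.
  by apply/memv_imgP; exists (rep P g); rewrite ?lfunE ?rep_in_agenv.
case/(prime_dvdrM fP) => [fl|[q def_z]].
  have := homog_dvdr_le f0 ell0 fd (linear_mpoly_homog _) fl.
  by rewrite leqNgt d_ge2.
case: zL0; apply/(vanishes_atP ze Lv0).
have /fH/(vanishes_atP fd Lv0) fv0 := HL0.
by rewrite def_z mevalM fv0 mulr0.
Qed.

Hypothesis P_inj : injective (rep P).

Let A := agenv_aspace (lie_image P).

Let A1 : algid A = 1.
Proof.
by apply/eqP; rewrite algid_eq1; apply: (subvP (sub1_agenv _)); apply: memv_line.
Qed.

Let A_comm : commutative (fun x y : subvs_of A => x * y).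
Proof.
move=> x y; apply: val_inj; rewrite /=.
have WC : (lie_image P <= 'C(lie_image P))%VS.
  apply/centvsP => _ _ /lie_imageP[g ->] /lie_imageP[h ->].
  exact: (differential_comm PD).
have AC : (agenv (lie_image P) <= 'C(agenv (lie_image P)))%VS.
  have agC (V Y : {vspace 'M[K]_n.+2}) : (V <= 'C(Y) -> agenv V <= 'C(Y))%VS.
    move=> VC; apply: agenv_sub_modl; first by rewrite -memvE centv1.
    by apply: subv_trans (asubv 'C(Y)%AS); apply: prodvSl.
  by apply: (agC); rewrite centvC; apply: agC.
by have /centvsP := AC; apply; apply: subvsP.
Qed.

Lemma vsval_lrmorphism : exists Phi : {lrmorphism subvs_of A -> 'M[K]_n.+2},
  forall x, Phi x = vsval x.
Proof.
pose v (x : subvs_of A) : 'M[K]_n.+2 := vsval x.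
have v_lin : linear v by move=> a x y; rewrite /v linearP.
have v_mon : monoid_morphism v by split=> [|x y] //=; rewrite /v -A1.
pose v_linM := GRing.isLinear.Build K (subvs_of A) 'M[K]_n.+2 _ v v_lin.
pose v_monM := GRing.isMonoidMorphism.Build (subvs_of A) 'M[K]_n.+2 v v_mon.
pose F : {lrmorphism subvs_of A -> 'M[K]_n.+2} := HB.pack v v_linM v_monM.
by exists F.
Qed.

Let incl : {linear subvs_of A -> 'M[K]_n.+2} := @vsval _ _ A.
Let W : {vspace subvs_of A} := (linfun incl @^-1: lie_image P)%VS.

Let WE x : (x \in W) = (vsval x \in lie_image P).
Proof. by rewrite -memv_preim lfunE. Qed.

Let W_gen : agenv W = fullv.
Proof.
have /subvP sub : (agenv (lie_image P) <= linfun incl @: agenv W)%VS.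
  apply: agenv_sub_modl.
    rewrite -memvE; apply/memv_imgP; exists 1; last by rewrite lfunE /= A1.
    by apply: (subvP (sub1_agenv _)); apply: memv_line.
  apply/prodvP => a b aL /memv_imgP[s sW ->].
  have aA : a \in A by apply: (subvP (sub_agenv _)).
  apply/memv_imgP; exists (Subvs aA * s); last by rewrite !lfunE.
  rewrite -agenvM; apply: memv_mul => //; apply: (subvP (sub_agenv _)).
  by rewrite WE.
apply/eqP; rewrite eqEsubv subvf; apply/subvP => r _.
have /sub/memv_imgP[s sW] := subvsP r.
by rewrite lfunE => /val_inj ->.
Qed.

Let W_nilp a : a \in W -> exists k, a ^+ k = 0.
Proof.
rewrite WE => /lie_imageP[g ag]; have [M MP] := rep_nilp charK0 P0 PD g.
have [Phi PhiE] := vsval_lrmorphism.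
by exists M; apply: val_inj; rewrite /= -PhiE rmorphXn /= PhiE ag MP.
Qed.

Let R : local_algebra K := nil_local_algebra A_comm W_gen W_nilp.

Lemma pair_of_rep (v0 : 'rV[K]_n.+2) : f.@[v0 0] = 0 ->
  (forall x, exists2 B, B \in agenv (lie_image P) & x = v0 *m B) ->
  exists p : form_pair K n d, pair_of_action X p.
Proof.
move=> fv0 cyc; have [fd fI fH] := fX; have fP := irreducible_mpoly_prime fI.
have f0 : f != 0 by case: fP.
have d0 : (0 < d)%N by apply: leq_trans d_ge2.
have [Phi PhiE] := vsval_lrmorphism.
pose PhiR : {lrmorphism R -> 'M[K]_n.+2} := Phi.
have PhiP B : B \in agenv (lie_image P) <-> exists r : R, B = PhiR r.
  split=> [BA|[r ->]]; last by rewrite [PhiR r]PhiE; apply: subvsP.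
  by exists (Subvs (BA : B \in A)); rewrite [PhiR _]PhiE.
have Phi_inj : injective PhiR.
  by move=> r s; rewrite [PhiR r]PhiE [PhiR s]PhiE; apply: val_inj.
pose psi : {linear R -> 'rV[K]_n.+2} := mulmx v0 \o PhiR.
have psi_bij := cyclic_bij cyc Phi_inj PhiP.
have [F [Fml FE]] := form_of_mpoly charK0 psi fd.
have [W0 [iota [psi0 [[F1 Wgen WF] _ _ _ _]]]] :=
  rep_structure charK0 d0 P0 PD P_inj actE cyc Phi_inj PhiP fX Fml fv0 FE.
have dimR := cyclic_dim cyc Phi_inj PhiP.
have [psi' psiK psi'K] := psi_bij.
(* If [F] vanished on m, the linear equation of m would divide the irreducible [f], whose degree is
   at least 2. *)
have F_max : exists b : {ffun 'I_d -> R}, (forall i, b i \in la_max R) /\ F b != 0.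
  have [ell [ell1 _ ell0]] := exists_residue R.
  have [c lE] := functional_mpoly ell psi_bij; set l := linear_mpoly c in lE.
  have l0 : l != 0.
    by apply: contraNneq (oner_neq0 K) => l0; apply/eqP; rewrite -[LHS]ell1 -lE l0 meval0.
  have lP := linear_mpoly_prime l0.
  apply: NNPP => nex; have : dvdr l f.
    apply: (row_nullstellensatz lP) => x; rewrite -(psi'K x) lE => /eqP.
    rewrite ell0 => xm; rewrite -[LHS]FE; apply/eqP/negPn/negP => nF.
    by apply: nex; exists (diag d (psi' x)); split=> // i; rewrite ffunE.
  case=> q def_f; have [_ _ fq] := fI; case: (fq _ _ def_f) => [|lU].
    have ld : l \is 1.-homog by apply: linear_mpoly_homog.
    move/unit_homog0 => q0; have := dhomogM q0 ld; rewrite -def_f.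
    by move/(dhomog_uniq f0 fd) => d1; move: d_ge2; rewrite d1.
  by case: lP => _ /negP[].
have F_irr : irreducible_form F.
  split; first by exists W0; split=> //; split.
  case=> d1 [d2 [W1 [F1' [F2' [/andP[d10 d20] [F1ml _ _ _] [F2ml _ _ _] [dE FF]]]]]].
  have [f1 [f1d f1E]] := mpoly_of_form F1ml psi_bij.
  have [f2 [f2d f2E]] := mpoly_of_form F2ml psi_bij.
  have def_f : f = f1 * f2.
    apply: mpoly_row_inj => x; rewrite -(psi'K x) mevalM f1E f2E -FF.
    by rewrite -[LHS]FE.
  have /andP[f10 f20] : (f1 != 0) && (f2 != 0) by rewrite -negb_or -mulf_eq0 -def_f.
  have [_ _ /(_ _ _ def_f)] := fI; case=> /unit_homog0.
    by move/(dhomog_uniq f10 f1d) => d1E; rewrite d1E in d10.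
  by move/(dhomog_uniq f20 f2d) => d2E; rewrite d2E in d20.
exists (FormPair dimR F_irr), P, v0, f, PhiR; split=> //.
Qed.

End PairOfAction.

Lemma exists_pair_of_action (K : closedFieldType)
    (charK0 : [pchar K] =i pred0) n d (X : additive_action K n d) : (2 <= d)%N ->
  exists p : form_pair K n d, pair_of_action X p.
Proof.
move=> d_ge2; have [P [P0 PD P_inj actE]] := rep_of_action charK0 X.
have [f fX] := hsurfP X; have [fd _ fH] := fX.
have [L0 [HL0 [Z [Zc orbit]]]] := aact_open_orbit X.
have [v0 _ Lv0] := proj_vec L0.
apply: (pair_of_rep charK0 d_ge2 P0 PD actE fX P_inj (v0 := v0)).
  by apply/(vanishes_atP fd Lv0)/fH.
exact: (orbit_cyclic charK0 d_ge2 P0 PD actE fX Lv0 HL0 Zc orbit).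
Qed.

(** * From pairs to actions *)

Lemma row_mx_inj (K : fieldType) M N (A B : 'M[K]_(M, N)) :
  (forall x : 'rV[K]_M, x *m A = x *m B) -> A = B.
Proof. by move=> AB; apply/row_matrixP => i; rewrite !rowE. Qed.

Section ProjectiveMatrix.

Variables (K : closedFieldType) (n : nat).
Implicit Types (A : 'M[K]_n.+2) (L : proj K n.+2) (x : 'rV[K]_n.+2).

(** When [A] kills the line, [insubd] returns the default [L]; the matrices used below are
    invertible. *)
Definition proj_mx A L : proj K n.+2 := insubd L (linfun (mulmxr A) @: val L)%VS.

Lemma proj_mxE A L x : val L = <[x]>%VS -> x *m A != 0 ->
  val (proj_mx A L) = <[x *m A]>%VS.
Proof.
move=> Lx xA; have e : (linfun (mulmxr A) @: val L)%VS = <[x *m A]>%VS.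
  by rewrite Lx limg_line lfunE.
by rewrite val_insubd e dim_vline xA.
Qed.

Lemma bieval_rep k (P : 'M[{mpoly K[k]}]_n.+2) i (g : 'rV[K]_k) x :
  bieval (\sum_j P j i *: 'X_j) g x = (x *m rep P g) 0 i.
Proof.
pose ev (h : 'rV[K]_k) : {rmorphism {mpoly K[k]} -> K} := meval (h 0).
rewrite -[LHS]/(eval_at ev _ g x) /eval_at.
rewrite (rmorph_sum (map_mpoly (ev g))) rmorph_sum mxE.
apply: eq_bigr => j _ /=.
by rewrite map_mpolyZ map_mpolyX mevalZ mevalXU mxE mulrC.
Qed.

Lemma morphism_rep k (P : 'M[{mpoly K[k]}]_n.+2) :
  (forall g, \det (rep P g) != 0) ->
  morphism_AP (fun (g : 'rV[K]_k) L => proj_mx (rep P g) L).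
Proof.
move=> P0 g0 L0; exists 1%N, 0%N, (fun i => \sum_j P j i *: 'X_j), 1; split.
- by move=> i; apply: rpred_sum => j _; apply: dhomogZ; rewrite dhomogX /= mdeg1.
- exact: dhomog1.
- by move=> x _; rewrite /bieval rmorph1 meval1 oner_neq0.
move=> g L x Lx _; rewrite (proj_mxE Lx).
  by congr <[_]>%VS; apply/rowP => i; rewrite [RHS]mxE bieval_rep.
apply: contraNneq (P0 g) => xP; apply/det0P; exists x => //.
exact: proj_vec_neq0 Lx.
Qed.

End ProjectiveMatrix.

(** The truncated exponential is polynomial in coordinates, so after substitution of the linear map
    [iota] the matrix of multiplication by exp(iota g) has polynomial entries in [g]. *)
Lemma multiplication_rep (K : closedFieldType) (R : local_algebra K) n N
    (psi : {linear R -> 'rV[K]_N}) psi' (iota : {linear 'rV[K]_n -> R}) :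
  cancel psi psi' -> cancel psi' psi ->
  exists P : 'M[{mpoly K[n]}]_N, forall g x,
    x *m rep P g = psi (nexp (iota g) * psi' x).
Proof.
move=> psiK psi'K.
have pP i : exists p : 'I_N -> {mpoly K[N]}, forall r j,
    psi (nexp r * psi' (delta_mx 0 i)) 0 j = (p j).@[psi r 0].
  apply: (polynomial_endoM psiK psi'K).
    exact: (polynomial_endo_nexp psiK psi'K (polynomial_endo_id psi)).
  exact: polynomial_endo_const.
have [p pE] := fin_all_exists pP.
exists (\matrix_(i, j) (p i j \mPo
  [tuple linear_mpoly (fun l => psi (iota (delta_mx 0 l)) 0 k) | k < N])) => g x.
apply/rowP => j; rewrite mxE.
have {2}-> : x = \sum_i x 0 i *: psi (psi' (delta_mx 0 i)).
  by rewrite [LHS]row_sum_delta; apply: eq_bigr => i _; rewrite psi'K.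
have -> : psi' (\sum_i x 0 i *: psi (psi' (delta_mx 0 i))) =
    \sum_i x 0 i *: psi' (delta_mx 0 i).
  apply: (can_inj psiK); rewrite psi'K linear_sum; apply: eq_bigr => i _.
  by rewrite linearZ.
rewrite big_distrr linear_sum summxE; apply: eq_bigr => i _ /=.
rewrite -scalerAr linearZ [RHS]mxE; congr (_ * _); rewrite pE !mxE comp_mpoly_meval.
apply: meval_eq => k; rewrite tnth_mktuple linear_mpolyE.
rewrite [in RHS](row_sum_delta g) !linear_sum summxE; apply: eq_bigr => l _.
by rewrite !linearZ mxE mulrC.
Qed.

Section ActionOfPair.

Variables (K : closedFieldType) (n d : nat).
Hypotheses (charK0 : [pchar K] =i pred0) (d_ge2 : (2 <= d)%N).
Variables (R : local_algebra K) (F : {ffun 'I_d -> R} -> K) (W : {vspace R}).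
Variables (iota : {linear 'rV[K]_n -> R}).
Variables (psi : {linear R -> 'rV[K]_n.+2}) (psi' : 'rV[K]_n.+2 -> R).
Variables (f : {mpoly K[n.+2]}) (P : 'M[{mpoly K[n]}]_n.+2).
Hypotheses (F_irr : irreducible_form F) (WF : invariant_wrt W F)
  (iota_inj : injective iota) (iotaW : forall a, a \in W <-> exists g, a = iota g)
  (psiK : cancel psi psi') (psi'K : cancel psi' psi)
  (fd : f \is d.-homog) (fF : forall r, f.@[psi r 0] = F (diag d r))
  (PE : forall g x, x *m rep P g = psi (nexp (iota g) * psi' x)).

Let psi_bij : bijective psi. Proof. by exists psi'. Qed.

Let d_gt0 : (0 < d)%N. Proof. exact: leq_trans d_ge2. Qed.

Let fI : irreducible_mpoly f.
Proof. exact: (irreducible_form_mpoly charK0 psi_bij fd fF d_gt0 F_irr). Qed.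

Let iota_max g : iota g \in la_max R.
Proof.
have [_ [_ _ [Wm _ _] _]] := WF; apply: (subvP Wm).
by apply/iotaW; exists g.
Qed.

Lemma mult_rep0 : rep P 0 = 1%:M.
Proof.
by apply: row_mx_inj => x; rewrite PE linear0 nexp0 mul1r psi'K mulmx1.
Qed.

Lemma mult_repD g h : rep P (g + h) = rep P g *m rep P h.
Proof.
apply: row_mx_inj => x; rewrite mulmxA !PE psiK mulrA; congr (psi (_ * _)).
by rewrite linearD addrC nexpD.
Qed.

Lemma mult_rep_det g : \det (rep P g) != 0.
Proof.
apply/det0P => -[x x0 xP]; case/eqP: x0.
by rewrite -[x]mulmx1 -mult_rep0 -(subrr g) mult_repD mulmxA xP mul0mx.
Qed.

Lemma mult_rep_act g (L : proj K n.+2) r : val L = <[psi r]>%VS ->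
  val (proj_mx (rep P g) L) = <[psi (nexp (iota g) * r)%R]>%VS.
Proof.
move=> Lr; have := proj_mxE Lr (A := rep P g); rewrite PE psiK; apply.
apply: contraNneq (mult_rep_det g) => e; apply/det0P; exists (psi r).
  exact: proj_vec_neq0 Lr.
by rewrite PE psiK.
Qed.

Lemma form_invariant g r : F (diag d (nexp (iota g) * r)) = F (diag d r).
Proof.
have [_ [Fml _ _ Fa]] := WF; apply: infinitesimal0_nexp => // b.
by apply: Fa; apply/iotaW; exists g.
Qed.

Lemma form_zero_locus (L : proj K n.+2) r : val L = <[psi r]>%VS ->
  (vanishes_at f L <-> F (diag d r) = 0).
Proof. by move=> Lr; rewrite -fF; apply: (vanishes_atP fd Lr). Qed.

Let vec (L : proj K n.+2) : exists r, val L = <[psi r]>%VS.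
Proof. by have [x _ Lx] := proj_vec L; exists (psi' x); rewrite psi'K. Qed.

Lemma exists_mult_action : exists X : additive_action K n d,
  (forall g L, aact X g L = proj_mx (rep P g) L) /\
  (forall L, hsurf X L <-> vanishes_at f L).
Proof.
have [F1 WF'] := WF.
have actD g h (L : proj K n.+2) :
    proj_mx (rep P (g + h)) L = proj_mx (rep P g) (proj_mx (rep P h) L).
  have [r Lr] := vec L; apply: val_inj.
  rewrite (mult_rep_act _ Lr) (mult_rep_act _ (mult_rep_act _ Lr)) mulrA.
  by rewrite linearD nexpD.
have act0 (L : proj K n.+2) : proj_mx (rep P 0) L = L.
  have [r Lr] := vec L; apply: val_inj.
  by rewrite (mult_rep_act _ Lr) linear0 nexp0 mul1r Lr.
have psi1 : psi 1 != 0 by rewrite -(linear0 psi) (inj_eq (can_inj psiK)) oner_neq0.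
have [ell [ell1 _ ell0]] := exists_residue R.
have ellM a r : a \in la_max R -> ell (nexp a * r) = ell r.
  move=> am; apply/eqP; rewrite -subr_eq0 -linearB -{2}[r]mul1r -mulrBl ell0.
  by rewrite max_ideal_mulr // nexp_sub1.
(* Fixing the line of 1 means exp(iota g) = c; exponentials of elements of m have residue 1, so c =
   1 and iota g = 0. *)
have act_eff g : (forall L : proj K n.+2, proj_mx (rep P g) L = L) -> g = 0.
  move=> /(_ (line psi1))/(congr1 val).
  rewrite (mult_rep_act _ (erefl : val (line psi1) = _)) mulr1 /= => e.
  have /vlineP[c] : psi (nexp (iota g)) \in <[psi 1%R]>%VS by rewrite -e memv_line.
  rewrite -linearZ => /(can_inj psiK) gc.
  have c1 : c = 1.
    have := ellM _ 1 (iota_max g); rewrite mulr1 gc linearZ /= ell1.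
    by rewrite /GRing.scale /= mulr1.
  apply: iota_inj; rewrite linear0; apply: nexp_inj1 => //.
  by rewrite gc c1 scale1r.
have act_inv g (L : proj K n.+2) :
    vanishes_at f L -> vanishes_at f (proj_mx (rep P g) L).
  have [r Lr] := vec L; move=> /(form_zero_locus Lr) Fr.
  by apply/(form_zero_locus (mult_rep_act _ Lr)); rewrite form_invariant.
have [c lE] := functional_mpoly ell psi_bij.
(* The open orbit is that of the line of 1, and its boundary is cut out by the residue form, whose
   zero set is the maximal ideal. *)
have act_orbit : exists L0, vanishes_at f L0 /\ exists Z, zariski_closed Z /\
    forall L, (exists g, L = proj_mx (rep P g) L0) <-> vanishes_at f L /\ ~ Z L.
  exists (line psi1); split.
    exact/(form_zero_locus (erefl : val (line psi1) = _)).
  exists (vanishes_at (linear_mpoly c)); split.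
    exists (fun q => q = linear_mpoly c); split=> [q ->|L].
      by exists 1%N; apply: linear_mpoly_homog.
    by split=> [h q -> //|]; apply.
  move=> L; split=> [[g ->]|[]].
    have Lg := mult_rep_act g (erefl : val (line psi1) = _).
    split.
      by apply: act_inv; apply/(form_zero_locus (erefl : val (line psi1) = _)).
    move/(vanishes_atP (linear_mpoly_homog c) Lg); rewrite lE ellM // ell1.
    by move/eqP; rewrite oner_eq0.
  have [r Lr] := vec L; move=> /(form_zero_locus Lr) Fr nZ.
  have rm : r \notin la_max R.
    apply/negP => rm; apply: nZ; apply/(vanishes_atP (linear_mpoly_homog c) Lr).
    by rewrite lE; apply/eqP; rewrite ell0.
  have [l [w [l0 /iotaW[g ->] def_r]]] := zero_exp_orbit charK0 psi_bij fd fF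
    (irreducible_mpoly_prime fI) WF Fr rm.
  exists g; apply: val_inj; rewrite (mult_rep_act _ (erefl : val (line psi1) = _)) Lr.
  by rewrite mulr1 def_r linearZ vline_scale.
have fH : hypersurface d (vanishes_at f) by exists f.
by exists (AdditiveAction fH (morphism_rep mult_rep_det) act0 actD act_eff
             act_inv act_orbit).
Qed.

End ActionOfPair.

Lemma exists_action_of_pair (K : closedFieldType)
    (charK0 : [pchar K] =i pred0) n d (p : form_pair K n d) : (2 <= d)%N ->
  exists X : additive_action K n d, action_of_pair p X.
Proof.
move=> d_ge2; have F_irr := fp_irr p; have [[W WF] _] := F_irr.
have [_ [Fml _ [_ dW _] _]] := WF.
have dimW : \dim W = n.
  by have := dim_max_ideal (fp_alg p); rewrite dW fp_dim => -[].
have [iota [iota_inj iotaW]] := exists_parametrization dimW.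
have [psi psi_bij] := exists_coordinates (fp_dim p).
have [psi' psiK psi'K] := psi_bij.
have [f [fd fF]] := mpoly_of_form Fml psi_bij.
have [P PE] := multiplication_rep iota psiK psi'K.
have [X [XP XH]] :=
  exists_mult_action charK0 d_ge2 F_irr WF iota_inj iotaW psiK psi'K fd fF PE.
exists X, W, iota, psi; split=> // [g L r Lr|L r Lr].
  by rewrite XP; apply: (mult_rep_act charK0 WF iotaW psiK psi'K PE g Lr).
by rewrite XH; apply: (form_zero_locus fd fF Lr).
Qed.

(** * Equivalences *)

Lemma linear_Ga_automorphism (K : closedFieldType) n
    (s : {linear 'rV[K]_n -> 'rV[K]_n}) :
  injective s -> Ga_automorphism s.
Proof.
move=> s_inj; pose A := lin1_mx s; have sE g : s g = g *m A by rewrite mul_rV_lin1.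
have linear_polynomial (B : 'M[K]_n) : polynomial_map (mulmxr B : 'rV[K]_n -> 'rV[K]_n).
  exists (fun i => linear_mpoly (fun j => B j i)) => g i.
  by rewrite /= linear_mpolyE mxE; apply: eq_bigr => j _; apply: mulrC.
have A_unit : A \in unitmx.
  rewrite -row_free_unit; apply: inj_row_free => g; rewrite -sE.
  by move=> sg; apply: s_inj; rewrite sg linear0.
split=> [g h||]; first exact: linearD.
  by have [p pE] := linear_polynomial A; exists p => g i; rewrite sE -pE.
exists (mulmxr (invmx A)); split=> // g /=; first by rewrite sE mulmxK.
by rewrite sE mulmxKV.
Qed.

Lemma proj_mx_automorphism (K : closedFieldType) n (M : 'M[K]_n.+2) :
  M \in unitmx -> proj_automorphism (proj_mx M).
Proof.
move=> M_unit; have morph (B : 'M[K]_n.+2) : B \in unitmx ->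
    morphism_AP (fun _ : 'rV[K]_0 => proj_mx B).
  move=> B_unit; pose P : 'M[{mpoly K[0]}]_n.+2 := map_mx (@mpolyC 0 K) B.
  have PE g : rep P g = B by apply/matrixP => i j; rewrite !mxE mevalC.
  have := @morphism_rep K n 0 P; rewrite /morphism_AP => h g0 L0.
  have [|e [e' [p [u [pe ue ux pP]]]]] := h _ g0 L0.
    by move=> g; rewrite PE -unitfE -unitmxE.
  by exists e, e', p, u; split=> // g L x Lx ugx; rewrite -(pP g L x Lx ugx) PE.
have nz (B : 'M[K]_n.+2) (x : 'rV[K]_n.+2) : B \in unitmx -> x != 0 -> x *m B != 0.
  by move=> BU; apply: contraNneq => xB; rewrite -(mulmxK BU x) xB mul0mx.
have invM : invmx M \in unitmx by rewrite unitmx_inv.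
exists (proj_mx (invmx M)); split; [| |exact: morph|exact: morph] => L;
  have [x x0 Lx] := proj_vec L; apply: val_inj.
  have LM := proj_mxE Lx (nz _ _ M_unit x0).
  by rewrite (proj_mxE LM) mulmxK.
have LM := proj_mxE Lx (nz _ _ invM x0).
by rewrite (proj_mxE LM) mulmxKV.
Qed.

Section AlgebraIsomorphism.

Variables (K : closedFieldType) (R R' : local_algebra K).
Variables (phi : {lrmorphism R -> R'}) (phi_bij : bijective phi).

Lemma lrmorphism_max a : a \in la_max R -> phi a \in la_max R'.
Proof.
move=> am; apply: (@nilpotent_max _ _ _ (\dim {:R})).
by rewrite -rmorphXn max_ideal_nilp // rmorph0.
Qed.

Lemma lrmorphism_nexp a : a \in la_max R -> phi (nexp a) = nexp (phi a).
Proof.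
move=> am; have am' := lrmorphism_max am.
rewrite (nexp_widen am (leq_addr (\dim {:R'}) _)).
rewrite (nexp_widen am' (leq_addl (\dim {:R}) _)).
by rewrite linear_sum; apply: eq_bigr => k _; rewrite linearZ rmorphXn.
Qed.

(** Combined with [invariant_hyperplane_unique], this shows that an isomorphism of pairs carries W
    onto W'. *)
Lemma lrmorphism_invariant d (F : {ffun 'I_d -> R} -> K)
    (F' : {ffun 'I_d -> R'} -> K) W W' c : invariant_wrt W F -> invariant_wrt W' F' -> \dim W = \dim W' ->
  (forall b : {ffun 'I_d -> R}, F' [ffun i => phi (b i)] = c * F b) ->
  invariant_wrt (linfun phi @: W) F'.
Proof.
move=> [_ [_ _ [Wm _ W_gen] WF]] [F'1 [F'ml F'm [_ dW' _] _]] dWW' FF'.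
have [phi' phiK phi'K] := phi_bij.
split=> //; split=> //.
  have phi_ker : lker (linfun phi) == 0%VS.
    by apply/lker0P => a b; rewrite !lfunE; apply: (can_inj phiK).
  split.
  - apply/subvP => _ /memv_imgP[a aW ->]; rewrite lfunE.
    by apply: lrmorphism_max; apply: (subvP Wm).
  - by rewrite limg_dim_eq ?dWW' // (eqP phi_ker) capv0.
  apply/eqP; rewrite eqEsubv subvf; apply/subvP => r _.
  have /subvP sub : (agenv W <= linfun phi @^-1: agenv (linfun phi @: W))%VS.
    apply: agenv_sub_modl.
      rewrite -memvE -memv_preim lfunE rmorph1.
      by apply: (subvP (sub1_agenv _)); apply: memv_line.
    apply/prodvP => a b aW; rewrite -!memv_preim !lfunE rmorphM => bW.
    rewrite -agenvM; apply: memv_mul => //; apply: (subvP (sub_agenv _)).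
    by apply/memv_imgP; exists a; rewrite ?lfunE.
  have := sub (phi' r); rewrite W_gen memvf -memv_preim lfunE => /(_ isT).
  by rewrite -{2}(phi'K r).
move=> _ b /memv_imgP[a aW ->]; rewrite lfunE.
pose b' := [ffun i => phi' (b i)] : {ffun 'I_d -> R}.
rewrite (eq_bigr (fun i => c * F (upd b' i (a * b' i)))) => [|i _].
  by rewrite -big_distrr /= WF // mulr0.
rewrite -FF'; congr F'; apply/ffunP => j; rewrite !ffunE.
by case: eqP => _; rewrite ?rmorphM /= ?ffunE phi'K.
Qed.

End AlgebraIsomorphism.

Lemma linear_inverse (K : fieldType) (U V : lmodType K) (f : {linear U -> V}) :
  bijective f -> exists g : {linear V -> U}, cancel f g /\ cancel g f.
Proof.
case=> g fK gK; have g_lin : linear g.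
  by move=> a x y; apply: (can_inj fK); rewrite linearP !gK.
pose gM := GRing.isLinear.Build K V U _ g g_lin.
by pose G : {linear V -> U} := HB.pack g gM; exists G.
Qed.

Lemma form_pair_dim (K : closedFieldType) n d (p : form_pair K n d) W :
  generating_hyperplane W -> \dim (W : {vspace fp_alg p}) = n.
Proof.
by case=> _ dW _; have := dim_max_ideal (fp_alg p); rewrite dW fp_dim => -[].
Qed.

(** An algebra isomorphism commutes with exponentials and maps W onto W'. Read in coordinates it is
    the projective automorphism, and its restriction to W is the reparametrization [s] of the
    group. *)
Lemma equivalent_actions_of_pairs (K : closedFieldType)
    (charK0 : [pchar K] =i pred0) n d (p p' : form_pair K n d)
    (X X' : additive_action K n d) :
  action_of_pair p X -> action_of_pair p' X' -> equivalent_pairs p p' ->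
  equivalent_actions X X'.
Proof.
move=> [W [iota [psi [WF [iota_inj iotaW] psi_bij aE hE]]]].
move=> [W' [iota' [psi' [WF' [iota'_inj iota'W] psi'_bij a'E h'E]]]].
move=> [phi [c [phi_bij c0 FF']]].
have [_ [F'ml _ W'_gen _]] := WF'; have [_ [_ _ W_gen _]] := WF.
have dW : \dim W = \dim W' by rewrite !form_pair_dim.
have [f' [f'd f'F]] := mpoly_of_form F'ml psi'_bij.
have phiW a : (phi a \in W') = (a \in W).
  have [phi' phiK phi'K] := phi_bij.
  have WF'' := lrmorphism_invariant phi_bij WF WF' dW FF'.
  rewrite (invariant_hyperplane_unique charK0 psi'_bij f'd f'F WF' WF'').
  apply/memv_imgP/idP => [[b bW]|aW]; last by exists a; rewrite ?lfunE.
  by rewrite lfunE => /(can_inj phiK) ->.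
have iota_max g : iota g \in la_max (fp_alg p).
  by have [Wm _ _] := W_gen; apply: (subvP Wm); apply/iotaW; exists g.
pose s : {linear 'rV[K]_n -> 'rV[K]_n} := (linfun iota')^-1%VF \o (phi \o iota).
have sE g : iota' (s g) = phi (iota g).
  have /iota'W[h hE'] : phi (iota g) \in W' by rewrite phiW; apply/iotaW; exists g.
  rewrite /s /= -[LHS](lfunE iota') limg_lfunVK //.
  by apply/memv_imgP; exists h; rewrite ?memvf // lfunE.
have s_inj : injective s.
  move=> g h gh; apply: iota_inj; apply: (bij_inj phi_bij).
  by rewrite -!sE gh.
have [psiV [psiK psiVK]] := linear_inverse psi_bij.
pose m : {linear 'rV[K]_n.+2 -> 'rV[K]_n.+2} := psi' \o (phi \o psiV).
pose M := lin1_mx m.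
have ME r : psi r *m M = psi' (phi r) by rewrite mul_rV_lin1 /m /= psiK.
have M_unit : M \in unitmx.
  rewrite -row_free_unit; apply: inj_row_free => x; rewrite mul_rV_lin1 => mx0.
  apply: (can_inj psiVK); apply: (bij_inj phi_bij); apply: (bij_inj psi'_bij).
  by rewrite -[LHS]/(m x) mx0 !linear0.
have phiE (L : proj K n.+2) r : val L = <[psi r]>%VS ->
    val (proj_mx M L) = <[psi' (phi r)]>%VS.
  move=> Lr; rewrite -ME; apply: proj_mxE => //.
  apply: contraNneq (proj_vec_neq0 Lr) => e.
  by rewrite -(mulmxK M_unit (psi r)) e mul0mx.
have vec (L : proj K n.+2) : exists r, val L = <[psi r]>%VS.
  by have [x _ Lx] := proj_vec L; exists (psiV x); rewrite psiVK.
exists (proj_mx M), s; split.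
- exact: proj_mx_automorphism.
- exact: linear_Ga_automorphism.
- move=> L; have [r Lr] := vec L; rewrite (hE L r Lr) (h'E _ _ (phiE L r Lr)).
  have -> : diag d (phi r) = [ffun i => phi (diag d r i)].
    by apply/ffunP => i; rewrite !ffunE.
  by rewrite FF'; split=> [->|/eqP]; rewrite ?mulr0 // mulf_eq0 (negbTE c0) => /eqP.
move=> g L; have [r Lr] := vec L; apply: val_inj.
rewrite (phiE _ _ (aE g L r Lr)) (a'E _ _ _ (phiE L r Lr)) sE.
by rewrite rmorphM /= lrmorphism_nexp.
Qed.

Lemma poly_natr_roots (K : closedFieldType) (charK0 : [pchar K] =i pred0)
    (q : {poly K}) :
  (forall k : nat, q.[k%:R] = 0) -> q = 0.
Proof.
move=> q0; apply/eqP/negPn/negP => nq.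
have := max_poly_roots nq (rs := [seq k%:R | k <- iota 0 (size q)]).
rewrite size_map size_iota ltnn.
suff -> : uniq [seq (k%:R : K) | k <- iota 0 (size q)].
  move=> /(_ _ isT) h; apply: notF; apply: h.
  by apply/allP => _ /mapP[k _ ->]; rewrite /root q0.
rewrite map_inj_uniq ?iota_uniq // => a b /eqP; rewrite (natr_inj charK0).
by move/eqP.
Qed.

(** * Transport of exponentials by a linear bijection *)

Section TransportedAction.

Variables (K : closedFieldType) (R R' : local_algebra K).
Hypothesis charK0 : [pchar K] =i pred0.
Variable T : {linear R -> R'}.
Hypothesis T_inj : injective T.

(** A comparison of eigenvalues: exp(a) - c is transported to c (exp(a') - 1), hence is nilpotent,
    while exp(a) - 1 is nilpotent as well; so 1 - c lies in m. *)
Lemma nexp_transport_scalar a a' c : a \in la_max R -> a' \in la_max R' ->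
  (forall r, T (nexp a * r) = c *: (nexp a' * T r)) -> c = 1.
Proof.
move=> am am' Tc; pose D := \dim {:R'}; pose e := nexp a - c%:A.
have step k : T (e ^+ k) = (c%:A * (nexp a' - 1)) ^+ k * T 1.
  elim: k => [|k IH]; first by rewrite !expr0 mul1r.
  have -> : e ^+ k.+1 = nexp a * e ^+ k - c *: e ^+ k.
    by rewrite exprS mulrBl mulr_algl.
  rewrite linearB linearZ /= Tc IH exprS mulr_algl -!scalerAl.
  by rewrite -scalerBr -mulrA mulrBl mul1r.
have eD : e ^+ D = 0.
  apply: T_inj; rewrite step exprMn [(nexp a' - 1) ^+ D]max_ideal_nilp ?nexp_sub1 //.
  by rewrite mulr0 mul0r linear0.
have em := nilpotent_max eD.
have : (1 - c)%:A \in la_max R.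
  have -> : (1 - c)%:A = e - (nexp a - 1) by rewrite scalerBl scale1r /e; ring.
  by rewrite rpredB ?nexp_sub1.
have [//|c1] := eqVneq c 1; have c10 : 1 - c != 0 by rewrite subr_eq0 eq_sym.
by move=> cm; case/negP: (one_notin_max R); rewrite -[1](scalerK c10) memvZ.
Qed.

(** Both sides of the hypothesis are polynomial in k, and in characteristic zero they agree as
    polynomials once they agree at all natural numbers; the conclusion compares the coefficients of
    k. Natural multiples occur because an additive reparametrization preserves them. *)
Lemma nexp_transport_derivative N (psi : {linear R' -> 'rV[K]_N}) a a' r :
    injective psi -> a \in la_max R -> a' \in la_max R' ->
    (forall k : nat, T (nexp (a *+ k) * r) = nexp (a' *+ k) * T r) ->
  T (a * r) = a' * T r.
Proof.
(* The two extra terms keep the linear coefficient within the truncation. *)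
move=> psi_inj am am' Tk; pose M := (\dim {:R} + \dim {:R'})%N.+2.
have expE (S : local_algebra K) (z : S) k : z \in la_max S -> (\dim {:S} <= M)%N ->
    nexp (z *+ k) = \sum_(j < M) ((j`!%:R : K)^-1 * k%:R ^+ j) *: z ^+ j.
  move=> zm le_M; rewrite (nexp_widen _ le_M) ?rpredMn //; apply: eq_bigr => j _.
  by rewrite -scaler_nat exprZn scalerA.
have [le_M le_M'] : (\dim {:R} <= M)%N /\ (\dim {:R'} <= M)%N by rewrite /M; lia.
apply: psi_inj; apply/rowP => i.
pose u j := (j`!%:R : K)^-1 * (psi (T (a ^+ j * r)) 0 i - psi (a' ^+ j * T r) 0 i).
pose q := \poly_(j < M) u j.
have : q`_1 = 0.
  rewrite (_ : q = 0) ?coef0 //; apply: (poly_natr_roots charK0) => k.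
  rewrite horner_poly; have /eqP := Tk k; rewrite -subr_eq0 => /eqP.
  rewrite !expE // => /(congr1 (fun z => psi z 0 i)).
  rewrite linear0 [RHS]mxE => e; rewrite -[RHS]e.
  rewrite !big_distrl raddfB /= !raddf_sum !mxE !summxE -big_split.
  apply: eq_bigr => j _; rewrite -!scalerAl /= !linearZ !mxE /u mulrN.
  by rewrite mulrAC mulrBr.
rewrite coef_poly /u factS fact0 invr1 mul1r !expr1 => /eqP.
by rewrite subr_eq0 => /eqP.
Qed.

End TransportedAction.

(* T intertwines multiplication by W with multiplication by sigma(W), so it   *)
(* maps R onto the ideal generated by T 1; hence T 1 is invertible, and the   *)
(* elements v with T (v * x) = T v / T 1 * T x form a W-stable subspace.      *)
Lemma lrmorphism_of_intertwiner (K : closedFieldType) (R R' : local_algebra K)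
    (W : {vspace R}) (T : {linear R -> R'}) :
    bijective T -> agenv W = fullv ->
    (forall w, w \in W -> exists w', forall r, T (w * r) = w' * T r) ->
  T 1 \notin la_max R' /\
  exists phi : {lrmorphism R -> R'}, bijective phi /\ forall r, T r = T 1 * phi r.
Proof.
move=> [T' TK T'K] W_gen TW.
have span (V : {vspace R}) : 1 \in V ->
    (forall w v, w \in W -> v \in V -> w * v \in V) -> forall r, r \in V.
  move=> V1 WV r; have /subvP : (agenv W <= V)%VS.
    by apply: agenv_sub_modl; rewrite -?memvE //; apply/prodvP.
  by apply; rewrite W_gen memvf.
have ideal r : exists x, T r = x * T 1.
  have : r \in (linfun T @^-1: limg (amulr (T 1%R)))%VS.
    apply: span => [|w v wW]; rewrite -!memv_preim !lfunE /=.
      by apply/memv_imgP; exists 1; rewrite ?memvf // lfunE /= mul1r.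
    have [w' ->] := TW w wW; case/memv_imgP => x _ ->.
    by apply/memv_imgP; exists (w' * x); rewrite ?memvf // !lfunE /= mulrA.
  by rewrite -memv_preim lfunE => /memv_imgP[x _]; rewrite lfunE; exists x.
have [b' bb'] : exists b', T 1 * b' = 1.
  by have [x] := ideal (T' 1); rewrite T'K => e; exists x; rewrite e mulrC.
split.
  by apply/negP => /(max_ideal_mulr b'); rewrite bb' (negbTE (one_notin_max R')).
have TM r x : T (r * x) = T r * b' * T x.
  have : r \in lker ((linfun T \o amulr x)%VF - (amulr (b' * T x)%R \o linfun T)%VF).
    apply: span => [|w v wW];
      rewrite !memv_ker !add_lfunE !opp_lfunE !comp_lfunE !lfunE /=.
      by rewrite mul1r mulrA bb' mul1r subrr.
    have [w' w'E] := TW w wW; rewrite -mulrA !w'E -mulrA -mulrBr => /eqP->.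
    by rewrite mulr0.
  rewrite memv_ker !add_lfunE !opp_lfunE !comp_lfunE !lfunE /= subr_eq0 => /eqP->.
  by rewrite mulrA.
pose h r := T r * b'.
have h_lin : linear h by move=> c x y; rewrite /h linearP mulrDl -scalerAl.
have h_mon : monoid_morphism h by split=> [|x y]; rewrite /h ?bb' // TM mulrA.
pose hL := GRing.isLinear.Build K R R' _ h h_lin.
pose hM := GRing.isMonoidMorphism.Build R R' h h_mon.
pose phi : {lrmorphism R -> R'} := HB.pack h hL hM.
exists phi; split=> [|r]; last by rewrite mulrC /= /h -mulrA [b' * _]mulrC bb' mulr1.
exists (fun x => T' (x * T 1)) => [r|x] /=; rewrite /h.
  by rewrite -mulrA [b' * _]mulrC bb' mulr1 TK.
by rewrite T'K -mulrA bb' mulr1.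
Qed.

Lemma nexp_mulK (K : closedFieldType) (charK0 : [pchar K] =i pred0)
    (R : local_algebra K) (a x : R) :
  a \in la_max R -> nexp (- a) * (nexp a * x) = x.
Proof.
by move=> am; rewrite mulrA [nexp (- a) * _]mulrC (nexp_unit charK0 am) mul1r.
Qed.

Lemma proj_automorphism_mx (K : closedFieldType) (charK0 : [pchar K] =i pred0) n
    (phi : proj K n.+2 -> proj K n.+2) : proj_automorphism phi ->
  exists2 M : 'M[K]_n.+2, M \in unitmx & forall (L : proj K n.+2) x,
    val L = <[x]>%VS -> val (phi L) = <[x *m M]>%VS.
Proof.
case=> psi [_ psiK phi_morph psi_morph].
have [P PE] := linearize charK0 (g0 := 0) phi_morph psi_morph psiK.
exists (rep P 0); last by move=> L x Lx; apply: PE.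
rewrite -row_free_unit; apply: inj_row_free => x xP; apply/eqP/negPn/negP => x0.
by have := proj_vec_neq0 (PE 0 (line x0) x erefl); rewrite xP eqxx.
Qed.

(** The pullback of the second equation is homogeneous of the same degree and vanishes on the zeros
    of the prime [f], so it is a multiple of [f]; the factor is nonzero because [T] is onto and [F']
    is not zero. *)
Lemma form_pullback_proportional (K : closedFieldType)
    (charK0 : [pchar K] =i pred0) d N (R R' : local_algebra K) (F : {ffun 'I_d -> R} -> K)
    (F' : {ffun 'I_d -> R'} -> K) (psi : {linear R -> 'rV[K]_N})
    (psi' : {linear R' -> 'rV[K]_N}) (T : {linear R -> R'}) f :
  bijective psi -> bijective psi' -> bijective T ->
  prime_elt f -> f \is d.-homog -> (forall r, f.@[psi r 0] = F (diag d r)) ->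
  symmetric_multilinear F' -> (exists b, F' b != 0) ->
  (forall r, F (diag d r) = 0 -> F' (diag d (T r)) = 0) ->
  exists2 c, c != 0 & forall r, F' (diag d (T r)) = c * F (diag d r).
Proof.
move=> psi_bij psi'_bij [T' TK T'K] fP fd fF F'ml [b F'b] FF'.
have [psiV [psiK psiVK]] := linear_inverse psi_bij.
have [f' [f'd f'F]] := mpoly_of_form F'ml psi'_bij.
pose m : {linear 'rV[K]_N -> 'rV[K]_N} := psi' \o (T \o psiV).
have hE r : (mpoly_mx f' (lin1_mx m)).@[psi r 0] = F' (diag d (T r)).
  by rewrite mpoly_mxE mul_rV_lin1 /m /= psiK f'F.
have [|c cE] := homog_proportional fP fd (mpoly_mx_homog (lin1_mx m) f'd).
  by move=> x; rewrite -(psiVK x) fF hE; apply: FF'.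
have FE r : F' (diag d (T r)) = c * F (diag d r) by rewrite -hE cE mevalZ fF.
exists c => //; apply: contraNneq F'b => c0; apply/eqP.
by apply: (polarization_diag charK0) => // r; rewrite -(T'K r) FE c0 mul0r.
Qed.

(** The projective automorphism is induced by a linear map [T], which intertwines exponentials
    exactly and hence multiplications by W. So T is T(1) times an algebra isomorphism. As T(1) is a
    scalar multiple of an element of exp(W'), it changes [F'] only by a scalar, and the isomorphism
    respects the forms up to a scalar. *)
Lemma equivalent_pairs_of_actions (K : closedFieldType)
    (charK0 : [pchar K] =i pred0) n d (p p' : form_pair K n d)
    (X X' : additive_action K n d) : (0 < d)%N ->
  action_of_pair p X -> action_of_pair p' X' -> equivalent_actions X X' ->
  equivalent_pairs p p'.
Proof.
move=> d_gt0 [W [iota [psi [WF [iota_inj iotaW] psi_bij aE hE]]]].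
move=> [W' [iota' [psi' [WF' [iota'_inj iota'W] psi'_bij a'E h'E]]]].
move=> [phi [s [phi_aut [sD _ _] phiH phi_act]]].
have [F1 [Fml _ [Wm _ W_gen] _]] := WF.
have [F'1 [F'ml [b0 [_ F'b0]] [W'm _ W'_gen] F'inf]] := WF'.
have [f [fd fF]] := mpoly_of_form Fml psi_bij.
have fP := irreducible_mpoly_prime
  (irreducible_form_mpoly charK0 psi_bij fd fF d_gt0 (fp_irr p)).
have [f' [f'd f'F]] := mpoly_of_form F'ml psi'_bij.
have f'P := irreducible_mpoly_prime
  (irreducible_form_mpoly charK0 psi'_bij f'd f'F d_gt0 (fp_irr p')).
have [M M_unit ME] := proj_automorphism_mx charK0 phi_aut.
have [psiV' [psi'K psiV'K]] := linear_inverse psi'_bij.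
have [psiV psiK psiVK] := psi_bij.
pose T : {linear fp_alg p -> fp_alg p'} := psiV' \o (mulmxr M \o psi).
have psiT r : psi' (T r) = psi r *m M by rewrite psiV'K.
have T_inj : injective T.
  move=> r r' e; apply: (can_inj psiK); rewrite -[LHS](mulmxK M_unit).
  by rewrite -psiT e psiT mulmxK.
have T_bij : bijective T.
  exists (fun r => psiV (psi' r *m invmx M)) => r.
    by rewrite psiT mulmxK // psiK.
  by apply: (can_inj psi'K); rewrite psiT psiVK mulmxKV.
have phiE (L : proj K n.+2) r : val L = <[psi r]>%VS -> val (phi L) = <[psi' (T r)]>%VS.
  by move=> Lr; rewrite psiT; apply: ME.
have psi_neq0 r : r != 0 -> psi r != 0.
  by apply: contraNneq => e; apply/eqP/(can_inj psiK); rewrite e linear0.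
have max g : iota g \in la_max (fp_alg p) by apply: (subvP Wm); apply/iotaW; exists g.
have max' g : iota' g \in la_max (fp_alg p').
  by apply: (subvP W'm); apply/iota'W; exists g.
have [|c c0 FT] := form_pullback_proportional charK0 psi_bij psi'_bij T_bij fP fd fF
  F'ml (ex_intro _ b0 F'b0).
  move=> r Fr; have [->|r0] := eqVneq r 0.
    by rewrite linear0 -f'F linear0 (homog_root0 d_gt0 f'd).
  have Lr : val (line (psi_neq0 r r0)) = <[psi r]>%VS by [].
  exact/(h'E _ _ (phiE _ _ Lr))/phiH/(hE _ _ Lr).
(* Projectively the two sides agree, so the linear maps [u] and [v] differ by one scalar, which is 1
   because both exponentials are unipotent. *)
have T_exp g r : T (nexp (iota g) * r) = nexp (iota' (s g)) * T r.
  pose u : {linear fp_alg p -> fp_alg p'} := T \o amull (nexp (iota g)).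
  pose v : {linear fp_alg p -> fp_alg p'} := amull (nexp (iota' (s g))) \o T.
  have uE x : u x = T (nexp (iota g) * x) by rewrite /u /= lfunE.
  have vE x : v x = nexp (iota' (s g)) * T x by rewrite /v /= lfunE.
  have [x y|x|l lE] := @proportional_linear _ _ _ u v.
  - rewrite !vE => xy; apply: T_inj.
    have := congr1 ( *%R (nexp (- iota' (s g)))) xy.
    by rewrite !(nexp_mulK charK0 _ (max' (s g))).
  - have [->|x0] := eqVneq x 0; first by exists 0; rewrite scale0r linear0.
    have Lx : val (line (psi_neq0 x x0)) = <[psi x]>%VS by [].
    have := congr1 val (phi_act g (line (psi_neq0 x x0))).
    rewrite (phiE _ _ (aE _ _ _ Lx)) (a'E _ _ _ (phiE _ _ Lx)) -uE -vE => e.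
    have : psi' (u x) \in <[psi' (v x)]>%VS by rewrite -e memv_line.
    by case/vlineP=> l; rewrite -linearZ => /(can_inj psi'K) ->; exists l.
  have l1 : l = 1.
    by apply: (nexp_transport_scalar T_inj (max g) (max' (s g))) => x; rewrite -uE -vE.
  by rewrite -uE lE l1 scale1r vE.
have T_W w : w \in W -> exists w', forall r, T (w * r) = w' * T r.
  case/iotaW=> g ->; exists (iota' (s g)) => r.
  apply: (nexp_transport_derivative charK0 (bij_inj psi'_bij)) => // k.
  have s0 : s 0 = 0 by apply: (addrI (s 0)); rewrite -sD !addr0.
  have sMn : s (g *+ k) = s g *+ k.
    by elim: k => [|k IH]; rewrite ?mulr0n // !mulrS sD IH.
  by rewrite -(raddfMn iota) -(raddfMn iota') -sMn; apply: T_exp.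
have [b_unit [h [h_bij Th]]] := lrmorphism_of_intertwiner T_bij W_gen T_W.
(* T(1) is a unit at which [F'] vanishes, since F(1) = 0. *)
have [|l [w' [l0 w'W def_b]]] :=
  zero_exp_orbit charK0 psi'_bij f'd f'F f'P WF' _ b_unit.
  by rewrite FT F1 mulr0.
have F'h r : fp_form p' (diag d (T r)) = l ^+ d * fp_form p' (diag d (h r)).
  rewrite Th def_b -scalerAl -(infinitesimal0_nexp charK0 F'ml (h r) (subvP W'm _ w'W)).
    rewrite -!f'F linearZ -(homog_scale _ _ f'd); apply: meval_eq => i.
    by rewrite mxE.
  by move=> b; apply: F'inf.
have ld0 : l ^+ d != 0 by rewrite expf_neq0.
exists h, (c / l ^+ d); split=> // [|b]; first by rewrite mulf_neq0 ?invr_eq0.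
(* The forms are so far compared on the diagonal only; polarizing their difference extends the
   equality to all arguments. *)
pose G (b : {ffun 'I_d -> fp_alg p}) : K :=
  fp_form p' [ffun i => h (b i)] - c / l ^+ d * fp_form p b.
suff : G b = 0 by move/eqP; rewrite subr_eq0 => /eqP.
apply: (polarization_diag charK0) => [|r].
  split=> [b1 i k x y|u b1]; rewrite /G.
    have hU z : [ffun j => h (upd b1 i z j)] = upd [ffun j => h (b1 j)] i (h z).
      by apply/ffunP => j; rewrite !ffunE; case: eqP.
    by rewrite Fml.1 !hU linearP F'ml.1; ring.
  rewrite Fml.2 -[in RHS](F'ml.2 u); congr (fp_form p' _ - _).
  by apply/ffunP => j; rewrite !ffunE.
rewrite /G (_ : [ffun i => _] = diag d (h r)); last by apply/ffunP => j; rewrite !ffunE.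
by rewrite mulrAC -FT F'h mulrC mulKf // subrr.
Qed.

Theorem theorem2 (K : closedFieldType) (charK0 : [pchar K]%R =i pred0)
    (n d : nat) (d_ge2 : (2 <= d)%N) :
  one_to_one_correspondence
    (@equivalent_actions K n d) (@equivalent_pairs K n d)
    (@pair_of_action K n d) (@action_of_pair K n d).
Proof.
have d_gt0 : (0 < d)%N by apply: leq_trans d_ge2.
have ab_ba (X : additive_action K n d) (p : form_pair K n d) :
    pair_of_action X p -> action_of_pair p X.
  exact: action_of_pair_of_action.
split.
- by split=> [X|p]; [apply: exists_pair_of_action | apply: exists_action_of_pair].
- by move=> X X' p p' /ab_ba Xp /ab_ba Xp'; apply: (equivalent_pairs_of_actions charK0).
- by move=> p p' X X' Xp Xp'; apply: (equivalent_actions_of_pairs charK0 Xp Xp').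
- move=> X p X' /ab_ba Xp X'p; apply: (equivalent_actions_of_pairs charK0 Xp X'p).
  exists idfun, 1; split=> [||b]; [by exists id | exact: oner_neq0 |].
  by rewrite mul1r; congr fp_form; apply/ffunP => i; rewrite ffunE.
move=> p X p' Xp /ab_ba Xp'.
apply: (equivalent_pairs_of_actions charK0 d_gt0 Xp Xp').
exists id, id; split=> //; first by exists id; split=> //; apply: morphism_id.
exact: (@linear_Ga_automorphism _ _ idfun).
Qed.
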